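(* Let $D\subset\mathbf{R}^n$ be a bounded open region and $1<p<\infty$. Suppose $\max(1,\frac np)<r\le\infty$, and let $q\ge p$ be given by $\frac1r+\frac pq=1$. Suppose $V\in L^r(D)$ and $u\in W_0^{1,p}(D)$ is a nontrivial solution of $-\Delta_p u=V|u|^{p-2}u$. Then $$K_{q,p}^p\,\|V_+\|_r\ge1 .$$ Moreover, let $u_*\ge0$ be a normalized nonnegative extremal for $K_{q,p}$, i.e. $u_*\in W_0^{1,p}(D)$, $u_*\ge 0$, $\|\nabla u_*\|_p=1$, $\|u_*\|_q=K_{q,p}$. Then the equation $-\Delta_p u=V|u|^{p-2}u$ holds with $u=u_*$, and equality $K_{q,p}^p\|V_+\|_r=1$ is attained, when $$V(x)=c_*\,u_*^{q-p}(x),\qquad c_*=\frac1{\|u_*\|_q^q}.$$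
   Context: $D$ is a bounded open region in $\mathbf{R}^n$; nothing is assumed about its boundary. $\Delta_p u=\mathrm{div}(|\nabla u|^{p-2}\nabla u)$. $V$ is real-valued, $V_+=\max(V,0)$, and $u$ may be complex-valued. Solutions are in the distribution sense: $\int_D|\nabla u|^{p-2}\nabla u\cdot\nabla\psi\,dx=\int_D V|u|^{p-2}u\,\psi\,dx$ for all $\psi\in C_0^\infty(D)$ (with $|u|^{p-2}u$ read as $0$ where $u=0$, and likewise for the gradient). The Sobolev constant is $K_{q,p}=\sup_{0\ne u\in W_0^{1,p}(D)}\|u\|_q/\|\nabla u\|_p$, norms being taken over $D$. A normalized nonnegative extremal $u_*$ exists under the stated conditions. When $q=p$, $u_*^{q-p}$ is the constant function $1$. *)

(* Defs.v *)
From HB Require Import structures.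
From mathcomp Require Import all_boot all_order all_algebra complex.
From mathcomp Require Import all_classical all_reals all_analysis.
Set Implicit Arguments.
Unset Strict Implicit.
Unset Printing Implicit Defensive.
Import Order.TTheory GRing.Theory Num.Theory.
Import numFieldTopology.Exports numFieldNormedType.Exports.
Local Open Scope classical_set_scope.
Local Open Scope ring_scope.
Local Open Scope complex_scope.

Definition rV_display : measure_display.
Proof. exact: default_measure_display. Qed.

(* R^n carries the sigma-algebra generated by its coordinates, i.e. the Borel
   one: a function measurable for the completed sigma-algebra has a
   representative measurable for this one. *)
Section measurable_rV.
Variables (R : realType) (n : nat).

Let coord : 'I_n -> 'rV[R]_n -> measurableTypeR R := fun i x => x ord0 i.

Let rV_set0 : g_sigma_preimage coord set0.
Proof. exact: sigma_algebra0. Qed.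

Let rV_setC A : g_sigma_preimage coord A -> g_sigma_preimage coord (~` A).
Proof. exact: sigma_algebraC. Qed.

Let rV_bigcup (F : _^nat) : (forall i, g_sigma_preimage coord (F i)) ->
  g_sigma_preimage coord (\bigcup_i (F i)).
Proof. exact: sigma_algebra_bigcup. Qed.

HB.instance Definition _ := @isMeasurable.Build rV_display
  'rV[R]_n (g_sigma_preimage coord) rV_set0 rV_setC rV_bigcup.

Lemma measurable_coord (i : 'I_n) :
  measurable_fun [set: 'rV[R]_n] (fun x => x ord0 i : measurableTypeR R).
Proof.
move=> _ Y mY; rewrite setTI; apply: sub_sigma_algebra => /=.
rewrite -bigcup_seq/=; exists i => /=; first by rewrite mem_index_enum.
by exists Y => //; rewrite setTI.
Qed.

Lemma measurable_fun_rVP d (T : measurableType d) (f : T -> 'rV[R]_n) :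
  (forall i, measurable_fun [set: T] (fun t => f t ord0 i : measurableTypeR R)) ->
  measurable_fun [set: T] f.
Proof.
move=> mf _ A mA; rewrite setTI.
suff : g_sigma_preimage coord `<=` [set B | measurable (f @^-1` B)] by exact.
apply: smallest_sub.
  split => /=.
  - by rewrite preimage_set0.
  - by move=> B; rewrite setTD preimage_setC; exact: measurableC.
  - by move=> F mF; rewrite preimage_bigcup; exact: bigcup_measurable.
move=> B; rewrite -bigcup_seq/= => -[i _ [Y mY <-]].
by rewrite setTI -(setTI (f @^-1` _)); exact: mf.
Qed.

End measurable_rV.

Section lebesgue_rV_step.
Variables (R : realType) (n : nat).

Definition rV_cons (p : measurableTypeR R * 'rV[R]_n) : 'rV[R]_n.+1 :=
  \row_i oapp (fun j => p.2 ord0 j) p.1 (unlift ord0 i).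

Definition rV_uncons (x : 'rV[R]_n.+1) : measurableTypeR R * 'rV[R]_n :=
  (x ord0 ord0, \row_j x ord0 (lift ord0 j)).

Lemma rV_consK : cancel rV_cons rV_uncons.
Proof.
move=> [a x]; congr pair; first by rewrite mxE unlift_none.
by apply/rowP => j; rewrite !mxE liftK.
Qed.

Lemma rV_unconsK : cancel rV_uncons rV_cons.
Proof.
by move=> x; apply/rowP => i; rewrite mxE; case: unliftP => [j|] ->//=; rewrite mxE.
Qed.

Lemma measurable_rV_cons : measurable_fun setT rV_cons.
Proof.
apply: measurable_fun_rVP => i; case: (unliftP ord0 i) => [j|] ->.
  under eq_fun do rewrite mxE liftK.
  exact: (measurableT_comp (measurable_coord j) measurable_snd).
under eq_fun do rewrite mxE unlift_none.
exact: measurable_fst.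
Qed.

Lemma measurable_rV_uncons : measurable_fun setT rV_uncons.
Proof.
apply: measurable_fun_pair; first exact: measurable_coord.
apply: measurable_fun_rVP => j; under eq_fun do rewrite mxE.
exact: measurable_coord.
Qed.

Variable mu : {sigma_finite_measure set 'rV[R]_n -> \bar R}.

Definition lebesgue_rVS : set 'rV[R]_n.+1 -> \bar R :=
  pushforward (@lebesgue_measure R \x mu)%E rV_cons.

HB.instance Definition _ := Measure.copy lebesgue_rVS
  (measure_function_pushforward__canonical__measure_function_Measure
     (@lebesgue_measure R \x mu)%E measurable_rV_cons).

Let sigma_finite_rVS : sigma_finite setT lebesgue_rVS.
Proof.
have /sigma_finiteP[F [TF ndF Foo]] := sigma_finiteT (@lebesgue_measure R).
have /sigma_finiteP[G [TG ndG Goo]] := sigma_finiteT mu.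
exists (fun k => rV_uncons @^-1` (F k `*` G k)).
  rewrite -preimage_bigcup; apply/seteqP; split => // x _ /=.
  have : [set: _] (rV_uncons x).1 by []. rewrite TF => -[i _ Fi].
  have : [set: _] (rV_uncons x).2 by []. rewrite TG => -[j _ Gj].
  exists (maxn i j) => //; split.
    by move: Fi; exact/subsetPset/ndF/leq_maxl.
  by move: Gj; exact/subsetPset/ndG/leq_maxr.
move=> k; have [mF Fk] := Foo k; have [mG Gk] := Goo k; split.
  by rewrite -(setTI (_ @^-1` _)); apply: measurable_rV_uncons => //; exact: measurableX.
rewrite /lebesgue_rVS /pushforward -comp_preimage.
rewrite (_ : rV_uncons \o rV_cons = idfun); last first.
  by apply/funext => p /=; rewrite rV_consK.
by rewrite preimage_id product_measure1E// lte_mul_pinfty// ge0_fin_numE.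
Qed.

HB.instance Definition _ :=
  Measure_isSigmaFinite.Build _ _ _ lebesgue_rVS sigma_finite_rVS.

Definition lebesgue_rVS_sigma_finite :
  {sigma_finite_measure set 'rV[R]_n.+1 -> \bar R} := lebesgue_rVS.

End lebesgue_rV_step.

(* n-dimensional Lebesgue measure as an iterated product; see lebesgue_rV_box. *)
Fixpoint lebesgue_rV (R : realType) (n : nat) :
    {sigma_finite_measure set 'rV[R]_n -> \bar R} :=
  match n with
  | 0 => \d_(0 : 'rV[R]_0)
  | n'.+1 => lebesgue_rVS_sigma_finite (lebesgue_rV R n')
  end.

Lemma lebesgue_rV_box (R : realType) (n : nat) (a b : 'rV[R]_n) :
  (forall i, a ord0 i <= b ord0 i) ->
  lebesgue_rV R n [set x | forall i, a ord0 i <= x ord0 i <= b ord0 i] =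
  (\prod_(i < n) (b ord0 i - a ord0 i))%:E.
Proof.
elim: n => [|n IH] in a b * => ab.
  by rewrite big_ord0 /= diracE mem_set//; case.
rewrite big_ord_recl /= /lebesgue_rVS /pushforward.
have := IH (rV_uncons a).2 (rV_uncons b).2.
set B := (X in lebesgue_rV R n X) => IHB.
have -> : rV_cons (n:=n) @^-1` [set x | forall i, a ord0 i <= x ord0 i <= b ord0 i]
    = `[a ord0 ord0, b ord0 ord0] `*` B.
  apply/seteqP; split => [[t x] /= h|[t x] /= [ht hx] i].
    split; first by have := h ord0; rewrite mxE unlift_none in_itv.
    by move=> i; have := h (lift ord0 i); rewrite !mxE liftK.
  case: (unliftP ord0 i) => [j|] ->; last first.
    by move: ht; rewrite mxE unlift_none/= in_itv.
  by have := hx j; rewrite !mxE liftK.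
have mB : measurable B.
  rewrite (_ : B = \big[setI/setT]_(j < n) [set x | x ord0 j \in
      `[(rV_uncons a).2 ord0 j, (rV_uncons b).2 ord0 j]]).
    elim/big_ind : _ => [|X Y mX mY|j _]; [exact: measurableT|exact: measurableI|]; rewrite -(setTI [set _ | _]).
    exact: (measurable_coord j measurableT (measurable_itv `[_, _])).
  rewrite -bigcap_seq/=; apply/seteqP; split => x /= h j; first by rewrite /= in_itv/= h.
  by have := h j (mem_index_enum _); rewrite /= in_itv.
rewrite product_measure1E// IHB => [|j]; last by rewrite !mxE.
rewrite /= lebesgue_measure_itv/= lte_fin; have := ab ord0.
rewrite le_eqVlt => /predU1P[->|->]; first by rewrite ltxx subrr mul0e mul0r.
by rewrite -EFinB -EFinM; congr (_ * _)%:E; apply: eq_bigr => j _; rewrite !mxE.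
Qed.

Local Notation Re := complex.Re.
Local Notation Im := complex.Im.
Local Notation normc := ComplexField.Normc.normc.

Section sobolev.
Variables (R : realType) (n : nat).
Local Notation E := 'rV[R]_n.
Local Notation leb := (lebesgue_rV R n).
Implicit Types (D : set E) (p q : R) (r : \bar R).

Definition partial (i : 'I_n) (f : E -> R) : E -> R :=
  fun x => 'D_(delta_mx ord0 i) f x.

(* Every iterated partial derivative is Fréchet differentiable everywhere;
   in particular all of them are continuous, so this is C^infty. *)
Definition smooth (f : E -> R) : Prop :=
  forall (s : seq 'I_n) (x : E), differentiable (foldr partial f s) x.

Definition csupport (f : E -> R[i]) : set E := closure [set x | f x != 0].

Definition test_fun D (f : E -> R[i]) : Prop :=
  [/\ smooth (fun x => Re (f x)), smooth (fun x => Im (f x)),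
      compact (csupport f) & csupport f `<=` D].

Definition grad (f : E -> R[i]) (x : E) : 'rV[R[i]]_n :=
  \row_i (partial i (fun y => Re (f y)) x +i* partial i (fun y => Im (f y)) x).

(* The Hermitian norm of a vector of C^n; the library norm on matrices is the
   sup norm. *)
Definition vnorm (v : 'rV[R[i]]_n) : R :=
  Num.sqrt (\sum_i normc (v ord0 i) ^+ 2).

(* Bilinear, without conjugation. *)
Definition dotC (v w : 'rV[R[i]]_n) : R[i] := \sum_i v ord0 i * w ord0 i.

Definition cintegrable D (f : E -> R[i]) : Prop :=
  leb.-integrable D (fun x => (Re (f x))%:E) /\
  leb.-integrable D (fun x => (Im (f x))%:E).

Definition cintegral D (f : E -> R[i]) : R[i] :=
  (\int[leb]_(x in D) Re (f x)) +i* (\int[leb]_(x in D) Im (f x)).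

Definition cmeasurable D (f : E -> R[i]) : Prop :=
  measurable_fun D (fun x => Re (f x)) /\ measurable_fun D (fun x => Im (f x)).

Definition LnormD D r (f : E -> R) : \bar R := Lnorm leb r ((EFin \o f) \_ D).

Definition LnormDC D r (f : E -> R[i]) : \bar R :=
  LnormD D r (fun x => normc (f x)).

Definition LnormDV D r (f : E -> 'rV[R[i]]_n) : \bar R :=
  LnormD D r (fun x => vnorm (f x)).

Definition in_Lp D r (f : E -> R) : Prop :=
  measurable_fun D f /\ (LnormD D r f < +oo)%E.

Definition in_LpC D r (f : E -> R[i]) : Prop :=
  cmeasurable D f /\ (LnormDC D r f < +oo)%E.

Definition in_LpV D r (f : E -> 'rV[R[i]]_n) : Prop :=
  (forall i, cmeasurable D (fun x => f x ord0 i)) /\ (LnormDV D r f < +oo)%E.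

Definition weak_grad D (u : E -> R[i]) (gu : E -> 'rV[R[i]]_n) : Prop :=
  forall f, test_fun D f -> forall i,
    cintegral D (fun x => u x * grad f x ord0 i) =
    - cintegral D (fun x => gu x ord0 i * f x).

(* Weak gradients are unique only up to null sets, so a Sobolev function is
   handled together with a chosen representative gu of its gradient. *)
Definition W1p D p (u : E -> R[i]) (gu : E -> 'rV[R[i]]_n) : Prop :=
  [/\ in_LpC D p%:E u, in_LpV D p%:E gu & weak_grad D u gu].

(* The closure of the test functions in W1p. *)
Definition W01p D p (u : E -> R[i]) (gu : E -> 'rV[R[i]]_n) : Prop :=
  W1p D p u gu /\
  exists f : nat -> E -> R[i],
    [/\ forall k, test_fun D (f k),
        LnormDC D p%:E (fun x => f k x - u x) @[k --> \oo] --> 0%E &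
        LnormDV D p%:E (fun x => grad (f k) x - gu x) @[k --> \oo] --> 0%E].

Definition ae_zero D (u : E -> R[i]) : Prop :=
  {ae leb, forall x, D x -> u x = 0}.

Definition sobolev_const D q p : \bar R :=
  ereal_sup [set t | exists u gu,
    [/\ W01p D p u gu, ~ ae_zero D u &
        t = (LnormDC D q%:E u / LnormDV D p%:E gu)%E]].

(* Distributional solutions of - div (|gu|^(p-2) gu) = V |u|^(p-2) u.  The
   factors gu and u make the two products 0 at the zeros of gu and u, whatever
   the value of the power there.  Real integrals of non-integrable functions
   have a junk value, whence the integrability clauses. *)
Definition plaplace_sol D p (V : E -> R) (u : E -> R[i])
    (gu : E -> 'rV[R[i]]_n) : Prop :=
  forall f, test_fun D f ->
    let lhs x := (vnorm (gu x) `^ (p - 2))%:C * dotC (gu x) (grad f x) in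
    let rhs x := (V x * normc (u x) `^ (p - 2))%:C * u x * f x in
    [/\ cintegrable D lhs, cintegrable D rhs &
        cintegral D lhs = cintegral D rhs].

End sobolev.

(* Main.v *)
Require Import Defs.
From HB Require Import structures.
From mathcomp Require Import all_boot all_order all_algebra complex.
From mathcomp Require Import all_classical all_reals all_analysis.
From mathcomp Require Import measurable_realfun ess_sup_inf ring lra.
Import Order.TTheory GRing.Theory Num.Theory.
Import numFieldTopology.Exports numFieldNormedType.Exports.
Local Open Scope classical_set_scope.
Local Open Scope ring_scope.
Local Open Scope complex_scope.
Set Implicit Arguments.
Unset Strict Implicit.
Unset Printing Implicit Defensive.

(** The lower bound.  Testing the equation with [u] itself gives
    [int |grad u|^p = int V |u|^p], at most the norm of [V^\+] in [L^r] times the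
    [p]-th power of the [L^q] norm of [u], by Hölder's inequality with exponents
    [r] and [q / p] ([hoelder_potential]).  The Sobolev constant turns the latter
    into the left-hand side, which is positive ([solution_lower_bound]).  As [u]
    is only a limit of test functions, the equation is tested with those; Young's
    inequality absorbs the error provided they converge in [L^q] too
    ([solution_energy], [W01p_approximation_Lq]).

    The embedding.  This convergence, the finiteness of the [L^q] norms and the
    fact that zero gradient implies zero function all come from the subcritical
    Sobolev inequality for test functions ([sobolev_test]): the condition on [r]
    says that [n * (q - p) < p * q] ([subcritical_exponents]).  A test function
    [f] vanishes off the bounded set [D], so [f x] is recovered by integrating
    its gradient along the path [x + s ^ N * y], [0 <= s <= 1], for every [y] in
    a fixed cube far away.  Averaging over [y] bounds [|f|] by the integral over
    [s] of [N * s ^ (N - 1)] times the means of [|grad f|] over cubes of side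
    [s ^ N].  By Jensen's inequality each such mean is bounded in [L^p] and, at
    the cost of a negative power of [s], pointwise; interpolation bounds it in
    [L^q], and for [N] large the factor [s ^ (N - 1)] offsets the negative power.
    Truncation extends the inequality to the closure of the test functions
    ([sobolev_closure]).

    The extremal.  Normalize [int |grad u|^p = 1] and let [j = int |u|^q], so that
    the [q]-th power of the Sobolev constant is [j].  For a test function [f] the
    Sobolev inequality bounds [int |u + t f|^q] by [j] times the power [q / p] of
    [int |grad u + t grad f|^p], with equality at [t = 0].  Both integrals are
    convex in [t].  Bounding the first below by its tangent at [0] and the second
    above by its tangent at [t > 0], dividing by [t] and letting [t] tend to [0]
    gives an inequality between two linear forms in [f], hence an equality
    ([euler_lagrange]): it says that [u] solves the equation with potential
    [V = u^(q - p) / j].  Since [(q - p) r = q], the [L^r] norm of [V] is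
    [j^(1/r - 1) = j^(- p/q)], the inverse of the [p]-th power of the Sobolev
    constant ([LnormD_extremal_potential]). *)

(** * Borel sets of R^n *)
Section measure_rV.
Variables (R : realType).

Lemma measurable_rV_box n (a b : 'rV[R]_n) :
  measurable [set x : 'rV[R]_n | forall i, a ord0 i <= x ord0 i <= b ord0 i].
Proof.
rewrite (_ : [set x | _] = \big[setI/setT]_(j < n) [set x : 'rV[R]_n | x ord0 j \in
    `[a ord0 j, b ord0 j]]).
  elim/big_ind : _ => [|X Y mX mY|j _]; [exact: measurableT|exact: measurableI|].
  rewrite -(setTI [set _ | _]).
  exact: (measurable_coord j measurableT (measurable_itv `[_, _])).
rewrite -bigcap_seq/=; apply/seteqP; split => x /= h j; first by rewrite /= in_itv/= h.
by have := h j (mem_index_enum _); rewrite /= in_itv.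
Qed.

Lemma ball_rV_box n (x : 'rV[R]_n) (e : R) : 0 < e ->
  [set y : 'rV[R]_n | forall i, x ord0 i - e / 2 <= y ord0 i <= x ord0 i + e / 2]
    `<=` ball x e.
Proof.
move=> e0 y /= xy; split => // i j; rewrite (ord1 i) /ball/= ltr_norml.
by have := xy j => /andP[h1 h2]; apply/andP; split; lra.
Qed.

(** The sigma-algebra is generated by the coordinates, so an open set has to be
    written as a countable union of boxes: those with rational corners suffice. *)
Lemma open_measurable_rV n (D : set 'rV[R]_n) : open D -> measurable D.
Proof.
move=> oD.
pose q (c : 'rV[rat]_n * 'rV[rat]_n) := [set x : 'rV[R]_n | forall i,
   (\row_j (ratr (c.1 ord0 j) : R)) ord0 i <= x ord0 i <=
   (\row_j (ratr (c.2 ord0 j) : R)) ord0 i].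
pose F c := if `[< q c `<=` D >] then q c else set0.
have -> : D = \bigcup_c F c.
  apply/seteqP; split => [x Dx|x [c _]]; last first.
    by rewrite /F; case: asboolP => // qD; exact: qD.
  have /nbhs_ballP[e /= e0 eD] := open_nbhs_nbhs (conj oD Dx).
  have h (i : 'I_n) : exists c : rat * rat,
      x ord0 i - e / 2 < ratr c.1 < x ord0 i /\ x ord0 i < ratr c.2 < x ord0 i + e / 2.
    have /rat_in_itvoo[s hs] : x ord0 i - e / 2 < x ord0 i by lra.
    have /rat_in_itvoo[t ht] : x ord0 i < x ord0 i + e / 2 by lra.
    by exists (s, t); move: hs ht; rewrite !in_itv.
  have [f hf] := choice h.
  exists (\row_i (f i).1, \row_i (f i).2) => //; rewrite /F.
  have qx : q (\row_i (f i).1, \row_i (f i).2) x.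
    move=> i /=; rewrite !mxE/=; have [] := hf i.
    by move=> /andP[_ /ltW ->] /andP[/ltW -> _].
  case: asboolP => // -[] y qy; apply: eD; apply: (ball_rV_box e0) => i /=.
  have := qy i; rewrite !mxE/=; have [] := hf i.
  move=> /andP[h1 h2] /andP[h3 h4] /andP[h5 h6]; apply/andP; split; lra.
apply: countable_bigcupT_measurable => [|c]; first exact: countableP.
by rewrite /F; case: asboolP => // _; exact: measurable_rV_box.
Qed.

Lemma continuous_measurable_rV n (f : 'rV[R]_n -> R) :
  continuous f -> measurable_fun [set: 'rV[R]_n] f.
Proof.
move=> cf; apply: (measurability _ (measurable_realfun.RGenOpens.measurableE R)) => _ [_ [a [b ->]] <-].
rewrite setTI; apply: open_measurable_rV.
by move/continuousP : cf; apply; exact: interval_open.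
Qed.

End measure_rV.

(** * Affine changes of variables *)
Section affine.
Variables (R : realType).
Local Open Scope ereal_scope.

Lemma ge0_integral_rV_cons n (f : 'rV[R]_n.+1 -> \bar R) :
  measurable_fun setT f -> (forall x, 0 <= f x) ->
  \int[lebesgue_rV R n.+1]_x f x =
  \int[@lebesgue_measure R]_a \int[lebesgue_rV R n]_x f (rV_cons (a, x)).
Proof.
move=> mf f0.
have := @ge0_integral_pushforward _ _ _ _ R _ (@measurable_rV_cons R n)
  (@lebesgue_measure R \x lebesgue_rV R n) setT f measurableT mf.
move=> -> //; rewrite preimage_setT.
rewrite fubini_tonelli1//; last by move=> x /=.
exact: measurableT_comp mf (@measurable_rV_cons R n).
Qed.

(** The pushforward of Lebesgue measure under [a => s * a + b], scaled by [s],
    gives intervals their length, hence is Lebesgue measure. *)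
Lemma ge0_integral_affine (f : R -> \bar R) (s b : R) : (0 < s)%R ->
  measurable_fun setT f -> (forall x, 0 <= f x) ->
  \int[@lebesgue_measure R]_a f (s * a + b)%R =
  (s^-1)%:E * \int[@lebesgue_measure R]_a f a.
Proof.
move=> s0 mf f0.
have mphi : measurable_fun setT (fun a : measurableTypeR R => (s * a + b)%R : measurableTypeR R).
  by apply: measurable_funD => //; apply: measurable_funM.
have sI : (0 <= s)%R by exact: ltW.
pose m := mscale (NngNum sI)
  (measure_function_pushforward__canonical__measure_function_Measure (@lebesgue_measure R) mphi).
have mE A : measurable A -> lebesgue_measure A = m A.
  apply: lebesgue_measure_unique => X -[[x y] /= _ <-].
  rewrite /m /mscale/= /pushforward.
  rewrite (_ : _ @^-1` _ = [set` `](x - b) / s, (y - b) / s]%R]); last first.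
    apply/seteqP; split => z /=; rewrite !in_itv/= ltr_pdivrMr// ler_pdivlMr//;
    by rewrite ltrBlDr lerBrDr mulrC.
  rewrite !lebesgue_measure_itv/= !lte_fin ltr_pM2r ?invr_gt0// ltrD2r.
  case: ifPn => _; last by rewrite mule0.
  rewrite -!EFinB -EFinM; congr EFin; field; exact: lt0r_neq0.
transitivity ((s^-1)%:E * \int[m]_a f a); last first.
  by congr (_ * _); apply: eq_measure_integral => A mA _; exact/esym/mE.
rewrite ge0_integral_mscale//= muleA -EFinM mulVf ?lt0r_neq0// mul1e.
by rewrite ge0_integral_pushforward.
Qed.

Lemma measurable_affine_rV n (s : R) (b : 'rV[R]_n) :
  measurable_fun [set: 'rV[R]_n] (fun x : 'rV[R]_n => s *: x + b)%R.
Proof.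
apply: measurable_fun_rVP => i.
under eq_fun do rewrite !mxE.
apply: measurable_funD => //; apply: measurable_funM => //; exact: measurable_coord.
Qed.

(** Induction on the dimension, one coordinate at a time. *)
Lemma ge0_integral_affine_rV n (f : 'rV[R]_n -> \bar R) (s : R) (b : 'rV[R]_n) :
  (0 < s)%R ->
  measurable_fun setT f -> (forall x, 0 <= f x) ->
  \int[lebesgue_rV R n]_x f (s *: x + b)%R =
  (s ^- n)%:E * \int[lebesgue_rV R n]_x f x.
Proof.
move=> s0; elim: n => [|n IH] in f b * => mf f0.
  rewrite expr0 invr1 mul1e; apply: eq_integral => x _; congr f.
  by apply/rowP => -[].
have mf' : measurable_fun setT (fun x : 'rV[R]_n.+1 => f (s *: x + b)%R).
  exact: measurableT_comp mf (measurable_affine_rV _ _).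
rewrite !ge0_integral_rV_cons//.
pose b' : 'rV[R]_n := (\row_j b ord0 (lift ord0 j))%R.
transitivity (\int[@lebesgue_measure R]_a \int[lebesgue_rV R n]_x
    f (rV_cons ((s * a + b ord0 ord0)%R, (s *: x + b')%R))).
  apply: eq_integral => a _; apply: eq_integral => x _; congr f.
  apply/rowP => i; rewrite !mxE; case: unliftP => [j|] ->/=; rewrite ?mxE//.
have mc a : measurable_fun setT (fun x : 'rV[R]_n => f (rV_cons (a : R, x))).
  apply: (measurableT_comp mf).
  apply: (measurableT_comp (@measurable_rV_cons R n)).
  exact: measurable_pair1.
transitivity (\int[@lebesgue_measure R]_a ((s ^- n)%:E *
   \int[lebesgue_rV R n]_x f (rV_cons ((s * a + b ord0 ord0)%R, x)))).
  apply: eq_integral => a _; exact: (IH (fun x => f (rV_cons (_, x)))).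
have mF : measurable_fun setT (fun a : R => \int[lebesgue_rV R n]_x f (rV_cons (a, x))).
  apply: (@measurable_fun_fubini_tonelli_F _ _ _ _ R (lebesgue_rV R n)
    (fun z => f (rV_cons z))) => //.
  exact: (measurableT_comp mf (@measurable_rV_cons R n)).
rewrite ge0_integralZl//; last 3 first.
- apply: (measurableT_comp mF).
  by apply: measurable_funD => //; apply: measurable_funM.
- by move=> a _; exact: integral_ge0.
- by rewrite lee_fin invr_ge0 exprn_ge0// ltW.
rewrite (ge0_integral_affine (f := fun a => \int[lebesgue_rV R n]_x f (rV_cons (a, x))))//.
  by rewrite muleA -EFinM exprSr invfM.
by move=> a; exact: integral_ge0.
Qed.

End affine.

(** * Volume of bounded sets and of open sets *)
Section volume.
Variables (R : realType).
Local Open Scope ereal_scope.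

Lemma lebesgue_rV_cube n (a b : R) : (a <= b)%R ->
  lebesgue_rV R n [set x | forall i, a <= x ord0 i <= b]%R = ((b - a) ^+ n)%:E.
Proof.
move=> ab.
have := @lebesgue_rV_box R n (const_mx a) (const_mx b).
rewrite (_ : [set x | _] = [set x | forall i, a <= x ord0 i <= b]%R); last first.
  by apply/seteqP; split => x /= h i; have := h i; rewrite !mxE.
move=> -> => [|i]; last by rewrite !mxE.
by under eq_bigr do rewrite !mxE; rewrite prodr_const card_ord.
Qed.

Lemma bounded_norm_le (V : normedModType R) (A : set V) : bounded_set A ->
  exists2 K : R, (0 <= K)%R & forall x, A x -> (`|x| <= K)%R.
Proof.
move=> [M [_ hM]]; exists (`|M| + 1)%R; first by rewrite addr_ge0.
by move=> x Ax; apply: (hM (`|M| + 1)%R) => //; rewrite (le_lt_trans (ler_norm _))// ltrDl.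
Qed.

Lemma rV_norm_coord n (x : 'rV[R]_n) i : (`|x ord0 i| <= `|x|)%R.
Proof. by rewrite {2}/Num.norm/= mx_normrE; exact: (le_bigmax _ _ (ord0, i)). Qed.

Lemma lebesgue_rV_bounded_lty n (D : set 'rV[R]_n) :
  measurable D -> bounded_set D -> lebesgue_rV R n D < +oo.
Proof.
move=> mD /bounded_norm_le[K K0 hM].
apply: (@le_lt_trans _ _ (lebesgue_rV R n [set x | forall i, - K <= x ord0 i <= K]%R)).
  apply: le_measure; rewrite ?inE//.
    have := @measurable_rV_box R n (const_mx (- K)%R) (const_mx K).
    by congr measurable; apply/seteqP; split => x /= h i; have := h i; rewrite !mxE.
  move=> x Dx i /=; rewrite -ler_norml.
  by rewrite (le_trans (rV_norm_coord x i))// hM.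
rewrite lebesgue_rV_cube ?ltry//.
by rewrite (le_trans _ K0)// oppr_le0.
Qed.

Lemma lebesgue_rV_open_gt0 n (D : set 'rV[R]_n) :
  open D -> D !=set0 -> 0 < lebesgue_rV R n D.
Proof.
move=> oD [x Dx].
have /nbhs_ballP[e /= e0 eD] := open_nbhs_nbhs (conj oD Dx).
pose a := (x - const_mx (e / 2))%R; pose b := (x + const_mx (e / 2))%R.
have ab i : (a ord0 i <= b ord0 i)%R by rewrite !mxE; lra.
apply: (@lt_le_trans _ _ (\prod_(i < n) (b ord0 i - a ord0 i))%:E).
  rewrite lte_fin; apply: prodr_gt0 => i _; rewrite !mxE; lra.
rewrite -lebesgue_rV_box//; apply: le_measure; rewrite ?inE.
- exact: measurable_rV_box.
- exact: open_measurable_rV.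
move=> y /= yab; apply: eD; apply: (ball_rV_box e0) => i /=.
by have := yab i; rewrite !mxE.
Qed.

End volume.

(** * Inequalities for real powers *)
Section powers.
Variables (R : realType).
Implicit Types a b m p e : R.

(** The convex function [x => x ^ m] lies above its tangent at [b]; this is
    Young's inequality for conjugate exponents. *)
Lemma powR_tangent a b m : 0 <= a -> 0 <= b -> 1 <= m ->
  m * (a * b `^ (m - 1)) <= a `^ m + (m - 1) * b `^ m.
Proof.
move=> a0 b0; rewrite le_eqVlt => /predU1P[<-|m1].
  by rewrite subrr powRr0 mul0r addr0 mul1r mulr1 powRr1.
have m0 : 0 < m by lra.
have m10 : 0 < m - 1 by lra.
have := @conjugate_powR R a (b `^ (m - 1)) m (m / (m - 1)) a0 (powR_ge0 _ _) m0.
rewrite divr_gt0// => /(_ isT) h.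
have {h} : a * b `^ (m - 1) <= a `^ m / m + b `^ m / (m / (m - 1)).
  rewrite (_ : b `^ m = (b `^ (m - 1)) `^ (m / (m - 1))).
    by apply: h; field; rewrite !lt0r_neq0.
  by rewrite -powRrM mulrCA mulfV ?lt0r_neq0// mulr1.
rewrite -(ler_pM2l m0) => /le_trans; apply.
rewrite le_eqVlt; apply/orP; left; apply/eqP; field.
by rewrite !lt0r_neq0.
Qed.

(** The tangent at [1 + x], evaluated at [1]: an upper bound whose slope is
    taken at the perturbed point. *)
Lemma powR_bernoulli (x m : R) : 0 <= 1 + x -> 1 <= m ->
  (1 + x) `^ m <= 1 + m * (x * (1 + x) `^ (m - 1)).
Proof.
move=> x0 m1; have := powR_tangent ler01 x0 m1.
rewrite powR1 mul1r -(@mulr_powRB1 _ (1 + x) m)//; last by lra.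
set y := (1 + x) `^ (m - 1); nra.
Qed.

Lemma powR_addr_le a b p : 0 <= a -> 0 <= b -> 0 <= p ->
  (a + b) `^ p <= 2 `^ p * (a `^ p + b `^ p).
Proof.
move=> a0 b0 p0.
wlog ab : a b a0 b0 / a <= b.
  move=> h; have [/h|/ltW/h] := leP a b; first exact.
  by rewrite addrC [X in _ * X]addrC; exact.
apply: (@le_trans _ _ ((2 * b) `^ p)).
  by apply: ge0_ler_powR; rewrite ?nnegrE ?addr_ge0 ?mulr_ge0//; lra.
by rewrite powRM// ler_pM2l ?powR_gt0// lerDr powR_ge0.
Qed.

(** Young's inequality without its sharp constants: compare [a] with [b / e]. *)
Lemma powR_young a b p e : 0 <= a -> 0 <= b -> 1 <= p -> 0 < e ->
  a `^ (p - 1) * b <= e * a `^ p + e * (b / e) `^ p.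
Proof.
move=> a0 b0 p1 e0; rewrite -mulrDr.
rewrite -[X in _ * X <= _](@divfK _ e) ?lt0r_neq0//  mulrA [leLHS]mulrC ler_pM2l//.
have c0 : 0 <= b / e by rewrite divr_ge0// ltW.
have h : forall u v : R, 0 <= u -> 0 <= v -> u <= v -> u `^ (p - 1) * v <= v `^ p.
  move=> u v u0 v0 uv; rewrite -[leRHS]mulr_powRB1//; last by lra.
  by rewrite mulrC ler_wpM2l// ge0_ler_powR ?nnegrE//; lra.
have [ac|/ltW ca] := leP a (b / e).
  by rewrite (le_trans (h _ _ a0 c0 ac))// lerDr powR_ge0.
rewrite (@le_trans _ _ (a `^ p))// ?lerDl ?powR_ge0// -[leRHS]mulr_powRB1//; last by lra.
by rewrite mulrC ler_wpM2r// powR_ge0.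
Qed.

Lemma powR_mulB2 a p : 0 <= a -> 1 < p -> a `^ (p - 2) * a = a `^ (p - 1).
Proof.
move=> a0 p1; rewrite mulrC (_ : p - 2 = (p - 1) - 1); last by ring.
by rewrite mulr_powRB1// subr_gt0.
Qed.

Lemma powR_mulB2_sqr a p : 0 <= a -> 1 < p -> a `^ (p - 2) * a ^+ 2 = a `^ p.
Proof.
move=> a0 p1; rewrite expr2 mulrA powR_mulB2// mulrC mulr_powRB1//.
exact: lt_trans p1.
Qed.

Lemma powR_le1D a s p : 0 <= a -> 0 <= s -> s <= p -> a `^ s <= 1 + a `^ p.
Proof.
move=> a0 s0 sp; have [a1|/ltW a1] := leP a 1.
  rewrite (@le_trans _ _ 1)// ?lerDl ?powR_ge0//.
  have := @ge0_ler_powR _ s s0 a 1; rewrite !nnegrE powR1; exact.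
by rewrite (le_trans (ler_powR a1 sp))// lerDr.
Qed.

Lemma ler1D_powR (x p : R) : 0 <= x -> 1 <= p -> x <= 1 + x `^ p.
Proof.
by move=> x0 /(powR_le1D x0 ler01); rewrite powRr1.
Qed.

(** Integrate the tangent inequality at the mean [c] of [f]. *)
Lemma jensen_powR d (T : measurableType d) (mu : {measure set T -> \bar R})
    (A : set T) (f : T -> R) p :
  measurable A -> mu A = 1%E -> 1 <= p ->
  measurable_fun A f -> (forall x, A x -> 0 <= f x) ->
  ((\int[mu]_(x in A) (f x)%:E) `^ p <= \int[mu]_(x in A) (f x `^ p)%:E)%E.
Proof.
move=> mA muA p1 mf f0.
have p0 : 0 < p by lra.
have mfp : measurable_fun A (fun x => (f x `^ p)%:E).
  by apply/measurable_EFinP; apply: (measurableT_comp (measurable_powR p)).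
have mfe : measurable_fun A (fun x => (f x)%:E) by exact/measurable_EFinP.
have [->|] := eqVneq (\int[mu]_(x in A) (f x `^ p)%:E)%E +oo%E; first exact: leey.
rewrite -ltey => Ifp.
have If0 : (0 <= \int[mu]_(x in A) (f x)%:E)%E.
  by apply: integral_ge0 => x Ax; rewrite lee_fin f0.
have If : (\int[mu]_(x in A) (f x)%:E < +oo)%E.
  apply: (@le_lt_trans _ _ (\int[mu]_(x in A) (1%:E + (f x `^ p)%:E))%E).
    apply: ge0_le_integral => //.
    - by apply: emeasurable_funD.
    - by move=> x Ax; rewrite -EFinD lee_fin ler1D_powR// f0.
  rewrite ge0_integralD//; last by move=> x Ax; rewrite lee_fin powR_ge0.
  by rewrite integral_cst// mul1e muA lte_add_pinfty// ltry.
have /fineK : (\int[mu]_(x in A) (f x)%:E)%E \is a fin_num by rewrite ge0_fin_numE.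
set c := fine _ => cE; rewrite -cE poweR_EFin.
have c0 : 0 <= c by apply: fine_ge0.
have : ((p * c `^ (p - 1))%:E * \int[mu]_(x in A) (f x)%:E <=
    \int[mu]_(x in A) (f x `^ p)%:E + ((p - 1) * c `^ p)%:E)%E.
  rewrite -ge0_integralZl_EFin//; last by rewrite mulr_ge0 ?powR_ge0// ltW.
  rewrite -[X in (_ <= _ + X)%E]mule1 -muA -integral_cst// -ge0_integralD//; last 2 first.
  - by move=> x Ax; rewrite lee_fin powR_ge0.
  - by move=> x Ax; rewrite lee_fin mulr_ge0 ?powR_ge0//; lra.
  apply: ge0_le_integral => //.
  - by move=> x Ax; rewrite -EFinM lee_fin mulr_ge0 ?f0// mulr_ge0 ?powR_ge0// ltW.
  - exact: measurable_funeM.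
  - by apply: emeasurable_funD.
  move=> x Ax; rewrite -EFinM -EFinD lee_fin -mulrA [_ * f x]mulrC.
  exact: powR_tangent (f0 _ Ax) c0 p1.
rewrite -cE -EFinM.
have /fineK <- : (\int[mu]_(x in A) (f x `^ p)%:E)%E \is a fin_num.
  by rewrite ge0_fin_numE//; apply: integral_ge0 => x Ax; rewrite lee_fin powR_ge0.
rewrite -EFinD !lee_fin -mulrA [_ * c]mulrC mulr_powRB1//.
by move=> h; lra.
Qed.

End powers.

(** * The Hermitian norm and the subgradient of its powers *)

Section hermitian.
Variables (R : realType).
Local Notation Re := complex.Re.
Local Notation Im := complex.Im.
Local Notation normc := ComplexField.Normc.normc.

(** The real inner product underlying [vnorm]: the variational argument only
    sees the real structure of C^m. *)
Definition rdot m (z w : 'rV[R[i]]_m) : R :=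
  \sum_i (Re (z ord0 i) * Re (w ord0 i) + Im (z ord0 i) * Im (w ord0 i)).

Lemma vnorm_ge0 m (z : 'rV[R[i]]_m) : 0 <= vnorm z.
Proof. exact: sqrtr_ge0. Qed.

Lemma sqr_normc_ReIm (z : R[i]) : normc z ^+ 2 = Re z ^+ 2 + Im z ^+ 2.
Proof. by case: z => a b; rewrite /= sqr_sqrtr// addr_ge0 ?sqr_ge0. Qed.

Lemma normc_ge0 (z : R[i]) : 0 <= normc z.
Proof. by case: z => a b; exact: sqrtr_ge0. Qed.

Lemma sqr_vnorm m (z : 'rV[R[i]]_m) : vnorm z ^+ 2 = rdot z z.
Proof.
rewrite sqr_sqrtr; last by apply: sumr_ge0 => i _; exact: sqr_ge0.
by apply: eq_bigr => i _; rewrite sqr_normc_ReIm !expr2.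
Qed.

Lemma rdotC m (z w : 'rV[R[i]]_m) : rdot z w = rdot w z.
Proof. by apply: eq_bigr => i _; rewrite mulrC [X in _ + X]mulrC. Qed.

Lemma ReD (a b : R[i]) : Re (a + b) = Re a + Re b. Proof. by case: a b => ? ? []. Qed.
Lemma ImD (a b : R[i]) : Im (a + b) = Im a + Im b. Proof. by case: a b => ? ? []. Qed.
Lemma ReZ (t : R) (a : R[i]) : Re (t%:C * a) = t * Re a.
Proof. by case: a => ? ? /=; rewrite mul0r subr0. Qed.
Lemma ImZ (t : R) (a : R[i]) : Im (t%:C * a) = t * Im a.
Proof. by case: a => ? ? /=; rewrite mul0r addr0. Qed.

Lemma rdotDl m (z1 z2 w : 'rV[R[i]]_m) : rdot (z1 + z2) w = rdot z1 w + rdot z2 w.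
Proof.
by rewrite /rdot -big_split; apply: eq_bigr => i _; rewrite /= !mxE ReD ImD; ring.
Qed.

Lemma rdotZl m (t : R) (z w : 'rV[R[i]]_m) : rdot (t%:C *: z) w = t * rdot z w.
Proof.
by rewrite /rdot mulr_sumr; apply: eq_bigr => i _; rewrite /= !mxE ReZ ImZ; ring.
Qed.

Lemma rdotDr m (z w1 w2 : 'rV[R[i]]_m) : rdot z (w1 + w2) = rdot z w1 + rdot z w2.
Proof. by rewrite rdotC rdotDl !(rdotC z). Qed.

Lemma rdotZr m (t : R) (z w : 'rV[R[i]]_m) : rdot z (t%:C *: w) = t * rdot z w.
Proof. by rewrite rdotC rdotZl (rdotC z). Qed.

Lemma rdot_ge0 m (z : 'rV[R[i]]_m) : 0 <= rdot z z.
Proof. by rewrite -sqr_vnorm sqr_ge0. Qed.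

Lemma vnorm_eq0 m (z : 'rV[R[i]]_m) : vnorm z = 0 -> z = 0.
Proof.
move=> z0; have : \sum_i normc (z ord0 i) ^+ 2 = 0.
  have := sqr_vnorm z; rewrite z0 expr0n/= => /esym; rewrite /rdot => h.
  by rewrite -[RHS]h; apply: eq_bigr => i _; rewrite sqr_normc_ReIm !expr2.
move/eqP; rewrite psumr_eq0 => [|i _]; last exact: sqr_ge0.
move=> /allP h; apply/rowP => i; rewrite mxE.
have := h i (mem_index_enum _); rewrite sqrf_eq0 => /eqP.
exact: ComplexField.Normc.eq0_normc.
Qed.

Lemma rdot0l m (w : 'rV[R[i]]_m) : rdot 0 w = 0.
Proof. by rewrite /rdot big1// => i _; rewrite mxE/= !mul0r addr0. Qed.

Lemma rdot_le m (z w : 'rV[R[i]]_m) : rdot z w <= vnorm z * vnorm w.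
Proof.
have [/vnorm_eq0->|z0] := eqVneq (vnorm z) 0.
  by rewrite rdot0l mulr_ge0 ?vnorm_ge0.
have [/vnorm_eq0->|w0] := eqVneq (vnorm w) 0.
  by rewrite rdotC rdot0l mulr_ge0 ?vnorm_ge0.
have zp : 0 < vnorm z by rewrite lt0r z0 vnorm_ge0.
have wp : 0 < vnorm w by rewrite lt0r w0 vnorm_ge0.
have := rdot_ge0 ((vnorm w)%:C *: z + (- vnorm z)%:C *: w).
rewrite !(rdotDl, rdotDr, rdotZl, rdotZr) -!sqr_vnorm (rdotC w z).
set a := vnorm z in zp *; set b := vnorm w in wp *; set s := rdot z w.
move=> h; have : 0 <= (2 * (a * b)) * (a * b - s) by nra.
by rewrite pmulr_rge0 ?subr_ge0// !mulr_gt0.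
Qed.

Lemma vnormN m (z : 'rV[R[i]]_m) : vnorm (- z) = vnorm z.
Proof. by congr Num.sqrt; apply: eq_bigr => i _; rewrite mxE normcN. Qed.

Lemma normr_rdot_le m (z w : 'rV[R[i]]_m) : `|rdot z w| <= vnorm z * vnorm w.
Proof.
rewrite ler_norml lerNl rdot_le andbT -(vnormN z) -[- rdot _ _]mulN1r -rdotZl.
by rewrite (_ : _ *: z = - z) ?rdot_le// raddfN scaleN1r.
Qed.

Lemma vnormD m (z w : 'rV[R[i]]_m) : vnorm (z + w) <= vnorm z + vnorm w.
Proof.
rewrite -(@ler_pXn2r _ 2)// ?nnegrE ?addr_ge0 ?vnorm_ge0//.
rewrite sqr_vnorm !(rdotDl, rdotDr) -!sqr_vnorm (rdotC w z).
have := rdot_le z w; nra.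
Qed.

Lemma vnormB m (z w : 'rV[R[i]]_m) : vnorm (z - w) <= vnorm z + vnorm w.
Proof. by rewrite -(vnormN w) vnormD. Qed.

Lemma vnormZ m (t : R) (z : 'rV[R[i]]_m) : vnorm (t%:C *: z) = `|t| * vnorm z.
Proof.
apply/eqP; rewrite -(@eqrXn2 _ 2)// ?mulr_ge0 ?vnorm_ge0//.
by rewrite exprMn !sqr_vnorm rdotZl rdotZr mulrA -expr2 real_normK// num_real.
Qed.

(** Scalars are vectors of length one: the inequalities for gradients also
    serve for functions. *)
Definition crow (z : R[i]) : 'rV[R[i]]_1 := const_mx z.

Lemma vnorm_crow z : vnorm (crow z) = normc z.
Proof. by rewrite /vnorm big_ord1 mxE sqrtr_sqr ger0_norm// normc_ge0. Qed.

(** The subgradient inequality of the convex function [vnorm ^ p]: combine the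
    tangent inequality for [x ^ p] with Cauchy-Schwarz. *)
Lemma vnorm_powR_subgrad m (z w : 'rV[R[i]]_m) p : 1 <= p ->
  vnorm z `^ p + p * (vnorm z `^ (p - 2) * rdot z w) <= vnorm (z + w) `^ p.
Proof.
move=> p1; set a := vnorm z; set b := vnorm (z + w).
have a0 : 0 <= a := vnorm_ge0 _; have b0 : 0 <= b := vnorm_ge0 _.
have h := powR_tangent b0 a0 p1.
have [a0'|aN0] := eqVneq a 0.
  have /vnorm_eq0 z0 : vnorm z = 0 by [].
  rewrite z0 rdot0l mulr0 mulr0 addr0.
  apply: ge0_ler_powR; rewrite ?nnegrE//; last by rewrite a0'.
  lra.
have ap : 0 < a by rewrite lt0r aN0.
have e1 : a `^ (p - 1) = a * a `^ (p - 2).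
  by rewrite -{2}(powRr1 a0) -powRD ?aN0 ?implybT//; congr (_ `^ _); lra.
have e2 : a `^ p = a ^+ 2 * a `^ (p - 2).
  rewrite -(powR_mulrn 2 a0) -powRD ?aN0 ?implybT//; congr (_ `^ _); lra.
have h2 : a ^+ 2 + rdot z w <= a * b.
  have := rdot_le z (z + w); by rewrite rdotDr -sqr_vnorm.
have c0 := powR_ge0 a (p - 2).
move: h; rewrite e1 e2; set c := a `^ (p - 2) in c0 *; set B := b `^ p; set d := rdot z w in h2 *.
move=> h.
have : p * c * (a ^+ 2 + d) <= p * c * (a * b) by apply: ler_wpM2l => //; rewrite mulr_ge0//; lra.
nra.
Qed.

(** [p * pairing p z w] is the derivative at [z] of [vnorm ^ p] in the
    direction [w]; the equation pairs gradients in this way. *)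
Definition pairing p m (z w : 'rV[R[i]]_m) : R := vnorm z `^ (p - 2) * rdot z w.

Lemma pairingZr p (t : R) m (z w : 'rV[R[i]]_m) :
  pairing p z (t%:C *: w) = t * pairing p z w.
Proof. by rewrite /pairing rdotZr; ring. Qed.

Lemma pairing_le p m (z w : 'rV[R[i]]_m) : 1 < p ->
  `|pairing p z w| <= vnorm z `^ (p - 1) * vnorm w.
Proof.
move=> p1; rewrite /pairing normrM (ger0_norm (powR_ge0 _ _)).
apply: (le_trans (ler_wpM2l (powR_ge0 _ _) (normr_rdot_le z w))).
by rewrite mulrA powR_mulB2 ?vnorm_ge0.
Qed.

(** Pairing with [w] instead of [z] costs an error that is small relative to
    [vnorm z ^ p] once [w] is close to [z]. *)
Lemma vnorm_pairing_young p m (z w : 'rV[R[i]]_m) (e : R) : 1 < p -> 0 < e ->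
  `|vnorm z `^ p - pairing p z w| <=
  e * vnorm z `^ p + e * (vnorm (w - z) / e) `^ p.
Proof.
move=> p1 e0.
have -> : vnorm z `^ p - pairing p z w = - pairing p z (w - z).
  have zw : rdot z w = rdot z (w - z) + rdot z z by rewrite -rdotDr subrK.
  by rewrite -(powR_mulB2_sqr (vnorm_ge0 z) p1) sqr_vnorm /pairing zw; ring.
rewrite normrN; apply: (le_trans (pairing_le _ _ p1)).
by apply: powR_young; rewrite ?vnorm_ge0// ltW.
Qed.

(** The bilinear product of the equation, tested against a conjugate, yields
    the real inner product. *)
Lemma rdot_conj m (z w : 'rV[R[i]]_m) : Re (dotC z (map_mx conjc w)) = rdot z w.
Proof.
rewrite /dotC /rdot; elim/big_ind2 : _ => //[a b c e <- <-|i _]; first by rewrite ReD.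
by rewrite mxE; case: (z _ _) (w _ _) => a b [c e] /=; ring.
Qed.

Lemma vnorm_conj m (z : 'rV[R[i]]_m) : vnorm (map_mx conjc z) = vnorm z.
Proof.
congr Num.sqrt; apply: eq_bigr => i _; rewrite !mxE !sqr_normc_ReIm.
by case: (z _ _) => a b /=; rewrite sqrrN.
Qed.

Lemma Re_dotC_le m (z w : 'rV[R[i]]_m) : `|Re (dotC z w)| <= vnorm z * vnorm w.
Proof.
have -> : Re (dotC z w) = rdot z (map_mx conjc w).
  by rewrite -rdot_conj; congr (Re (dotC _ _)); apply/rowP => i; rewrite !mxE conjcK.
by rewrite -(vnorm_conj w) normr_rdot_le.
Qed.

Lemma Im_dotC_le m (z w : 'rV[R[i]]_m) : `|Im (dotC z w)| <= vnorm z * vnorm w.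
Proof.
have -> : Im (dotC z w) = - Re (dotC z ('i%C *: w)).
  rewrite -[RHS]/(- (Re (\sum_i _))) -[LHS]/(Im (\sum_i _)).
  elim/big_rec2 : _ => [|i a b _]; first by rewrite /= oppr0.
  rewrite ImD ReD => ->; rewrite mxE opprD; congr (_ + _).
  by case: (z _ _) (w _ _) => ? ? [? ?] /=; ring.
rewrite normrN (le_trans (Re_dotC_le _ _))// ler_wpM2l ?vnorm_ge0//.
rewrite le_eqVlt; apply/orP; left; apply/eqP; congr Num.sqrt.
apply: eq_bigr => i _; rewrite !mxE !sqr_normc_ReIm.
by case: (w _ _) => a b /=; ring.
Qed.

End hermitian.

(** * Test functions *)
Section smooth_functions.
Variables (R : realType) (n : nat).
Local Notation E := 'rV[R]_n.
Local Notation Re := complex.Re.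
Local Notation Im := complex.Im.
Local Notation normc := ComplexField.Normc.normc.

Lemma smooth_differentiable (f : E -> R) x : smooth f -> differentiable f x.
Proof. by move=> /(_ [::] x). Qed.

Lemma smooth_continuous (f : E -> R) : smooth f -> continuous f.
Proof. by move=> sf x; apply: differentiable_continuous; exact: smooth_differentiable. Qed.

Lemma smooth_partial_continuous (f : E -> R) i : smooth f -> continuous (partial i f).
Proof. by move=> sf x; apply: differentiable_continuous; exact: (sf [:: i] x). Qed.

Lemma derive_lin (f g : E -> R) (a b : R) x v :
  differentiable f x -> differentiable g x ->
  'D_v (fun y => a * f y + b * g y) x = a * 'D_v f x + b * 'D_v g x.
Proof.
move=> df dg.
have dfv : derivable (f : E -> R^o) x v by exact: diff_derivable.
have dgv : derivable (g : E -> R^o) x v by exact: diff_derivable.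
have := deriveD (derivableZ (k := a) dfv) (derivableZ (k := b) dgv).
by rewrite (deriveZ a dfv) (deriveZ b dgv).
Qed.

Lemma differentiable_lin (f g : E -> R) (a b : R) x :
  differentiable f x -> differentiable g x ->
  differentiable (fun y => a * f y + b * g y) x.
Proof.
move=> df dg; apply: (@differentiableD _ _ _ (a *: (f : E -> R^o))
  (b *: (g : E -> R^o))); exact: differentiableZ.
Qed.

Lemma partial_lin (f g : E -> R) (a b : R) i x :
  differentiable f x -> differentiable g x ->
  partial i (fun x => a * f x + b * g x) x = a * partial i f x + b * partial i g x.
Proof. exact: derive_lin. Qed.

(** Combinations [a * f + b * g] cover at once sums, complex multiples and
    conjugates of complex test functions. *)
Lemma smooth_lin (f g : E -> R) (a b : R) :
  smooth f -> smooth g -> smooth (fun x => a * f x + b * g x).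
Proof.
move=> sf sg.
have h s : foldr (@partial R n) (fun x => a * f x + b * g x) s =
    (fun x => a * foldr (@partial R n) f s x + b * foldr (@partial R n) g s x).
  elim: s => //= i s ->; apply/funext => x.
  by rewrite partial_lin; [|exact: sf|exact: sg].
by move=> s x; rewrite h; apply: differentiable_lin; [exact: sf|exact: sg].
Qed.

Lemma partial_supp (K : set E) (f : E -> R) i :
  closed K -> (forall x, ~ K x -> f x = 0) -> forall x, ~ K x -> partial i f x = 0.
Proof.
move=> cK f0 x Kx; rewrite /partial (@near_eq_derive _ _ _ f (cst 0))//.
  by rewrite derive_cst.
have oK : open (~` K) by exact: closed_openC.
by apply: filterS (open_nbhs_nbhs (conj oK Kx)) => y /f0.
Qed.

Lemma compact_supp_bounded (K : set E) (f : E -> R) :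
  compact K -> (forall x, ~ K x -> f x = 0) -> continuous f ->
  exists2 M, 0 <= M & forall x, `|f x| <= M.
Proof.
move=> cK f0 cf.
have : bounded_set (f @` K).
  apply: compact_bounded; apply: continuous_compact => //.
  exact: continuous_subspaceT.
move=> /bounded_norm_le[M M0 hM]; exists M => // x.
have [Kx|/f0 ->] := pselect (K x); last by rewrite normr0.
by apply: hM; exists x.
Qed.

(** Any compact set outside which [f] vanishes replaces the support. *)
Lemma test_funP (D : set E) (f : E -> R[i]) : test_fun D f <->
  [/\ smooth (fun x => Re (f x)), smooth (fun x => Im (f x)) &
      exists K, [/\ compact K, K `<=` D & forall x, ~ K x -> f x = 0]].
Proof.
split=> [[sr si cK KD]|[sr si [K [cK KD f0]]]].
  split => //; exists (csupport f); split => // x.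
  apply: contra_notP => /eqP fx; exact: subset_closure.
have hK : csupport f `<=` K.
  rewrite /csupport [X in _ `<=` X](closure_id K).1; last first.
    exact: compact_closed (@norm_hausdorff _ _) cK.
  apply: closureS => x /= /eqP; apply: contra_notP; exact: f0.
split => //; last exact: subset_trans KD.
by apply: subclosed_compact cK hK; exact: closed_closure.
Qed.

Lemma test_fun_supp (D : set E) (f : E -> R[i]) : test_fun D f ->
  exists K, [/\ compact K, K `<=` D, forall x, ~ K x -> f x = 0 &
    forall x, ~ K x -> grad f x = 0].
Proof.
move=> /test_funP[sr si [K [cK KD f0]]]; exists K; split => // x Kx.
have clK : closed K by exact: compact_closed (@norm_hausdorff _ _) cK.
apply/rowP => i; rewrite !mxE (partial_supp _ clK) ?(partial_supp _ clK)//;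
  by move=> y /f0 ->.
Qed.

Lemma test_funD (D : set E) (f g : E -> R[i]) :
  test_fun D f -> test_fun D g -> test_fun D (fun x => f x + g x).
Proof.
move=> /test_funP[sr si [K [cK KD f0]]] /test_funP[sr' si' [K' [cK' KD' g0]]].
apply/test_funP; split.
- under eq_fun do rewrite ReD -(mul1r (Re (f _))) -(mul1r (Re (g _))).
  exact: smooth_lin.
- under eq_fun do rewrite ImD -(mul1r (Im (f _))) -(mul1r (Im (g _))).
  exact: smooth_lin.
exists (K `|` K'); split; first exact: compactU.
  by rewrite subUset.
by move=> x /not_orP[/f0 -> /g0 ->]; rewrite addr0.
Qed.

Lemma test_funZ (D : set E) (c : R[i]) (f : E -> R[i]) :
  test_fun D f -> test_fun D (fun x => c * f x).
Proof.
move=> /test_funP[sr si [K [cK KD f0]]].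
apply/test_funP; split; last first.
- by exists K; split => // x /f0 ->; rewrite mulr0.
- rewrite (_ : (fun x => _) = (fun x => Re c * Im (f x) + Im c * Re (f x))).
    exact: smooth_lin.
  by apply/funext => x; case: c (f x) => a b [u v].
- rewrite (_ : (fun x => _) = (fun x => Re c * Re (f x) + (- Im c) * Im (f x))).
    exact: smooth_lin.
  by apply/funext => x; case: c (f x) => a b [u v] /=; rewrite mulNr.
Qed.

Lemma test_funJ (D : set E) (f : E -> R[i]) :
  test_fun D f -> test_fun D (fun x => (f x)^*).
Proof.
move=> /test_funP[sr si [K [cK KD f0]]].
apply/test_funP; split; last first.
- by exists K; split => // x /f0 ->; rewrite conjc0.
- rewrite (_ : (fun x => _) = (fun x => 0 * Re (f x) + (- 1) * Im (f x))).
    exact: smooth_lin.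
  by apply/funext => x; case: (f x) => u v /=; rewrite mul0r add0r mulN1r.
- by rewrite (_ : (fun x => _) = (fun x => Re (f x)))//; apply/funext => x; case: (f x).
Qed.

Lemma gradD (D : set E) (f g : E -> R[i]) x : test_fun D f -> test_fun D g ->
  grad (fun x => f x + g x) x = grad f x + grad g x.
Proof.
move=> [fr fi _ _] [gr gi _ _]; apply/rowP => i; rewrite !mxE.
under [in X in X +i* _]eq_fun do rewrite ReD -(mul1r (Re (f _))) -(mul1r (Re (g _))).
under [in X in _ +i* X]eq_fun do rewrite ImD -(mul1r (Im (f _))) -(mul1r (Im (g _))).
by rewrite !partial_lin ?mul1r//; exact: smooth_differentiable.
Qed.

Lemma gradZ (D : set E) (c : R[i]) (f : E -> R[i]) x : test_fun D f ->
  grad (fun x => c * f x) x = c *: grad f x.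
Proof.
move=> [fr fi _ _]; apply/rowP => i; rewrite !mxE.
rewrite (_ : (fun x => Im _) = (fun x => Re c * Im (f x) + Im c * Re (f x))); last first.
  by apply/funext => y; case: c (f y) => a b [u v].
rewrite (_ : (fun x => Re _) = (fun x => Re c * Re (f x) + (- Im c) * Im (f x))); last first.
  by apply/funext => y; case: c (f y) => a b [u v] /=; rewrite mulNr.
rewrite !partial_lin//; [|exact: smooth_differentiable..].
by case: c => a b /=; rewrite mulNr.
Qed.

Lemma gradJ (D : set E) (f : E -> R[i]) x : test_fun D f ->
  grad (fun x => (f x)^*) x = map_mx conjc (grad f x).
Proof.
move=> [fr fi _ _]; apply/rowP => i; rewrite !mxE.
rewrite (_ : (fun x => Im _) = (fun x => 0 * Re (f x) + (- 1) * Im (f x))); last first.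
  by apply/funext => y; case: (f y) => u v /=; rewrite mul0r add0r mulN1r.
rewrite (_ : (fun x => Re _^*) = (fun x => Re (f x))); last first.
  by apply/funext => y; case: (f y).
by rewrite partial_lin/= ?mul0r ?add0r ?mulN1r//; exact: smooth_differentiable.
Qed.

Lemma continuous_sqr (a : E -> R) : continuous a -> continuous (fun x => a x ^+ 2).
Proof. by move=> ca x; exact: (continuous_comp (ca x) (@exprn_continuous _ 2 _)). Qed.

Lemma normc_continuous (a b : E -> R) : continuous a -> continuous b ->
  continuous (fun x => Num.sqrt (a x ^+ 2 + b x ^+ 2)).
Proof.
move=> ca cb x; apply: continuous_comp; last exact: sqrt_continuous.
exact: (cvgD (continuous_sqr ca (x:=x)) (continuous_sqr cb (x:=x))).
Qed.

Lemma vnorm_ReIm m (z : 'rV[R[i]]_m) :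
  vnorm z = Num.sqrt (\sum_i (Re (z ord0 i) ^+ 2 + Im (z ord0 i) ^+ 2)).
Proof. by congr Num.sqrt; apply: eq_bigr => i _; rewrite sqr_normc_ReIm. Qed.

Lemma vnorm_grad_continuous (D : set E) (f : E -> R[i]) : test_fun D f ->
  continuous (fun x => vnorm (grad f x)).
Proof.
move=> [fr fi _ _] x; under eq_fun do rewrite vnorm_ReIm.
have h : continuous (fun x => \sum_i (Re (grad f x ord0 i) ^+ 2 + Im (grad f x ord0 i) ^+ 2)).
  apply: continuous_big => [|i _]; first exact: add_continuous.
  under eq_fun do rewrite !mxE /=.
  have cr := continuous_sqr (@smooth_partial_continuous _ i fr).
  have ci := continuous_sqr (@smooth_partial_continuous _ i fi).
  by move=> y; exact: (cvgD (cr y) (ci y)).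
exact: (continuous_comp (h x) (@sqrt_continuous _ _)).
Qed.

Lemma normc_ReIm (z : R[i]) : normc z = Num.sqrt (Re z ^+ 2 + Im z ^+ 2).
Proof. by case: z. Qed.

Lemma test_fun_normc_continuous (D : set E) (f : E -> R[i]) : test_fun D f ->
  continuous (fun x => normc (f x)).
Proof.
move=> [fr fi _ _]; under eq_fun do rewrite normc_ReIm.
by apply: normc_continuous; exact: smooth_continuous.
Qed.

Lemma test_fun_bounded (D : set E) (f : E -> R[i]) : test_fun D f ->
  exists2 M, 0 <= M & forall x, normc (f x) <= M /\ vnorm (grad f x) <= M.
Proof.
move=> tf; have [K [cK KD f0 g0]] := test_fun_supp tf.
have [M M0 hM] : exists2 M, 0 <= M & forall x, `|normc (f x)| <= M.
  apply: (compact_supp_bounded cK) => [x /f0 ->|]; first by rewrite ComplexField.Normc.normc0.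
  exact: test_fun_normc_continuous tf.
have [M' M'0 hM'] : exists2 M, 0 <= M & forall x, `|vnorm (grad f x)| <= M.
  apply: (compact_supp_bounded cK) => [x /g0 ->|]; last exact: vnorm_grad_continuous tf.
  by rewrite /vnorm big1 ?sqrtr0// => i _; rewrite mxE ComplexField.Normc.normc0 expr0n.
exists (M + M'); rewrite ?addr_ge0// => x; split.
  by rewrite (le_trans (ler_norm _))// (le_trans (hM x))// lerDl.
by rewrite (le_trans (ler_norm _))// (le_trans (hM' x))// lerDr.
Qed.

End smooth_functions.

(** * Derivatives along lines and paths *)
Section calculus.
Variables (R : realType) (n : nat).
Local Notation E := 'rV[R]_n.

Lemma is_derive_line (f : E -> R) (x v : E) (s : R) :
  differentiable f (x + s *: v) ->
  is_derive s 1 (fun t => f (x + t *: v)) ('D_v f (x + s *: v)).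
Proof.
move=> df.
have e : (fun h : R => h^-1 *: (((fun t => f (x + t *: v)) \o shift s) (h *: 1) -
    f (x + s *: v))) =
    (fun h : R => h^-1 *: ((f \o shift (x + s *: v)) (h *: v) - f (x + s *: v))).
  apply/funext => h /=; congr (_ *: (f _ - _)).
  by rewrite -[h *: 1]/(h * 1) mulr1 scalerDl addrCA.
have dfv := diff_derivable (v := v) df.
by split; rewrite ?/derivable ?/derive e.
Qed.

Lemma deriveE_partial (f : E -> R) (x v : E) : differentiable f x ->
  'D_v f x = \sum_i v ord0 i * partial i f x.
Proof.
move=> df; rewrite deriveE// [in LHS](row_sum_delta v) linear_sum.
by apply: eq_bigr => i _; rewrite linearZ /partial deriveE.
Qed.

Lemma directional_continuous (f : E -> R) (v : E) :
  (forall x, differentiable f x) -> (forall i, continuous (partial i f)) ->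
  continuous (fun x => 'D_v f x).
Proof.
move=> df cf; under eq_fun do rewrite deriveE_partial//.
apply: continuous_big => [|i _ x]; first exact: add_continuous.
exact: (cvgMl_tmp (cf i x)).
Qed.

Lemma integral_translate (f : E -> R) (b : E) : measurable_fun setT f ->
  (\int[lebesgue_rV R n]_x (f (x + b)%R)%:E =
   \int[lebesgue_rV R n]_x (f x)%:E)%E.
Proof.
move=> mf; rewrite integralE [RHS]integralE.
have mfe : measurable_fun setT (EFin \o f) by exact/measurable_EFinP.
have h (g : E -> \bar R) : measurable_fun setT g -> (forall x, 0 <= g x)%E ->
  (\int[lebesgue_rV R n]_x (g (x + b)%R) = \int[lebesgue_rV R n]_x (g x))%E.
  move=> mg g0; have := ge0_integral_affine_rV b ltr01 mg g0.
  rewrite expr1n invr1 mul1e => <-; apply: eq_integral => x _.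
  by rewrite scale1r.
congr (_ - _)%E.
- rewrite -(h _ (measurable_funepos mfe) (funepos_ge0 _)).
  by apply: eq_integral => x _; rewrite unlock.
- rewrite -(h _ (measurable_funeneg mfe) (funeneg_ge0 _)).
  by apply: eq_integral => x _; rewrite unlock.
Qed.

Lemma increment_le (f : E -> R) (x v : E) (M t : R) : 0 < t ->
  (forall z, differentiable f z) -> (forall z, `|'D_v f z| <= M) ->
  `|f (x + t *: v) - f x| <= M * t.
Proof.
move=> t0 df hM.
have d (s : R) : is_derive s 1 (fun t : R => f (x + t *: v)) ('D_v f (x + s *: v)).
  exact: is_derive_line.
have [|c _] := MVT t0 (fun s _ => d s).
  apply: derivable_within_continuous => s _; exact: (@ex_derive _ _ _ _ _ _ _ (d s)).
rewrite scale0r addr0 subr0 => ->.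
by rewrite normrM (gtr0_norm t0) ler_wpM2r ?hM// ltW.
Qed.

Lemma harmonic_dnbhs : (@harmonic R) k @[k --> \oo] --> (0 : R)^'.
Proof.
move=> A A0.
have h : \forall k \near \oo, @harmonic R k != 0 -> A (@harmonic R k) := @cvg_harmonic R _ A0.
change (\forall k \near \oo, A (@harmonic R k)); move: h.
by apply: filterS => k; apply; rewrite gt_eqF//; exact: harmonic_gt0.
Qed.

Lemma difference_quotient_cvg (f : E -> R) (x v : E) : differentiable f x ->
  (@harmonic R k)^-1 * (f (x + @harmonic R k *: v) - f x) @[k --> \oo] --> 'D_v f x.
Proof.
move=> df; have /cvg_ex[l hl] := diff_derivable (v := v) df.
have <- : l = 'D_v f x by apply/esym/cvg_lim.
have := cvg_comp _ _ harmonic_dnbhs hl.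
apply: cvg_trans; apply: near_eq_cvg; apply: nearW => k /=.
by rewrite [x + _]addrC.
Qed.

Lemma integrable_le_indic d (T : measurableType d) (mu : {measure set T -> \bar R})
    (B : set T) (f : T -> R) (M : R) :
  measurable B -> (mu B < +oo)%E -> 0 <= M -> measurable_fun setT f ->
  (forall x, `|f x| <= M * \1_B x) -> mu.-integrable setT (EFin \o f).
Proof.
move=> mB fB M0 mf fM.
apply: (@le_integrable _ _ _ mu setT measurableT _ (fun x => (M * \1_B x)%:E)).
- exact/measurable_EFinP.
- by move=> x _ /=; rewrite lee_fin (le_trans (fM x))// ler_norm.
apply/integrableP; split.
  by apply/measurable_EFinP; apply: measurable_funM.
under eq_integral do rewrite gee0_abs ?lee_fin ?mulr_ge0// EFinM.
rewrite ge0_integralZl_EFin//; last by apply/measurable_EFinP.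
by rewrite integral_indic// setIT lte_mul_pinfty.
Qed.

(** Translation invariance makes the integral of every difference quotient
    vanish; dominated convergence passes to the derivative. *)
Lemma integral_partial_eq0 (K : set E) (f : E -> R) (i : 'I_n) :
  compact K -> (forall x, ~ K x -> f x = 0) -> (forall x, differentiable f x) ->
  continuous (partial i f) ->
  (\int[lebesgue_rV R n]_x (partial i f x)%:E = 0)%E.
Proof.
move=> cK f0 df cf; set e := delta_mx ord0 i : E.
have clK : closed K by exact: compact_closed (@norm_hausdorff _ _) cK.
have [M M0 hM] := compact_supp_bounded cK (fun x => partial_supp i clK f0 (x:=x)) cf.
have [C C_ge0 hC] := bounded_norm_le (compact_bounded cK).
(* The translates by at most one unit of the support stay in this box. *)
pose B := [set x : E | forall j, (const_mx (- (C + 1)) : E) ord0 j <= x ord0 j <= (const_mx (C + 1) : E) ord0 j].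
have mB : measurable B by exact: measurable_rV_box.
have fB : (lebesgue_rV R n B < +oo)%E.
  by rewrite lebesgue_rV_box ?ltry// => j; rewrite !mxE; lra.
pose q (k : nat) (x : E) := (@harmonic R k)^-1 * (f (x + @harmonic R k *: e) - f x).
have fc : continuous f by move=> x; exact: differentiable_continuous.
have mf : measurable_fun setT f by exact: continuous_measurable_rV.
have mft k : measurable_fun setT (fun x : E => f (x + @harmonic R k *: e)).
  have -> : (fun x : E => f (x + @harmonic R k *: e)) = f \o (fun x => 1 *: x + @harmonic R k *: e).
    by apply/funext => x /=; rewrite scale1r.
  exact: measurableT_comp mf (measurable_affine_rV _ _).
have hk0 k : 0 < @harmonic R k by exact: harmonic_gt0.
have hk1 k : @harmonic R k <= 1 by rewrite /= invf_le1// ler1n.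
have qB k x : `|q k x| <= M * \1_B x.
  have [Bx|nBx] := pselect (B x).
    rewrite indicE mem_set// mulr1 normrM gtr0_norm ?invr_gt0// mulrC.
    by rewrite ler_pdivrMr// increment_le.
  have Kfar y : `|y - x| <= 1 -> f y = 0.
    move=> yx; apply: f0 => Ky; apply: nBx => j; rewrite !mxE -ler_norml.
    rewrite (le_trans (rV_norm_coord x j))//.
    rewrite -(subrK y x) (le_trans (ler_normD _ _))// addrC lerD ?hC//.
    by rewrite distrC.
  have fx0 : f x = 0 by apply: Kfar; rewrite subrr normr0.
  have fxe0 : f (x + @harmonic R k *: e) = 0.
    apply: Kfar; rewrite addrAC subrr add0r.
    have e1 : `|e| <= 1.
      rewrite /Num.norm/= mx_normrE; apply: bigmax_le => // -[a b] _ /=.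
      by rewrite mxE; case: (_ && _); rewrite ?normr1 ?normr0.
    rewrite normrZ (ger0_norm (ltW (hk0 k))).
    rewrite -[leRHS](mulr1 1); apply: ler_pM => //; exact: ltW.
  by rewrite indicE memNset// mulr0 /q fx0 fxe0 subrr mulr0 normr0.
have [|||||_ _] := @dominated_convergence _ _ _ (lebesgue_rV R n) setT measurableT
  (fun k x => (q k x)%:E) (fun x => (partial i f x)%:E) (fun x => (M * \1_B x)%:E).
- move=> k; apply/measurable_EFinP; apply: measurable_funM => //.
  exact: measurable_funB.
- by apply/measurable_EFinP; exact: continuous_measurable_rV.
- by apply: aeW => x _; apply: cvg_EFin; [exact: nearW|exact: difference_quotient_cvg].
- apply: (integrable_le_indic mB fB M0); first exact: measurable_funM.
  by move=> x; rewrite ger0_norm// mulr_ge0.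
- by apply: aeW => x k _; rewrite lee_fin.
move=> /cvg_lim <- //; rewrite (_ : (fun _ => _) = cst 0%E) ?lim_cst//.
apply/funext => k /=.
have iq : (lebesgue_rV R n).-integrable setT (EFin \o q k).
  apply: (integrable_le_indic mB fB M0) => //.
  by apply: measurable_funM => //; exact: measurable_funB.
have [Mf Mf0 hMf] := compact_supp_bounded cK f0 fc.
have fi : (lebesgue_rV R n).-integrable setT (EFin \o f).
  apply: (integrable_le_indic mB fB Mf0) => // x.
  have [Kx|/f0 ->] := pselect (K x); last by rewrite normr0 mulr_ge0.
  rewrite indicE mem_set ?mulr1// => j; rewrite !mxE -ler_norml.
  by rewrite (le_trans (rV_norm_coord x j))// (le_trans (hC _ Kx))// lerDl.
have := @integral_translate f (@harmonic R k *: e) mf.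
under eq_integral => x _.
  rewrite (_ : f _ = f x + @harmonic R k * q k x); last first.
    by rewrite /q mulrA divff ?mul1r ?subrKC// gt_eqF.
  rewrite EFinD EFinM; over.
rewrite integralD//; last exact: integrableZl.
rewrite integralZl//.
have /fineK <- := integrable_fin_num measurableT fi.
have /fineK <- := integrable_fin_num measurableT iq.
rewrite -EFinM -EFinD => -[/eqP]; rewrite -subr_eq0 addrAC subrr add0r mulf_eq0.
by rewrite gt_eqF//= => /eqP ->.
Qed.

(** The fundamental theorem of calculus along [s => x + s ^ N * y]; the factor
    [s ^ (N - 1)] gained from this parametrization will offset the
    singularity at [s = 0] of the averages taken below. *)
Lemma path_integral_bound (u : E -> R) (N : nat) (x y : E) : (0 < N)%N ->
  (forall z, differentiable u z) -> (forall i, continuous (partial i u)) ->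
  u (x + y) = 0 ->
  (`|u x|%:E <= \int[@lebesgue_measure R]_(s in `[0%R, 1%R])
    (N%:R * s ^+ N.-1 * `|'D_y u (x + s ^+ N *: y)|)%:E)%E.
Proof.
move=> N0 du cu uxy.
pose F (s : R) := u (x + s ^+ N *: y).
pose f (s : R) := N%:R * s ^+ N.-1 * 'D_y u (x + s ^+ N *: y).
have cX k : continuous (fun s : R => s ^+ k) by move=> s; exact: exprn_continuous.
have cp : continuous (fun s : R => x + s ^+ N *: y).
  move=> s; apply: cvgD; first exact: cvg_cst.
  by apply: cvgZr_tmp; exact: cX.
have dc : continuous (fun z => 'D_y u z) by exact: directional_continuous.
have cf : continuous f.
  move=> s; apply: (@cvgM _ R); last first.
    exact: (continuous_comp (cp s) (dc _)).
  by apply: cvgMl_tmp; exact: cX.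
have dF (s : R) : is_derive s 1 F (f s).
  have dl := @is_derive_line u x y (s ^+ N) (du _).
  have dX : is_derive s 1 (fun t : R => t ^+ N) (N%:R * s ^+ N.-1).
    split; first exact: exprn_derivable.
    by rewrite -(prednK N0) exp_derive /= -[_ *: 1]/(_ * 1) mulr1.
  rewrite /f mulrC.
  exact: (@is_derive1_comp _ (fun t => u (x + t *: y)) (fun t : R => t ^+ N)).
have cF : continuous F.
  by move=> s; apply: differentiable_continuous; apply/derivable1_diffP.
have : (\int[@lebesgue_measure R]_(s in `[0%R, 1%R]) (f s)%:E = (F 1)%:E - (F 0)%:E)%E.
  apply: continuous_FTC2 => //.
  - exact: continuous_subspaceT.
  - split; [by move=> s _; apply: ex_derive| |].
      by apply: cvg_at_right_filter; exact: cF.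
    by apply: cvg_at_left_filter; exact: cF.
  - by move=> s _; rewrite derive1E; apply: derive_val.
rewrite /F expr1n scale1r uxy expr0n gtn_eqF// scale0r addr0 sub0e => h.
rewrite -[leLHS]abse_EFin -abseN -h.
apply: (le_trans (le_abse_integral _ _ _)) => //.
  by apply/measurable_EFinP/measurable_funTS; exact: continuous_measurable_fun.
rewrite le_eqVlt; apply/orP; left; apply/eqP; apply: eq_integral => s /[1!inE] /=; rewrite in_itv/= => /andP[s0 _].
by rewrite normrM ger0_norm// mulr_ge0// exprn_ge0.
Qed.

End calculus.

(** * Iterated integrals over measurable sets *)
(** The product theorems hold on whole spaces: extend the integrand by zero. *)
Lemma fubini_tonelli_in d1 d2 (T1 : measurableType d1) (T2 : measurableType d2)
    (R : realType) (m1 : {sigma_finite_measure set T1 -> \bar R})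
    (m2 : {sigma_finite_measure set T2 -> \bar R}) (A : set T1) (B : set T2)
    (F : T1 * T2 -> \bar R) : measurable A -> measurable B ->
  measurable_fun setT F -> (forall z, 0 <= F z)%E ->
  (\int[m1]_(x in A) \int[m2]_(y in B) F (x, y) =
   \int[m2]_(y in B) \int[m1]_(x in A) F (x, y))%E.
Proof.
move=> mA mB mF F0; pose F' := F \_ (A `*` B).
have mF' : measurable_fun setT F'.
  apply/(measurable_restrictT F (measurableX mA mB)); exact: measurable_funTS.
have F'0 z : (0 <= F' z)%E by rewrite /F' patchE; case: ifP.
transitivity (\int[m1]_x \int[m2]_y F' (x, y))%E; last first.
  rewrite fubini_tonelli//; rewrite [in RHS]integral_mkcond.
  apply: eq_integral => y _; rewrite [in RHS]patchE; case: ifPn => yB.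
    rewrite [in RHS]integral_mkcond; apply: eq_integral => x _.
    by rewrite /F' !patchE in_setX/= yB andbT.
  apply: integral0_eq => x _; rewrite /F' patchE in_setX/= (negbTE yB).
  by rewrite andbF.
rewrite integral_mkcond; apply: eq_integral => x _; rewrite [in LHS]patchE; case: ifPn => xA.
  rewrite integral_mkcond; apply: eq_integral => y _.
  by rewrite /F' !patchE in_setX/= xA.
by apply/esym/integral0_eq => y _; rewrite /F' patchE in_setX/= (negbTE xA).
Qed.

Lemma measurable_integral_in d1 d2 (T1 : measurableType d1) (T2 : measurableType d2)
    (R : realType) (m2 : {sigma_finite_measure set T2 -> \bar R}) (B : set T2)
    (F : T1 * T2 -> \bar R) : measurable B ->
  measurable_fun setT F -> (forall z, 0 <= F z)%E ->
  measurable_fun setT (fun x => \int[m2]_(y in B) F (x, y))%E.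
Proof.
move=> mB mF F0; pose F' := F \_ (setT `*` B).
have mF' : measurable_fun setT F'.
  by apply/(measurable_restrictT F (measurableX measurableT mB)); exact: measurable_funTS.
have F'0 z : (0 <= F' z)%E by rewrite /F' patchE; case: ifP.
have := @measurable_fun_fubini_tonelli_F _ _ _ _ R m2 F' mF' F'0.
congr measurable_fun; apply/funext => x /=.
rewrite /fubini_F [RHS]integral_mkcond; apply: eq_integral => y _.
by rewrite /F' !patchE in_setX/= in_setT.
Qed.

(** * Averages along rays *)
Section ray_average.
Variables (R : realType) (n N : nat) (L p q M : R).
Local Notation E := 'rV[R]_n.
Local Notation leb := (lebesgue_rV R n).
Hypotheses (p1 : 1 <= p) (pq : p <= q) (N2 : (2 <= N)%N) (M0 : 0 <= M).
(* Solvable for [N] exactly when [n * (q - p) < p * q]. *)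
Hypothesis Npq : n%:R * N%:R * (q - p) <= (N%:R - 1) * q * p.
Variable G : E -> R.
Hypotheses (mG : measurable_fun setT G) (G0 : forall x, 0 <= G x)
  (GM : forall x, G x <= M).

Definition cube : set E := [set x | forall i, L <= x ord0 i <= L + 1].

Lemma measurable_cube : measurable cube.
Proof.
have := @measurable_rV_box R n (const_mx L) (const_mx (L + 1)).
by congr measurable; apply/seteqP; split => x /= h i; have := h i; rewrite !mxE.
Qed.
Let mQ := measurable_cube.

Lemma lebesgue_cube : leb cube = 1%E.
Proof.
rewrite lebesgue_rV_cube ?lerDl// (_ : L + 1 - L = 1) ?expr1n//.
by rewrite addrC addKr.
Qed.

Lemma integral_cube_cst (c : R) : (\int[leb]_(y in cube) c%:E = c%:E)%E.
Proof. by rewrite integral_cst//; exact: (etrans (congr1 _ lebesgue_cube) (mule1 _)). Qed.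

(** By a change of variables, this is the mean of [G] over [x + s ^ N * cube]. *)
Definition cube_mean (s : R) (x : E) : R :=
  fine (\int[leb]_(y in cube) (G (x + s ^+ N *: y))%:E).

Let mGa3 : measurable_fun setT (fun z : (measurableTypeR R * E) * E => G (z.1.2 + z.1.1 ^+ N *: z.2)).
Proof.
apply: (measurableT_comp mG); apply: measurable_fun_rVP => i.
under eq_fun do rewrite !mxE.
apply: measurable_funD.
  apply: (measurableT_comp (measurable_coord i)).
  exact: measurableT_comp measurable_snd measurable_fst.
apply: measurable_funM.
  apply: measurable_funX.
  exact: (measurableT_comp measurable_fst measurable_fst).
exact: (measurableT_comp (measurable_coord i) measurable_snd).
Qed.

Let mGs x s : measurable_fun setT (fun y : E => G (x + s ^+ N *: y)).
Proof. exact: (measurable_fun_pair2 (s : measurableTypeR R, x) mGa3). Qed.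

Lemma cube_meanE s x :
  (cube_mean s x)%:E = (\int[leb]_(y in cube) (G (x + s ^+ N *: y))%:E)%E.
Proof.
rewrite fineK// ge0_fin_numE; last by apply: integral_ge0 => y _; rewrite lee_fin.
apply: (@le_lt_trans _ _ (\int[leb]_(y in cube) M%:E)%E).
  apply: ge0_le_integral => //.
  - by move=> y _; rewrite lee_fin.
  - by apply/measurable_EFinP; exact: measurable_funTS.
  - by move=> y _; rewrite lee_fin.
by rewrite integral_cube_cst ltry.
Qed.

Lemma cube_mean_ge0 s x : 0 <= cube_mean s x.
Proof. by rewrite -lee_fin cube_meanE; apply: integral_ge0 => y _; rewrite lee_fin. Qed.

Lemma measurable_cube_mean :
  measurable_fun setT (fun z : measurableTypeR R * E => cube_mean z.1 z.2).
Proof.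
rewrite /cube_mean; apply: (measurableT_comp (@fine_measurable R setT measurableT)).
pose F (z : (measurableTypeR R * E) * E) := (G (z.1.2 + z.1.1 ^+ N *: z.2))%:E.
have mF : measurable_fun setT F by apply/measurable_EFinP.
have F0 z : (0 <= F z)%E by rewrite lee_fin.
exact: (measurable_integral_in leb mQ mF F0).
Qed.

Lemma measurable_weighted_mean : measurable_fun setT
  (fun z : E * measurableTypeR R => N%:R * z.2 ^+ N.-1 * cube_mean z.2 z.1).
Proof.
apply: measurable_funM; last first.
  have ms : measurable_fun setT (fun z : E * measurableTypeR R => (z.2, z.1)) :=
    measurable_fun_pair measurable_snd measurable_fst.
  exact: (measurableT_comp measurable_cube_mean ms).
by apply: measurable_funM => //; apply: measurable_funX; exact: measurable_snd.
Qed.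

Lemma weighted_mean_ge0 x s : s \in `[0%R, 1%R] ->
  0 <= N%:R * s ^+ N.-1 * cube_mean s x.
Proof.
rewrite in_itv/= => /andP[s0 _].
by rewrite mulr_ge0 ?cube_mean_ge0// mulr_ge0// exprn_ge0.
Qed.

Lemma measurable_ray_average : measurable_fun setT
  (fun x => \int[@lebesgue_measure R]_(s in `[0%R, 1%R])
     (N%:R * s ^+ N.-1 * cube_mean s x)%:E)%E.
Proof.
pose F (z : E * measurableTypeR R) := N%:R * z.2 ^+ N.-1 * cube_mean z.2 z.1.
have mFn : measurable_fun setT (fun z => (`|F z|)%:E).
  by apply/measurable_EFinP; apply: measurableT_comp => //; exact: measurable_weighted_mean.
have mI : measurable (`[0%R, 1%R]%classic : set (measurableTypeR R)) by exact: measurable_itv.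
have := measurable_integral_in (@lebesgue_measure R) mI mFn (fun z => normr_ge0 _).
congr measurable_fun; apply/funext => x; apply: eq_integral => s /[1!inE] sI.
by rewrite ger0_norm// weighted_mean_ge0.
Qed.

Variable i : R.
Hypothesis Gi : (\int[leb]_x (G x `^ p)%:E = i%:E)%E.

Let mGp : measurable_fun setT (fun x => (G x `^ p)%:E).
Proof. by apply/measurable_EFinP; apply: (measurableT_comp (measurable_powR p)). Qed.

Let i0 : 0 <= i.
Proof. by rewrite -lee_fin -Gi; apply: integral_ge0 => x _; rewrite lee_fin powR_ge0. Qed.

Let p0 : 0 < p. Proof. exact: lt_le_trans p1. Qed.

Lemma cube_mean_jensen s x :
  ((cube_mean s x `^ p)%:E <= \int[leb]_(y in cube) (G (x + s ^+ N *: y) `^ p)%:E)%E.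
Proof.
rewrite -poweR_EFin cube_meanE; apply: jensen_powR => //; first exact: lebesgue_cube.
exact: measurable_funTS.
Qed.

Let mGsp x s : measurable_fun setT (fun y : E => (G (x + s ^+ N *: y) `^ p)%:E).
Proof. by apply/measurable_EFinP; apply: (measurableT_comp (measurable_powR p)). Qed.

(** Jensen, then the change of variables [y => x + s ^ N * y] on R^n. *)
Lemma cube_mean_sup s x : 0 < s -> cube_mean s x `^ p <= s ^- (N * n) * i.
Proof.
move=> s0; rewrite -lee_fin (le_trans (cube_mean_jensen s x))//.
apply: (@le_trans _ _ (\int[leb]_y (G (x + s ^+ N *: y) `^ p)%:E)%E).
  by apply: ge0_subset_integral => // y _; rewrite lee_fin powR_ge0.
under eq_integral do rewrite addrC.
rewrite (@ge0_integral_affine_rV _ _ (fun x => (G x `^ p)%:E))// ?exprn_gt0//.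
  by rewrite Gi -exprM EFinM.
by move=> y; rewrite lee_fin powR_ge0.
Qed.

Let mG2p s : measurable_fun setT (fun z : E * E => (G (z.1 + s ^+ N *: z.2) `^ p)%:E).
Proof.
apply/measurable_EFinP; apply: (measurableT_comp (measurable_powR p)).
apply: (measurableT_comp mG); apply: measurable_fun_rVP => j.
under eq_fun do rewrite !mxE.
apply: measurable_funD; first exact: (measurableT_comp (measurable_coord j)).
by apply: measurable_funM => //; exact: (measurableT_comp (measurable_coord j) measurable_snd).
Qed.

Let G2p0 s (z : E * E) : (0 <= (G (z.1 + s ^+ N *: z.2) `^ p)%:E)%E.
Proof. by rewrite lee_fin powR_ge0. Qed.

(** Jensen, then Tonelli and translation invariance. *)
Lemma cube_mean_Lp s : (\int[leb]_x (cube_mean s x `^ p)%:E <= i%:E)%E.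
Proof.
apply: (@le_trans _ _ (\int[leb]_x \int[leb]_(y in cube) (G (x + s ^+ N *: y) `^ p)%:E)%E).
  apply: ge0_le_integral => //.
  - by move=> x _; rewrite lee_fin powR_ge0.
  - apply/measurable_EFinP; apply: (measurableT_comp (measurable_powR p)).
    exact: (measurable_fun_pair2 (s : measurableTypeR R) measurable_cube_mean).
  - exact: (measurable_integral_in leb mQ (mG2p s) (@G2p0 s)).
  - by move=> x _; exact: cube_mean_jensen.
rewrite (fubini_tonelli_in leb leb measurableT mQ (mG2p s) (@G2p0 s))/=.
under eq_integral => y _.
  rewrite (@integral_translate _ _ (fun x => G x `^ p)) ?Gi; last first.
    exact: (measurableT_comp (measurable_powR p)).
  over.
by rewrite integral_cube_cst.
Qed.

Let q0 : 0 < q. Proof. exact: lt_le_trans pq. Qed.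

Let N0 : (0 < N)%N. Proof. exact: ltnW. Qed.

(** The exponent of [s] is nonnegative by the choice of [N]. *)
Lemma cube_mean_weight s : 0 < s <= 1 ->
  (s ^+ N.-1) `^ q * (s ^- (N * n)) `^ ((q - p) / p) <= 1.
Proof.
move=> /andP[s0 s1].
rewrite -powR_mulrn ?(ltW s0)// -powR_invn ?(ltW s0)// -!powRrM -powRD ?(gt_eqF s0) ?implybT//.
rewrite -[leRHS](powRr0 s); apply: ger_powR; first by rewrite s0.
rewrite -(pmulr_rge0 _ p0) natrM -subn1 natrB//.
rewrite (_ : p * _ = (N%:R - 1) * q * p - n%:R * N%:R * (q - p)) ?subr_ge0//.
by field; rewrite lt0r_neq0.
Qed.

(** Interpolation between the [L^p] bound and the pointwise bound of the mean:
    the negative power of [s] in the latter is absorbed by the weight. *)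
Lemma cube_mean_Lq s : 0 <= s <= 1 ->
  (\int[leb]_x ((N%:R * s ^+ N.-1 * cube_mean s x) `^ q)%:E <=
   (N%:R `^ q * i `^ (q / p))%:E)%E.
Proof.
move=> /andP[]; rewrite le_eqVlt => /predU1P[<- _|s0 s1].
  rewrite integral0_eq ?lee_fin ?mulr_ge0 ?powR_ge0// => x _.
  rewrite expr0n eqn0Ngt -ltnS prednK// N2 mulr0 mul0r powR0//; exact: lt0r_neq0.
have mh : measurable_fun setT (fun x => cube_mean s x).
  exact: (measurable_fun_pair2 (s : measurableTypeR R) measurable_cube_mean).
set w := (N%:R * s ^+ N.-1) `^ q * (s ^- (N * n) * i) `^ ((q - p) / p).
apply: (@le_trans _ _ (\int[leb]_x (w%:E * (cube_mean s x `^ p)%:E))%E).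
  apply: ge0_le_integral => //.
  - by move=> x _; rewrite lee_fin powR_ge0.
  - apply/measurable_EFinP; apply: (measurableT_comp (measurable_powR q)).
    exact: measurable_funM.
  - apply: measurable_funeM; apply/measurable_EFinP.
    exact: (measurableT_comp (measurable_powR p)).
  - move=> x _; rewrite -EFinM lee_fin powRM ?cube_mean_ge0//; last first.
      by rewrite mulr_ge0// exprn_ge0// ltW.
    rewrite /w -mulrA ler_wpM2l ?powR_ge0//.
    have [->|h0] := eqVneq (cube_mean s x) 0.
      by rewrite !powR0 ?mulr0// lt0r_neq0.
    rewrite (_ : q = (p * ((q - p) / p) + p)); last first.
      by field; rewrite lt0r_neq0.
    rewrite powRD ?h0 ?implybT// ler_wpM2r ?powR_ge0// powRrM.
    rewrite (_ : p * ((q - p) / p) + p - p = q - p); last by field; rewrite lt0r_neq0.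
    apply: ge0_ler_powR; rewrite ?nnegrE ?powR_ge0 ?cube_mean_sup//.
      by rewrite divr_ge0 ?subr_ge0// ltW.
    by rewrite mulr_ge0// invr_ge0 exprn_ge0// ltW.
rewrite ge0_integralZl_EFin//; last 3 first.
- by move=> x _; rewrite lee_fin powR_ge0.
- by apply/measurable_EFinP; exact: (measurableT_comp (measurable_powR p)).
- by rewrite mulr_ge0 ?powR_ge0.
apply: (@le_trans _ _ (w%:E * i%:E)%E).
  by apply: lee_wpmul2l; [rewrite lee_fin mulr_ge0 ?powR_ge0|exact: cube_mean_Lp].
rewrite -EFinM lee_fin /w !powRM ?exprn_ge0 ?invr_ge0 ?exprn_ge0 ?(ltW s0)//.
rewrite (_ : i `^ (q / p) = i `^ ((q - p) / p) * i); last first.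
  rewrite [RHS]mulrC -[LHS](@mulr_powRB1 _ i (q / p))// ?divr_gt0//.
  by congr (_ * _ `^ _); field; rewrite lt0r_neq0.
have := @cube_mean_weight s; rewrite s0 s1 => /(_ isT).
set a := (s ^+ N.-1) `^ q; set b := (s ^- (N * n)) `^ _; set c := i `^ _; set d := N%:R `^ q => ab.
rewrite [leLHS](_ : _ = (a * b) * (d * (c * i))); last by ring.
by rewrite ler_piMl// !mulr_ge0// powR_ge0.
Qed.

(** The bound of each slice is uniform in [s], and [0, 1] has measure one, so
    Jensen's inequality replaces Minkowski's integral inequality. *)
Lemma ray_average_Lq :
  (\int[leb]_x ((\int[@lebesgue_measure R]_(s in `[0%R, 1%R])
     (N%:R * s ^+ N.-1 * cube_mean s x)%:E) `^ q) <=
   (N%:R `^ q * i `^ (q / p))%:E)%E.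
Proof.
pose F (z : E * measurableTypeR R) := N%:R * z.2 ^+ N.-1 * cube_mean z.2 z.1.
have mF : measurable_fun setT F := measurable_weighted_mean.
have mI : measurable (`[0%R, 1%R]%classic : set (measurableTypeR R)) by exact: measurable_itv.
pose Fq z := (F z `^ q)%:E.
have mFq : measurable_fun setT Fq.
  by apply/measurable_EFinP; exact: (measurableT_comp (measurable_powR q)).
have Fq0 z : (0 <= Fq z)%E by rewrite lee_fin powR_ge0.
have lI : @lebesgue_measure R `[0%R, 1%R]%classic = 1%E.
  by rewrite lebesgue_measure_itv/= lte_fin ltr01 oppr0 adde0.
apply: (@le_trans _ _ (\int[leb]_x \int[@lebesgue_measure R]_(s in `[0%R, 1%R]) Fq (x, s))%E).
  apply: ge0_le_integral => //.
  - by move=> x _; exact: poweR_ge0.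
  - apply: (measurableT_comp (measurable_poweR q)).
    exact: measurable_ray_average.
  - exact: (measurable_integral_in (@lebesgue_measure R) mI mFq Fq0).
  - move=> x _; apply: jensen_powR => //.
    + by rewrite (le_trans p1).
    + apply: measurable_funTS; exact: (measurable_fun_pair2 x mF).
    + by move=> s; exact: weighted_mean_ge0.
rewrite (fubini_tonelli_in leb (@lebesgue_measure R) measurableT mI mFq Fq0).
apply: (@le_trans _ _ (\int[@lebesgue_measure R]_(s in `[0%R, 1%R]) (N%:R `^ q * i `^ (q / p))%:E)%E).
  apply: ge0_le_integral => //.
  - by move=> s _; apply: integral_ge0.
  - apply: measurable_funTS.
    have mFs : measurable_fun setT (fun z : measurableTypeR R * E => Fq (z.2, z.1)).
      have ms : measurable_fun setT (fun z : measurableTypeR R * E => (z.2, z.1)) :=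
        measurable_fun_pair measurable_snd measurable_fst.
      exact: (measurableT_comp mFq ms).
    exact: (measurable_integral_in leb measurableT mFs (fun z => Fq0 _)).
  - by move=> s; rewrite /= in_itv/=; exact: cube_mean_Lq.
rewrite integral_cst// le_eqVlt; apply/orP; left; apply/eqP.
exact: (etrans (congr1 _ lI) (mule1 _)).
Qed.

End ray_average.

(** * The Sobolev inequality for test functions *)
Section sobolev.
Variables (R : realType) (n : nat).
Local Notation E := 'rV[R]_n.
Local Notation leb := (lebesgue_rV R n).
Local Notation Re := complex.Re.
Local Notation Im := complex.Im.
Local Notation normc := ComplexField.Normc.normc.

Lemma normr_Re_le (z : R[i]) : `|Re z| <= normc z.
Proof.
rewrite -(@ler_pXn2r _ 2)// ?nnegrE ?normc_ge0// sqr_normc_ReIm real_normK ?num_real//.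
by rewrite lerDl sqr_ge0.
Qed.

Lemma normr_Im_le (z : R[i]) : `|Im z| <= normc z.
Proof.
rewrite -(@ler_pXn2r _ 2)// ?nnegrE ?normc_ge0// sqr_normc_ReIm real_normK ?num_real//.
by rewrite lerDr sqr_ge0.
Qed.

Lemma normc_le_ReIm (z : R[i]) : normc z <= `|Re z| + `|Im z|.
Proof.
rewrite -(@ler_pXn2r _ 2)// ?nnegrE ?normc_ge0 ?addr_ge0// sqr_normc_ReIm.
rewrite -(real_normK (num_real (Re z))) -(real_normK (num_real (Im z))).
by rewrite sqrrD -addrA [_ *+ 2 + _]addrC addrA lerDl mulrn_wge0// mulr_ge0.
Qed.

Lemma normc_le_vnorm m (z : 'rV[R[i]]_m) j : normc (z ord0 j) <= vnorm z.
Proof.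
rewrite -(@ler_pXn2r _ 2)// ?nnegrE ?normc_ge0 ?vnorm_ge0//.
rewrite sqr_sqrtr; last by apply: sumr_ge0 => k _; exact: sqr_ge0.
by rewrite (bigD1 j)//= lerDl; apply: sumr_ge0 => k _; exact: sqr_ge0.
Qed.

Lemma path_bound_component (D : set E) (u : E -> R) (N : nat) (L : R) (G : E -> R) x y :
  (0 < N)%N -> 0 <= L -> cube L y ->
  (forall z, differentiable u z) -> (forall i, continuous (partial i u)) ->
  measurable_fun setT G ->
  (forall i z, `|partial i u z| <= G z) -> u (x + y) = 0 ->
  (`|u x|%:E <= \int[@lebesgue_measure R]_(s in `[0%R, 1%R])
     (n%:R * (L + 1) * (N%:R * `|s| ^+ N.-1 * G (x + s ^+ N *: y)))%:E)%E.
Proof.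
move=> N0 L0 Qy du cu mG uG uxy.
apply: (le_trans (path_integral_bound N0 du cu uxy)).
have G0 z : 0 < (n%:R : R) -> 0 <= G z.
  rewrite ltr0n => n0; exact: le_trans (normr_ge0 _) (uG (Ordinal n0) z).
have mpath : measurable_fun setT (fun s : measurableTypeR R => x + s ^+ N *: y).
  apply: measurable_fun_rVP => i; under eq_fun do rewrite !mxE.
  by apply: measurable_funD => //; apply: measurable_funM => //; apply: measurable_funX.
apply: ge0_le_integral => //.
- by move=> s; rewrite /= in_itv/= => /andP[s0 _]; rewrite lee_fin mulr_ge0// mulr_ge0// exprn_ge0.
- apply/measurable_EFinP/measurable_funTS; apply: measurable_funM.
    by apply: measurable_funM => //; apply: measurable_funX.
  apply: measurableT_comp => //.
  apply: (measurableT_comp (f := fun z => 'D_y u z) _ mpath).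
  by apply: continuous_measurable_rV; exact: directional_continuous.
- apply/measurable_EFinP/measurable_funTS; apply: measurable_funM => //; apply: measurable_funM.
    by apply: measurable_funM => //; apply: measurable_funX; exact: normr_measurable.
  exact: (measurableT_comp mG mpath).
move=> s; rewrite /= in_itv/= => /andP[s0 _]; rewrite lee_fin (ger0_norm s0).
rewrite [leRHS]mulrCA ler_wpM2l ?mulr_ge0 ?exprn_ge0//.
rewrite deriveE_partial// (le_trans (ler_norm_sum _ _ _))//.
rewrite (_ : n%:R * (L + 1) * _ = \sum_(i < n) (L + 1) * G (x + s ^+ N *: y)); last first.
  by rewrite sumr_const card_ord -mulrA mulr_natl.
apply: ler_sum => i _; rewrite normrM; apply: ler_pM => //.
have := Qy i => /andP[h1 h2]; rewrite ger0_norm//; lra.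
Qed.

(** For [x] in [D] and [y] in a cube far away, [f] vanishes at [x + y], so [f x]
    is an integral of the gradient along the path from [x] to [x + y].
    Averaging over [y] bounds [normc (f x)] by the ray average of
    [vnorm (grad f)], whose [L^q] norm is controlled. *)
Lemma sobolev_test (D : set E) (p q : R) : (0 < n)%N -> open D -> bounded_set D ->
  1 <= p -> p <= q -> n%:R * (q - p) < p * q ->
  exists2 C : R, 0 <= C & forall f, test_fun D f ->
   (\int[leb]_(x in D) (normc (f x) `^ q)%:E <=
    C%:E * (\int[leb]_(x in D) (vnorm (grad f x) `^ p)%:E) `^ (q / p))%E.
Proof.
move=> n0 oD bD p1 pq npq.
have [K K0 hK] := bounded_norm_le bD.
have mD := open_measurable_rV oD.
have fD := lebesgue_rV_bounded_lty mD bD.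
(* Translating by a vector of the cube, whose coordinates are at least [L],
   leaves the ball of radius [K]. *)
pose L := 2 * K + 1; have L0 : 0 <= L by rewrite /L; lra.
pose delta := p * q - n%:R * (q - p); have delta0 : 0 < delta by rewrite subr_gt0.
pose N := (Num.bound (p * q / delta)).+2.
have p0 : 0 < p by exact: lt_le_trans p1.
have q0 : 0 < q by exact: lt_le_trans pq.
have Npq : n%:R * N%:R * (q - p) <= (N%:R - 1) * q * p.
  have : p * q / delta < N%:R.
    apply: (@lt_trans _ _ (Num.bound (p * q / delta))%:R); last by rewrite ltr_nat.
    by apply: archi_boundP; rewrite divr_ge0 ?mulr_ge0// ltW.
  by rewrite ltr_pdivrMr// /delta => h; nra.
(* The coordinates of [y] are at most [L + 1]; real and imaginary parts are
   bounded separately, whence the factor 2. *)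
pose c := 2 * (n%:R * (L + 1)) : R.
have c0 : 0 <= c by rewrite /c !mulr_ge0//; lra.
exists (c `^ q * N%:R `^ q); first by rewrite mulr_ge0 ?powR_ge0.
move=> f tf; pose G x := vnorm (grad f x).
have G0 x : 0 <= G x by exact: vnorm_ge0.
have mG : measurable_fun setT G.
  by apply: continuous_measurable_rV; exact: vnorm_grad_continuous tf.
have [M M0 hM] := test_fun_bounded tf.
have GM x : G x <= M by have [] := hM x.
have [Kf [_ KfD f0 g0]] := test_fun_supp tf.
have mGp : measurable_fun setT (fun x => (G x `^ p)%:E).
  by apply/measurable_EFinP; apply: (measurableT_comp (measurable_powR p)).
have GE : (\int[leb]_x (G x `^ p)%:E = \int[leb]_(x in D) (G x `^ p)%:E)%E.
  rewrite [RHS]integral_mkcond; apply: eq_integral => x _; rewrite patchE.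
  case: ifPn => //; rewrite notin_setE => nDx.
  rewrite /G g0 => [|/KfD//].
  by rewrite /vnorm big1 ?sqrtr0 ?powR0 ?lt0r_neq0// => i _; rewrite mxE ComplexField.Normc.normc0 expr0n.
have : (\int[leb]_(x in D) (G x `^ p)%:E)%E \is a fin_num.
  rewrite ge0_fin_numE; last by apply: integral_ge0 => x _; rewrite lee_fin powR_ge0.
  apply: (@le_lt_trans _ _ (\int[leb]_(x in D) (M `^ p)%:E)%E).
    apply: ge0_le_integral => //.
    - by move=> x _; rewrite lee_fin powR_ge0.
    - exact: measurable_funTS.
    - move=> x _; rewrite lee_fin ge0_ler_powR ?nnegrE//; exact: ltW.
  by rewrite integral_cst// lte_mul_pinfty// lee_fin powR_ge0.
move=> /fineK iE; rewrite -iE poweR_EFin; set i := fine _ in iE *.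
have Gi : (\int[leb]_x (G x `^ p)%:E = i%:E)%E by rewrite GE.
have := @ray_average_Lq R n N L p q M p1 pq isT Npq G mG G0 GM i Gi.
set P := fun x : E => (\int[@lebesgue_measure R]_(s in `[0%R, 1%R])
     (N%:R * s ^+ N.-1 * cube_mean N L G s x)%:E)%E.
rewrite -/P => hP.
have wm0 := @weighted_mean_ge0 R n N L M G mG G0 GM.
have mwm := @measurable_weighted_mean R n N L G mG G0.
have P0 x : (0 <= P x)%E.
  by apply: integral_ge0 => s sI; rewrite lee_fin wm0.
have fP x : D x -> ((normc (f x))%:E <= c%:E * P x)%E.
  move=> Dx.
  have fxy y : cube L y -> f (x + y) = 0.
    move=> Qy; apply: f0 => /KfD /hK xyK.
    have := Qy (Ordinal n0) => /andP[h1 _].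
    have h2 := le_trans (rV_norm_coord x (Ordinal n0)) (hK _ Dx).
    have h3 := le_trans (rV_norm_coord (x + y) (Ordinal n0)) xyK.
    move: h2 h3; rewrite !mxE !ler_norml => /andP[h4 h5] /andP[h6 h7].
    rewrite /L in h1; lra.
  have [sr si _ _] := tf.
  pose F (z : E * measurableTypeR R) := (c * (N%:R * `|z.2| ^+ N.-1 * G (x + z.2 ^+ N *: z.1)))%:E.
  have mxy : measurable_fun setT (fun z : E * measurableTypeR R => x + z.2 ^+ N *: z.1).
    apply: measurable_fun_rVP => j; under eq_fun do rewrite !mxE.
    apply: measurable_funD => //; apply: measurable_funM.
      by apply: measurable_funX; exact: measurable_snd.
    exact: (measurableT_comp (measurable_coord j) measurable_fst).
  have mF : measurable_fun setT F.
    apply/measurable_EFinP; apply: measurable_funM => //; apply: measurable_funM.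
      apply: measurable_funM => //; apply: measurable_funX.
      by apply: (measurableT_comp (@normr_measurable R setT)); exact: measurable_snd.
    exact: (measurableT_comp mG mxy).
  have F0 z : (0 <= F z)%E by rewrite lee_fin mulr_ge0// mulr_ge0// mulr_ge0// exprn_ge0.
  have mI : measurable (`[0%R, 1%R]%classic : set (measurableTypeR R)) by exact: measurable_itv.
  have h y : cube L y -> ((normc (f x))%:E <= \int[@lebesgue_measure R]_(s in `[0%R, 1%R]) F (y, s))%E.
    move=> Qy.
    pose W (s : R) := n%:R * (L + 1) * (N%:R * `|s| ^+ N.-1 * G (x + s ^+ N *: y)).
    have W0 s : 0 <= W s.
      by rewrite mulr_ge0//; [rewrite mulr_ge0//; lra|rewrite mulr_ge0// mulr_ge0// exprn_ge0].
    have FW : (\int[@lebesgue_measure R]_(s in `[0%R, 1%R]) F (y, s) =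
        2%:E * \int[@lebesgue_measure R]_(s in `[0%R, 1%R]) (W s)%:E)%E.
      rewrite -ge0_integralZl_EFin//; last 2 first.
      - by move=> s _; rewrite lee_fin.
      - apply/measurable_EFinP/measurable_funTS; apply: measurable_funM => //.
        apply: measurable_funM; last exact: (measurableT_comp mG (measurable_fun_pair2 y mxy)).
        by apply: measurable_funM => //; apply: measurable_funX; exact: normr_measurable.
      by apply: eq_integral => s _; rewrite -EFinM /F /W /c /= !mulrA.
    rewrite FW (@le_trans _ _ (`|Re (f x)|%:E + `|Im (f x)|%:E)%E)//.
      by rewrite -EFinD lee_fin normc_le_ReIm.
    rewrite mule_natl mule2n; apply: leeD.
      apply: (@path_bound_component D (fun z => Re (f z)) N L G) => //.
      - by move=> z; exact: smooth_differentiable.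
      - by move=> j; exact: smooth_partial_continuous.
      - move=> j z; apply: le_trans (normc_le_vnorm (grad f z) j).
        by rewrite mxE; exact: (normr_Re_le (_ +i* _)).
      - by rewrite fxy.
    apply: (@path_bound_component D (fun z => Im (f z)) N L G) => //.
    - by move=> z; exact: smooth_differentiable.
    - by move=> j; exact: smooth_partial_continuous.
    - move=> j z; apply: le_trans (normc_le_vnorm (grad f z) j).
      by rewrite mxE; exact: (normr_Im_le (_ +i* _)).
    - by rewrite fxy.
  have mQ := @measurable_cube R n L.
  rewrite -[leLHS](@integral_cube_cst R n L).
  apply: (@le_trans _ _ (\int[leb]_(y in cube L) \int[@lebesgue_measure R]_(s in `[0%R, 1%R]) F (y, s))%E).
    apply: ge0_le_integral => //.
    - by move=> y _; rewrite lee_fin normc_ge0.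
    - apply: measurable_funTS.
      exact: (measurable_integral_in (@lebesgue_measure R) mI mF F0).
  rewrite (fubini_tonelli_in leb (@lebesgue_measure R) mQ mI mF F0).
  rewrite /P -ge0_integralZl_EFin//; last 2 first.
  - by move=> s sI; rewrite lee_fin wm0.
  - by apply/measurable_EFinP/measurable_funTS; exact: (measurable_fun_pair2 x mwm).
  rewrite le_eqVlt; apply/orP; left; apply/eqP; apply: eq_integral => s.
  rewrite inE/= in_itv/= => /andP[s0 _].
  rewrite [X in _ = (_ * X)%E]EFinM (@cube_meanE R n N L M G mG G0 GM) muleA -EFinM.
  rewrite -ge0_integralZl_EFin//; last 3 first.
  - by move=> y _; rewrite lee_fin.
  - apply/measurable_EFinP/measurable_funTS.
    exact: (measurableT_comp mG (measurable_fun_pair1 (s : measurableTypeR R) mxy)).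
  - by rewrite mulr_ge0// mulr_ge0// exprn_ge0.
  apply: eq_integral => y _; rewrite /F -EFinM /=.
  by rewrite (ger0_norm s0) !mulrA.
have mP : measurable_fun setT P := @measurable_ray_average R n N L M G mG G0 GM.
apply: (@le_trans _ _ (\int[leb]_(x in D) ((c `^ q)%:E * (P x `^ q)))%E).
  apply: ge0_le_integral => //.
  - by move=> x _; rewrite lee_fin powR_ge0.
  - apply: measurable_funTS; apply/measurable_EFinP.
    apply: (measurableT_comp (measurable_powR q)).
    by apply: continuous_measurable_rV; exact: test_fun_normc_continuous tf.
  - apply: measurable_funTS; apply: measurable_funeM.
    exact: (measurableT_comp (measurable_poweR q)).
  - move=> x Dx; rewrite -!poweR_EFin -poweRM//.
    apply: gt0_ler_poweR; last exact: fP.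
    + exact: ltW.
    + by rewrite in_itv/= leey lee_fin normc_ge0.
    + by rewrite in_itv/= leey mule_ge0.
rewrite ge0_integralZl_EFin ?powR_ge0//; last 2 first.
- by move=> x _; exact: poweR_ge0.
- by apply: measurable_funTS; exact: (measurableT_comp (measurable_poweR q)).
rewrite [in leRHS]EFinM -muleA; apply: lee_wpmul2l; first by rewrite lee_fin powR_ge0.
rewrite -EFinM.
apply: le_trans hP; apply: ge0_subset_integral => //.
  exact: (measurableT_comp (measurable_poweR q)).
by move=> x _; exact: poweR_ge0.
Qed.

End sobolev.

(** * Power integrals and the closure of the test functions *)
Section power_integrals.
Variables (R : realType) (n : nat).
Local Notation E := 'rV[R]_n.
Local Notation leb := (lebesgue_rV R n).
Local Notation Re := complex.Re.
Local Notation Im := complex.Im.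
Local Notation normc := ComplexField.Normc.normc.
Implicit Types (D : set E) (p q : R).

Lemma normcD (a b : R[i]) : normc (a + b) <= normc a + normc b.
Proof. by rewrite -!vnorm_crow (le_trans _ (vnormD _ _))// /crow raddfD. Qed.

Lemma normcB (a b : R[i]) : normc (a - b) = normc (b - a).
Proof. by rewrite -!vnorm_crow /crow -opprB raddfN vnormN. Qed.

Lemma measurable_sqrt : measurable_fun setT (@Num.sqrt R).
Proof. by apply: continuous_measurable_fun; exact: sqrt_continuous. Qed.

Lemma cmeasurable_normc D (u : E -> R[i]) : cmeasurable D u ->
  measurable_fun D (fun x => normc (u x)).
Proof.
move=> [mr mi]; under eq_fun do rewrite normc_ReIm.
apply: (measurableT_comp measurable_sqrt).
by apply: measurable_funD; exact: measurable_funX.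
Qed.

Lemma measurable_vnorm D m (g : E -> 'rV[R[i]]_m) :
  (forall i, cmeasurable D (fun x => g x ord0 i)) ->
  measurable_fun D (fun x => vnorm (g x)).
Proof.
move=> mg; apply: (measurableT_comp measurable_sqrt).
apply: measurable_sum => i; apply: measurable_funX.
exact: cmeasurable_normc.
Qed.

Lemma measurable_powR_EFin D (f : E -> R) p : measurable_fun D f ->
  measurable_fun D (fun x => (f x `^ p)%:E).
Proof. by move=> mf; apply/measurable_EFinP; apply: (measurableT_comp (measurable_powR p)). Qed.

Lemma LnormD_powE D p (f : E -> R) : 0 < p ->
  (LnormD D p%:E f `^ p = \int[leb]_(x in D) (`|f x| `^ p)%:E)%E.
Proof.
move=> p0; rewrite /LnormD poweR_Lnorm ?gt_eqF// [RHS]integral_mkcond.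
apply: eq_integral => x _; rewrite !patchE; case: ifPn => //= _.
by rewrite normr0 powR0// gt_eqF.
Qed.

Lemma LnormD_E D p (f : E -> R) : 0 < p ->
  (LnormD D p%:E f = (\int[leb]_(x in D) (`|f x| `^ p)%:E) `^ p^-1)%E.
Proof.
move=> p0; rewrite -LnormD_powE// -poweRrM mulfV ?gt_eqF// poweRe1//.
exact: Lnorm_ge0.
Qed.

Lemma LnormDC_powE D p (u : E -> R[i]) : 0 < p ->
  (LnormDC D p%:E u `^ p = \int[leb]_(x in D) (normc (u x) `^ p)%:E)%E.
Proof.
move=> p0; rewrite /LnormDC /LnormDV (LnormD_powE _ _ p0); apply: eq_integral => x _.
by rewrite ger0_norm// normc_ge0.
Qed.

Lemma LnormDV_powE D p (g : E -> 'rV[R[i]]_n) : 0 < p ->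
  (LnormDV D p%:E g `^ p = \int[leb]_(x in D) (vnorm (g x) `^ p)%:E)%E.
Proof.
move=> p0; rewrite /LnormDC /LnormDV (LnormD_powE _ _ p0); apply: eq_integral => x _.
by rewrite ger0_norm// vnorm_ge0.
Qed.

Lemma cvg_poweR_small (a : (\bar R)^nat) p (e : R) : 0 < p -> 0 < e ->
  (forall k, 0 <= a k)%E -> a @ \oo --> 0%E ->
  \forall k \near \oo, (a k `^ p <= e%:E)%E.
Proof.
move=> p0 e0 a0 ca.
have ep : 0 < e `^ p^-1 by exact: powR_gt0.
have h0 : [set y : \bar R | (y < (e `^ p^-1)%:E)%E] 0%E by rewrite /= lte_fin.
have h1 : \forall k \near \oo, (a k < (e `^ p^-1)%:E)%E :=
  ca _ (open_nbhs_nbhs (conj (@open_ereal_lt_ereal R _) h0)).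
move: h1; apply: filterS => k /= ak.
rewrite (_ : e = (e `^ p^-1) `^ p); last by rewrite -powRrM mulVf ?gt_eqF// powRr1// ltW.
rewrite -poweR_EFin; apply: gt0_ler_poweR; rewrite ?in_itv/= ?leey ?a0 ?lee_fin ?powR_ge0//.
  exact: ltW.
exact: ltW.
Qed.

(** A triangle inequality up to the constant [2 ^ p], sufficient for limits. *)
Lemma integral_powR_triangle D p (a b c : E -> R) : measurable D -> 0 <= p ->
  measurable_fun D a -> measurable_fun D b -> measurable_fun D c ->
  (forall x, 0 <= a x) -> (forall x, 0 <= b x) -> (forall x, 0 <= c x) ->
  (forall x, c x <= a x + b x) ->
  (\int[leb]_(x in D) (c x `^ p)%:E <= (2 `^ p)%:E *
   (\int[leb]_(x in D) (a x `^ p)%:E + \int[leb]_(x in D) (b x `^ p)%:E))%E.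
Proof.
move=> mD p0 ma mb mc a0 b0 c0 abc.
have pge0 (f : E -> R) x : (0 <= (f x `^ p)%:E)%E by rewrite lee_fin powR_ge0.
rewrite -ge0_integralD//; [|exact: measurable_powR_EFin..].
rewrite -ge0_integralZl_EFin ?powR_ge0//; last 2 first.
- by move=> x _; rewrite adde_ge0.
- by apply: emeasurable_funD; exact: measurable_powR_EFin.
apply: ge0_le_integral => //.
- exact: measurable_powR_EFin.
- by apply: measurable_funeM; apply: emeasurable_funD; exact: measurable_powR_EFin.
move=> x _; rewrite -EFinD -EFinM lee_fin.
apply: (le_trans _ (powR_addr_le (a0 x) (b0 x) p0)).
by apply: ge0_ler_powR; rewrite ?nnegrE ?addr_ge0.
Qed.

(** The form in which membership in the closure of the test functions is
    used: norms are replaced by power integrals. *)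
Definition approximable D p (w : E -> R[i]) (gw : E -> 'rV[R[i]]_n) : Prop :=
  forall e : R, 0 < e -> exists f, [/\ test_fun D f,
    (\int[leb]_(x in D) (normc (f x - w x) `^ p)%:E <= e%:E)%E &
    (\int[leb]_(x in D) (vnorm (grad f x - gw x) `^ p)%:E <= e%:E)%E].

Lemma W01p_approximating_sequence D p w gw : 0 < p -> W01p D p w gw ->
  exists2 f : nat -> E -> R[i], (forall k, test_fun D (f k)) &
  forall e : R, 0 < e -> \forall k \near \oo,
    (\int[leb]_(x in D) (normc (f k x - w x) `^ p)%:E <= e%:E)%E /\
    (\int[leb]_(x in D) (vnorm (grad (f k) x - gw x) `^ p)%:E <= e%:E)%E.
Proof.
move=> p0 [_ [f [tf fw gfw]]]; exists f => // e e0.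
have h1 := cvg_poweR_small p0 e0 (fun k => Lnorm_ge0 _ _ _) fw.
have h2 := cvg_poweR_small p0 e0 (fun k => Lnorm_ge0 _ _ _) gfw.
near=> k; split.
- by rewrite -LnormDC_powE//; near: k.
- by rewrite -LnormDV_powE//; near: k.
Unshelve. all: by end_near. Qed.

Lemma W01p_approximable D p w gw : 0 < p -> W01p D p w gw -> approximable D p w gw.
Proof.
move=> p0 /(W01p_approximating_sequence p0)[f tf fw] e e0.
by have [k _ /(_ k (leqnn k))[h1 h2]] := fw _ e0; exists (f k).
Qed.

Lemma test_fun_cmeasurable D (f : E -> R[i]) A : test_fun D f -> cmeasurable A f.
Proof.
by move=> [sr si _ _]; split; apply: measurable_funTS; apply: continuous_measurable_rV;
  exact: smooth_continuous.
Qed.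

Lemma test_fun_grad_cmeasurable D (f : E -> R[i]) A i : test_fun D f ->
  cmeasurable A (fun x => grad f x ord0 i).
Proof.
move=> [sr si _ _]; split; under eq_fun do rewrite mxE /=;
  by apply: measurable_funTS; apply: continuous_measurable_rV;
  exact: smooth_partial_continuous.
Qed.

Lemma cmeasurableD (A : set E) (f g : E -> R[i]) :
  cmeasurable A f -> cmeasurable A g -> cmeasurable A (fun x => f x + g x).
Proof.
move=> [fr fi] [gr gi]; split.
  by under eq_fun do rewrite ReD; exact: measurable_funD.
by under eq_fun do rewrite ImD; exact: measurable_funD.
Qed.

Lemma cmeasurableM (A : set E) (f g : E -> R[i]) :
  cmeasurable A f -> cmeasurable A g -> cmeasurable A (fun x => f x * g x).
Proof.
move=> [fr fi] [gr gi]; split.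
  rewrite (_ : (fun x => _) = (fun x => Re (f x) * Re (g x) - Im (f x) * Im (g x))).
    by apply: measurable_funB; exact: measurable_funM.
  by apply/funext => x; case: (f x) (g x) => ? ? [].
rewrite (_ : (fun x => _) = (fun x => Re (f x) * Im (g x) + Im (f x) * Re (g x))).
  by apply: measurable_funD; exact: measurable_funM.
by apply/funext => x; case: (f x) (g x) => ? ? [].
Qed.

Lemma cmeasurable_cst (A : set E) (c : R[i]) : cmeasurable A (fun=> c).
Proof. by split; exact: measurable_cst. Qed.

Lemma cmeasurableB (A : set E) (f g : E -> R[i]) :
  cmeasurable A f -> cmeasurable A g -> cmeasurable A (fun x => f x - g x).
Proof.
move=> mf mg; under eq_fun do rewrite -[- g _]mulN1r.
by apply: cmeasurableD => //; apply: cmeasurableM => //; exact: cmeasurable_cst.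
Qed.

Lemma cmeasurable_rowB (A : set E) m (f g : E -> 'rV[R[i]]_m) :
  (forall i, cmeasurable A (fun x => f x ord0 i)) ->
  (forall i, cmeasurable A (fun x => g x ord0 i)) ->
  forall i, cmeasurable A (fun x => (f x - g x) ord0 i).
Proof.
by move=> mf mg i; under eq_fun do rewrite !mxE; exact: cmeasurableB.
Qed.

Lemma min_powR_le (d M p q : R) : 0 <= d -> 0 < M -> 0 < p -> p <= q ->
  Num.min d M `^ q <= M `^ (q - p) * d `^ p.
Proof.
move=> d0 M0 p0 pq; have m0 : 0 <= Num.min d M by rewrite le_min d0 ltW.
have [mm|mN0] := eqVneq (Num.min d M) 0.
  by rewrite mm powR0 ?mulr_ge0 ?powR_ge0// gt_eqF// (lt_le_trans p0).
rewrite (_ : Num.min d M `^ q = Num.min d M `^ (q - p) * Num.min d M `^ p); last first.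
  by rewrite -powRD ?mN0 ?implybT// subrK.
apply: ler_pM; rewrite ?powR_ge0//; apply: ge0_ler_powR => //.
- by rewrite subr_ge0.
- by rewrite nnegrE ltW.
- by rewrite ge_min lexx orbT.
- exact: ltW.
- by rewrite ge_min lexx.
Qed.

(** Truncating at height [M] trades the missing [L^q] convergence for [L^p]
    convergence, since [min t M ^ q <= M ^ (q - p) * t ^ p]; monotone
    convergence then removes the truncation. *)
Lemma sobolev_closure D p q (C : R) (w : E -> R[i]) (gw : E -> 'rV[R[i]]_n) :
  measurable D -> 1 <= p -> p <= q -> 0 <= C ->
  (forall f, test_fun D f ->
   (\int[leb]_(x in D) (normc (f x) `^ q)%:E <=
    C%:E * (\int[leb]_(x in D) (vnorm (grad f x) `^ p)%:E) `^ (q / p))%E) ->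
  cmeasurable D w -> (forall i, cmeasurable D (fun x => gw x ord0 i)) ->
  approximable D p w gw ->
  forall e : R, 0 < e ->
  (\int[leb]_(x in D) (normc (w x) `^ q)%:E <=
   (2 `^ q)%:E * (C%:E * ((2 `^ p)%:E *
     (\int[leb]_(x in D) (vnorm (gw x) `^ p)%:E + e%:E)) `^ (q / p) + e%:E))%E.
Proof.
move=> mD p1 pq C0 sob mw mgw app e e0.
have p0 : 0 < p by exact: lt_le_trans p1.
have q0 : 0 < q by exact: lt_le_trans pq.
set I := (\int[leb]_(x in D) (vnorm (gw x) `^ p)%:E)%E.
set B := ((2 `^ q)%:E * _)%E.
have I0 : (0 <= I)%E by apply: integral_ge0 => x _; rewrite lee_fin powR_ge0.
have mnw := cmeasurable_normc mw.
have trunc (M : R) : 0 < M ->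
    (\int[leb]_(x in D) (Num.min (normc (w x)) M `^ q)%:E <= B)%E.
  move=> M0; have K0 : 0 < M `^ (q - p) by exact: powR_gt0.
  (* The [L^p] error, multiplied by [M ^ (q - p)], has to stay below [e]. *)
  have ee0 : 0 < Num.min e (e / M `^ (q - p)) by rewrite lt_min e0 divr_gt0.
  have [f [tf fw gfw]] := app _ ee0.
  have mf := test_fun_cmeasurable D tf.
  have mgf i := test_fun_grad_cmeasurable D i tf.
  have mmin : measurable_fun D (fun x => Num.min (normc (f x - w x)) M).
    by apply: measurable_minr => //; apply: cmeasurable_normc; exact: cmeasurableB.
  apply: le_trans (@integral_powR_triangle D q (fun x => normc (f x))
    (fun x => Num.min (normc (f x - w x)) M) _ mD (ltW q0) _ mmin _ _ _ _ _) _ => //.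
  - exact: cmeasurable_normc.
  - exact: measurable_minr.
  - by move=> x; exact: normc_ge0.
  - by move=> x; rewrite le_min normc_ge0 ltW.
  - by move=> x; rewrite le_min normc_ge0 ltW.
  - move=> x; have h : normc (w x) <= normc (f x) + normc (f x - w x).
      by have := normcD (f x) (w x - f x); rewrite subrKC normcB.
    rewrite ge_min; apply/orP; have [wM|Mw] := leP (normc (f x - w x)) M; first by left.
    by right; rewrite lerDr normc_ge0.
  rewrite /B; apply: lee_wpmul2l; first by rewrite lee_fin powR_ge0.
  apply: leeD.
    apply: (le_trans (sob _ tf)); apply: lee_wpmul2l; first by rewrite lee_fin.
    have Ige0 : (0 <= \int[leb]_(x in D) (vnorm (grad f x) `^ p)%:E)%E.
      by apply: integral_ge0 => x _; rewrite lee_fin powR_ge0.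
    apply: gt0_ler_poweR; rewrite ?in_itv/= ?leey ?andbT//.
    - by rewrite divr_ge0// ltW.
    - apply: mule_ge0; first by rewrite lee_fin powR_ge0.
      by apply: adde_ge0; [exact: I0|rewrite lee_fin; exact: ltW].
    apply: le_trans (@integral_powR_triangle D p (fun x => vnorm (gw x))
      (fun x => vnorm (grad f x - gw x)) _ mD (ltW p0) _ _ _ _ _ _ _) _ => //.
    - exact: measurable_vnorm.
    - by apply: measurable_vnorm; exact: cmeasurable_rowB.
    - exact: measurable_vnorm.
    - by move=> x; exact: vnorm_ge0.
    - by move=> x; exact: vnorm_ge0.
    - by move=> x; exact: vnorm_ge0.
    - by move=> x; rewrite -{1}(subrK (gw x) (grad f x)) addrC vnormD.
    apply: lee_wpmul2l; first by rewrite lee_fin powR_ge0.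
    apply: leeD; first exact: lexx.
    by apply: (le_trans gfw); rewrite lee_fin ge_min lexx.
  apply: (@le_trans _ _ (\int[leb]_(x in D) ((M `^ (q - p))%:E * (normc (f x - w x) `^ p)%:E))%E).
    apply: ge0_le_integral => //.
    - by move=> x _; rewrite lee_fin powR_ge0.
    - exact: measurable_powR_EFin.
    - apply: measurable_funeM; apply: measurable_powR_EFin.
      by apply: cmeasurable_normc; exact: cmeasurableB.
    move=> x _; rewrite -EFinM lee_fin; set d := normc _.
    by apply: min_powR_le; [exact: normc_ge0|exact: M0|exact: p0|exact: pq].
  rewrite ge0_integralZl_EFin ?(ltW K0)//; last 2 first.
  - by move=> x _; rewrite lee_fin powR_ge0.
  - apply: measurable_powR_EFin.
    by apply: cmeasurable_normc; exact: cmeasurableB.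
  apply: (@le_trans _ _ ((M `^ (q - p))%:E * (e / M `^ (q - p))%:E)%E).
    apply: lee_wpmul2l; first by rewrite lee_fin ltW.
    by apply: (le_trans fw); rewrite lee_fin ge_min lexx orbT.
  by rewrite -EFinM mulrC divfK ?gt_eqF.
pose g k x : \bar R := (Num.min (normc (w x)) k.+1%:R `^ q)%:E.
have g0 k x : D x -> (0 <= g k x)%E by rewrite lee_fin powR_ge0.
have mg k : measurable_fun D (g k).
  by apply: measurable_powR_EFin; exact: measurable_minr.
have ndg x : D x -> {homo g ^~ x : a b / (a <= b)%N >-> (a <= b)%E}.
  move=> _ a b ab; rewrite lee_fin; apply: ge0_ler_powR.
  - exact: ltW.
  - by rewrite nnegrE le_min normc_ge0 ler0n.
  - by rewrite nnegrE le_min normc_ge0 ler0n.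
  - by rewrite le_min ge_min lexx/= ge_min ler_nat ltnS ab orbT.
have cg : (\int[leb]_(x in D) g k x @[k --> \oo] -->
    \int[leb]_(x in D) limn (g ^~ x))%E by exact: cvg_monotone_convergence.
have limg x : limn (g ^~ x) = (normc (w x) `^ q)%:E.
  apply/cvg_lim => //; apply: cvg_near_cst.
  exists (Num.bound (normc (w x))) => // k /= hk; rewrite /g min_l//.
  rewrite (le_trans (ltW (archi_boundP (normc_ge0 _))))// ler_nat.
  exact: leq_trans hk _.
under eq_integral do rewrite -limg.
rewrite -(cvg_lim _ cg)//; apply: lime_le; last by apply: nearW => k; exact: trunc.
by apply/cvg_ex; eexists; exact: cg.
Qed.

End power_integrals.

(** * The subcritical embedding *)
Section embedding.
Variables (R : realType) (n : nat) (D : set 'rV[R]_n) (p q : R).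
Local Notation E := 'rV[R]_n.
Local Notation leb := (lebesgue_rV R n).
Local Notation normc := ComplexField.Normc.normc.
Hypotheses (n0 : (0 < n)%N) (oD : open D) (bD : bounded_set D).
Hypotheses (p1 : 1 <= p) (pq : p <= q) (npq : n%:R * (q - p) < p * q).

Let mD : measurable D. Proof. exact: open_measurable_rV. Qed.
Let p0 : 0 < p. Proof. exact: lt_le_trans p1. Qed.
Let q0 : 0 < q. Proof. exact: lt_le_trans pq. Qed.

Lemma embedding_eps : exists2 C : R, 0 <= C & forall (w : E -> R[i]) (gw : E -> 'rV[R[i]]_n),
  cmeasurable D w -> (forall i, cmeasurable D (fun x => gw x ord0 i)) ->
  approximable D p w gw -> forall e : R, 0 < e ->
  (\int[leb]_(x in D) (normc (w x) `^ q)%:E <=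
   (2 `^ q)%:E * (C%:E * ((2 `^ p)%:E *
     (\int[leb]_(x in D) (vnorm (gw x) `^ p)%:E + e%:E)) `^ (q / p) + e%:E))%E.
Proof.
have [C C0 hC] := sobolev_test n0 oD bD p1 pq npq; exists C => // w gw mw mgw app e e0.
exact: (sobolev_closure mD p1 pq C0 hC mw mgw app e0).
Qed.

(** The form used below: it applies to the differences of an approximating
    sequence and, with zero gradient, to the vanishing of [w]. *)
Lemma embedding_small (e : R) : 0 < e -> exists2 d : R, 0 < d &
  forall (w : E -> R[i]) (gw : E -> 'rV[R[i]]_n),
  cmeasurable D w -> (forall i, cmeasurable D (fun x => gw x ord0 i)) ->
  approximable D p w gw ->
  (\int[leb]_(x in D) (vnorm (gw x) `^ p)%:E <= d%:E)%E ->
  (\int[leb]_(x in D) (normc (w x) `^ q)%:E <= e%:E)%E.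
Proof.
move=> e0; have [C C0 hC] := embedding_eps.
have C1 : 0 < C + 1 by lra.
(* Both terms of the embedding, the one with [C] and the error [d], are made
   at most [t]. *)
pose t := e / (2 * 2 `^ q).
have t0 : 0 < t by rewrite divr_gt0// mulr_gt0// powR_gt0.
pose d := Num.min t (((t / (C + 1)) `^ (p / q)) / (2 * 2 `^ p)).
have d0 : 0 < d.
  by rewrite lt_min t0 divr_gt0 ?powR_gt0 ?divr_gt0 ?mulr_gt0 ?powR_gt0.
exists d => // w gw mw mgw app gwd.
apply: (le_trans (hC w gw mw mgw app d d0)).
apply: (@le_trans _ _ ((2 `^ q)%:E * (C%:E * ((2 `^ p)%:E * (d%:E + d%:E)) `^ (q / p) + d%:E))%E).
  apply: lee_wpmul2l; first by rewrite lee_fin powR_ge0.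
  apply: leeD; last exact: lexx.
  apply: lee_wpmul2l; first by rewrite lee_fin.
  have I0 : (0 <= \int[leb]_(x in D) (vnorm (gw x) `^ p)%:E)%E.
    by apply: integral_ge0 => x _; rewrite lee_fin powR_ge0.
  have h2p : (0 <= (2 `^ p)%:E :> \bar R)%E by rewrite lee_fin powR_ge0.
  have hd : (0 <= d%:E)%E by rewrite lee_fin ltW.
  apply: gt0_ler_poweR.
  - by rewrite divr_ge0// ltW.
  - by rewrite in_itv/= leey andbT; apply: mule_ge0 h2p (adde_ge0 I0 hd).
  - by rewrite in_itv/= leey andbT; apply: mule_ge0 h2p (adde_ge0 hd hd).
  - by apply: (lee_wpmul2l h2p); apply: leeD => //.
rewrite -EFinD -EFinM lee_fin.
have h1 : (2 `^ p * (d + d)) `^ (q / p) <= t / (C + 1).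
  apply: (@le_trans _ _ (((t / (C + 1)) `^ (p / q)) `^ (q / p))).
    apply: ge0_ler_powR.
    - by rewrite divr_ge0// ltW.
    - by rewrite nnegrE mulr_ge0 ?powR_ge0 ?addr_ge0 ?(ltW d0).
    - by rewrite nnegrE powR_ge0.
    - have : d <= ((t / (C + 1)) `^ (p / q)) / (2 * 2 `^ p) by rewrite ge_min lexx orbT.
      rewrite ler_pdivlMr ?mulr_gt0 ?powR_gt0// => h.
      by rewrite (le_trans _ h)// -mulr2n -mulr_natl; rewrite le_eqVlt; apply/orP; left; apply/eqP; ring.
  rewrite -powRrM (_ : p / q * (q / p) = 1); last first.
    by field; rewrite !gt_eqF.
  by rewrite powRr1// divr_ge0// ltW.
have h2 : d <= t by rewrite ge_min lexx.
have h3 : C * (2 `^ p * (d + d)) `^ (q / p) <= t.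
  apply: (@le_trans _ _ ((C + 1) * (t / (C + 1)))).
    by apply: ler_pM; rewrite ?powR_ge0// lerDl.
  by rewrite mulrC divfK// gt_eqF.
rewrite (_ : e = 2 `^ q * (t + t)); last first.
  by rewrite /t; field; rewrite gt_eqF// powR_gt0.
by rewrite ler_wpM2l ?powR_ge0// lerD.
Qed.

Lemma W01p_cmeasurable w gw : W01p D p w gw ->
  cmeasurable D w /\ forall i, cmeasurable D (fun x => gw x ord0 i).
Proof. by move=> [[[mw _] [mgw _] _] _]. Qed.

Lemma W01p_grad_lty w gw : W01p D p w gw ->
  (\int[leb]_(x in D) (vnorm (gw x) `^ p)%:E < +oo)%E.
Proof. by move=> [[_ [_ h] _] _]; rewrite -(LnormDV_powE D gw p0) poweR_lty. Qed.

Lemma W01p_Lp_lty w gw : W01p D p w gw ->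
  (\int[leb]_(x in D) (normc (w x) `^ p)%:E < +oo)%E.
Proof. by move=> [[[_ h] _ _] _]; rewrite -(LnormDC_powE D w p0) poweR_lty. Qed.

Lemma W01p_Lq_lty w gw : W01p D p w gw ->
  (\int[leb]_(x in D) (normc (w x) `^ q)%:E < +oo)%E.
Proof.
move=> Ww; have [mw mgw] := W01p_cmeasurable Ww.
have [C C0 hC] := embedding_eps.
apply: (le_lt_trans (hC _ _ mw mgw (W01p_approximable p0 Ww) 1 ltr01)).
have : (\int[leb]_(x in D) (vnorm (gw x) `^ p)%:E)%E \is a fin_num.
  rewrite ge0_fin_numE; first exact: W01p_grad_lty Ww.
  by apply: integral_ge0 => x _; rewrite lee_fin powR_ge0.
move=> /fineK <-.
by rewrite -EFinD -EFinM ltry.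
Qed.

Lemma W01p_grad_eq0 w gw : W01p D p w gw ->
  (\int[leb]_(x in D) (vnorm (gw x) `^ p)%:E = 0)%E ->
  (\int[leb]_(x in D) (normc (w x) `^ q)%:E = 0)%E.
Proof.
move=> Ww gw0; have [mw mgw] := W01p_cmeasurable Ww.
apply/eqP; rewrite eq_le; apply/andP; split; last first.
  by apply: integral_ge0 => x _; rewrite lee_fin powR_ge0.
apply/lee_addgt0Pr => e e0; rewrite add0e.
have [d d0 hd] := embedding_small e0.
apply: (hd w gw mw mgw (W01p_approximable p0 Ww)).
by rewrite gw0 lee_fin ltW.
Qed.

(** [embedding_small] applies to [f - w], itself approximable by [f - g] for
    test functions [g] close to [w]. *)
Lemma W01p_approximation_Lq w gw (e : R) : W01p D p w gw -> 0 < e ->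
  exists f, [/\ test_fun D f,
    (\int[leb]_(x in D) (vnorm (grad f x - gw x) `^ p)%:E <= e%:E)%E &
    (\int[leb]_(x in D) (normc (f x - w x) `^ q)%:E <= e%:E)%E].
Proof.
move=> Ww e0; have [mw mgw] := W01p_cmeasurable Ww.
have [d d0 hd] := embedding_small e0.
have app := W01p_approximable p0 Ww.
have de0 : 0 < Num.min d e by rewrite lt_min d0.
have [f [tf fw gfw]] := app _ de0.
have mf := test_fun_cmeasurable D tf.
have mgf i := test_fun_grad_cmeasurable D i tf.
exists f; split => //.
  by apply: (le_trans gfw); rewrite lee_fin ge_min lexx orbT.
apply: (hd (fun x => f x - w x) (fun x => grad f x - gw x)).
- exact: cmeasurableB.
- exact: cmeasurable_rowB.
- move=> t t0; have [g [tg gw' ggw]] := app _ t0.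
  have tng := test_funZ (-1) tg.
  exists (fun x => f x + -1 * g x); split.
  + exact: test_funD.
  + apply: le_trans gw'; rewrite le_eqVlt; apply/orP; left; apply/eqP.
    apply: eq_integral => x _; rewrite (normcB (g x)).
    by congr ((normc _ `^ _)%:E); ring.
  + apply: le_trans ggw; rewrite le_eqVlt; apply/orP; left; apply/eqP.
    apply: eq_integral => x _.
    rewrite (gradD _ tf tng) (gradZ _ _ tg) -(vnormN (grad g x - _)).
    by congr ((vnorm _ `^ _)%:E); apply/rowP => j; rewrite !mxE; ring.
- by apply: (le_trans gfw); rewrite lee_fin ge_min lexx.
Qed.

End embedding.

(** * Complex integrals and integration by parts *)
Section complex_integrals.
Variables (R : realType) (n : nat).
Local Notation E := 'rV[R]_n.
Local Notation leb := (lebesgue_rV R n).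
Local Notation Re := complex.Re.
Local Notation Im := complex.Im.
Local Notation normc := ComplexField.Normc.normc.
Implicit Types (D : set E).

Lemma Re_cintegral D (f : E -> R[i]) :
  Re (cintegral D f) = \int[leb]_(x in D) Re (f x).
Proof. by []. Qed.

Lemma cintegrable_le D (f : E -> R[i]) (g : E -> R) : measurable D ->
  cmeasurable D f -> leb.-integrable D (EFin \o g) ->
  (forall x, D x -> `|Re (f x)| <= g x) -> (forall x, D x -> `|Im (f x)| <= g x) ->
  cintegrable D f.
Proof.
move=> mD [mr mi] ig fr fi.
split; apply: (le_integrable mD _ _ ig).
- exact/measurable_EFinP.
- by move=> x Dx /=; rewrite lee_fin (le_trans (fr x Dx))// ler_norm.
- exact/measurable_EFinP.
- by move=> x Dx /=; rewrite lee_fin (le_trans (fi x Dx))// ler_norm.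
Qed.

Lemma cintegralD D (f g : E -> R[i]) : measurable D ->
  cintegrable D f -> cintegrable D g ->
  cintegral D (fun x => f x + g x) = cintegral D f + cintegral D g.
Proof.
move=> mD [fr fi] [gr gi]; rewrite /cintegral.
under eq_Rintegral do rewrite ReD.
under [X in _ +i* X]eq_Rintegral do rewrite ImD.
by rewrite !RintegralD.
Qed.

Lemma RintegralZB D (a b : R) (f g : E -> R) : measurable D ->
  leb.-integrable D (EFin \o f) -> leb.-integrable D (EFin \o g) ->
  \int[leb]_(x in D) (a * f x + b * g x) =
  a * (\int[leb]_(x in D) f x) + b * (\int[leb]_(x in D) g x).
Proof.
move=> mD fi gi.
have h (c : R) k : leb.-integrable D (EFin \o k) ->
    leb.-integrable D (EFin \o (fun x => c * k x)).
  by move=> ik; exact: (integrableZl mD c ik).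
rewrite RintegralD//; [|exact: h..].
by rewrite !RintegralZl.
Qed.

Lemma integrableZB D (a b : R) (f g : E -> R) : measurable D ->
  leb.-integrable D (EFin \o f) -> leb.-integrable D (EFin \o g) ->
  leb.-integrable D (EFin \o (fun x => a * f x + b * g x)).
Proof.
move=> mD fi gi.
exact: (integrableD mD (integrableZl mD a fi) (integrableZl mD b gi)).
Qed.

Lemma integrable_cst_in D (c : R) : measurable D -> (leb D < +oo)%E ->
  leb.-integrable D (EFin \o (fun=> c)).
Proof.
move=> mD fD; apply/integrableP; split; first exact: measurable_cst.
by under eq_integral do rewrite /=; rewrite integral_cst// lte_mul_pinfty.
Qed.

Lemma compact_supp_integrable D (K : set E) (f : E -> R) : measurable D -> compact K ->
  (forall x, ~ K x -> f x = 0) -> continuous f -> leb.-integrable D (EFin \o f).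
Proof.
move=> mD cK f0 cf.
have [M M0 hM] := compact_supp_bounded cK f0 cf.
have [C C0 hC] := bounded_norm_le (compact_bounded cK).
pose B := [set x : E | forall j, (const_mx (- C) : E) ord0 j <= x ord0 j <= (const_mx C : E) ord0 j].
have mB : measurable B by exact: measurable_rV_box.
have fB : (leb B < +oo)%E.
  by rewrite lebesgue_rV_box ?ltry// => j; rewrite !mxE; lra.
apply: (integrableS measurableT) => //.
apply: (integrable_le_indic mB fB M0); first exact: continuous_measurable_rV.
move=> x; have [Kx|/f0 ->] := pselect (K x); last by rewrite normr0 mulr_ge0.
rewrite indicE mem_set ?mulr1// => j; rewrite !mxE -ler_norml.
by rewrite (le_trans (rV_norm_coord x j))// hC.
Qed.

Lemma Rintegral_supp D (K : set E) (f : E -> R) : K `<=` D ->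
  (forall x, ~ K x -> f x = 0) ->
  (\int[leb]_(x in D) (f x)%:E = \int[leb]_x (f x)%:E)%E.
Proof.
move=> KD f0; rewrite integral_mkcond; apply: eq_integral => x _.
rewrite patchE; case: ifPn => //; rewrite notin_setE => nDx.
by rewrite f0// => /KD.
Qed.

Lemma partialM (a c : E -> R) i x : differentiable a x -> differentiable c x ->
  partial i (fun y => a y * c y) x = a x * partial i c x + partial i a x * c x.
Proof.
move=> da dc; rewrite /partial.
have hM := deriveM (diff_derivable (v := delta_mx ord0 i) da) (diff_derivable (v := delta_mx ord0 i) dc).
by rewrite [LHS]hM addrC [X in X + _]mulrC addrC; congr (_ + _); rewrite -[LHS]/(_ * _) mulrC.
Qed.

(** The product has compact support, so its derivative integrates to zero. *)
Lemma smooth_ibp D (K : set E) (a c : E -> R) i : measurable D ->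
  compact K -> K `<=` D -> (forall x, ~ K x -> a x = 0) -> smooth a -> smooth c ->
  [/\ leb.-integrable D (EFin \o (fun x => a x * partial i c x)),
      leb.-integrable D (EFin \o (fun x => partial i a x * c x)) &
      \int[leb]_(x in D) (a x * partial i c x) =
      - \int[leb]_(x in D) (partial i a x * c x)].
Proof.
move=> mD cK KD a0 sa sc.
have clK : closed K by exact: compact_closed (@norm_hausdorff _ _) cK.
have da x := smooth_differentiable x sa.
have dc x := smooth_differentiable x sc.
have c1 : continuous (fun x => a x * partial i c x).
  move=> x; exact: (cvgM (smooth_continuous sa (x:=x)) (smooth_partial_continuous sc (x:=x))).
have c2 : continuous (fun x => partial i a x * c x).
  move=> x; exact: (cvgM (smooth_partial_continuous sa (x:=x)) (smooth_continuous sc (x:=x))).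
have i1 : leb.-integrable D (EFin \o (fun x => a x * partial i c x)).
  by apply: (compact_supp_integrable mD cK) => // x /a0 ->; rewrite mul0r.
have i2 : leb.-integrable D (EFin \o (fun x => partial i a x * c x)).
  apply: (compact_supp_integrable mD cK) => // x Kx.
  by rewrite (partial_supp i clK a0)// mul0r.
split => //; apply/eqP; rewrite -addr_eq0 -RintegralD//.
under eq_Rintegral => x _ do rewrite -(partialM i (da x) (dc x)).
rewrite /Rintegral (@Rintegral_supp D K)//; last first.
  by apply: partial_supp => // x /a0 ->; rewrite mul0r.
rewrite (@integral_partial_eq0 _ _ K)//.
- by move=> x /a0 ->; rewrite mul0r.
- by move=> x; exact: differentiableM.
rewrite (_ : partial i _ = (fun x => a x * partial i c x + partial i a x * c x)); last first.
  by apply/funext => x; rewrite (partialM i (da x) (dc x)).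
by move=> x; exact: (cvgD (c1 x) (c2 x)).
Qed.

(** Complex integration by parts splits into four real ones. *)
Lemma test_fun_weak_grad D (f : E -> R[i]) : measurable D -> test_fun D f ->
  weak_grad D f (grad f).
Proof.
move=> mD tf g [gr gi _ _] i.
have /test_funP[fr fi [K [cK KD f0]]] := tf.
have f0r x : ~ K x -> Re (f x) = 0 by move=> /f0 ->.
have f0i x : ~ K x -> Im (f x) = 0 by move=> /f0 ->.
have [a1 b1 e1] := smooth_ibp i mD cK KD f0r fr gr.
have [a2 b2 e2] := smooth_ibp i mD cK KD f0i fi gi.
have [a3 b3 e3] := smooth_ibp i mD cK KD f0r fr gi.
have [a4 b4 e4] := smooth_ibp i mD cK KD f0i fi gr.
have hc (u v w z : R) : u = - w -> v = - z -> (u +i* v) = - (w +i* z) by move=> -> ->.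
pose fr' x := Re (f x); pose fi' x := Im (f x); pose gr' x := Re (g x); pose gi' x := Im (g x).
have l1 : \int[leb]_(x in D) Re (f x * grad g x ord0 i) =
    1 * (\int[leb]_(x in D) (fr' x * partial i gr' x)) +
    (-1) * (\int[leb]_(x in D) (fi' x * partial i gi' x)).
  rewrite -RintegralZB//; apply: eq_Rintegral => x _.
  by rewrite mxE /fr' /fi'; case: (f x) => u v /=; ring.
have l2 : \int[leb]_(x in D) Im (f x * grad g x ord0 i) =
    1 * (\int[leb]_(x in D) (fr' x * partial i gi' x)) +
    1 * (\int[leb]_(x in D) (fi' x * partial i gr' x)).
  rewrite -RintegralZB//; apply: eq_Rintegral => x _.
  by rewrite mxE /fr' /fi'; case: (f x) => u v /=; ring.
have l3 : \int[leb]_(x in D) Re (grad f x ord0 i * g x) =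
    1 * (\int[leb]_(x in D) (partial i fr' x * gr' x)) +
    (-1) * (\int[leb]_(x in D) (partial i fi' x * gi' x)).
  rewrite -RintegralZB//; apply: eq_Rintegral => x _.
  by rewrite mxE /gr' /gi'; case: (g x) => u v /=; ring.
have l4 : \int[leb]_(x in D) Im (grad f x ord0 i * g x) =
    1 * (\int[leb]_(x in D) (partial i fr' x * gi' x)) +
    1 * (\int[leb]_(x in D) (partial i fi' x * gr' x)).
  rewrite -RintegralZB//; apply: eq_Rintegral => x _.
  by rewrite mxE /gr' /gi'; case: (g x) => u v /=; ring.
rewrite /cintegral l1 l2 l3 l4; apply: hc.
  by rewrite e1 e2; ring.
by rewrite e3 e4; ring.
Qed.

Lemma cintegrable_mul_bounded D p (u b : E -> R[i]) (M : R) :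
  measurable D -> (leb D < +oo)%E -> 1 <= p -> 0 <= M ->
  cmeasurable D u -> cmeasurable D b ->
  (\int[leb]_(x in D) (normc (u x) `^ p)%:E < +oo)%E ->
  (forall x, D x -> normc (b x) <= M) -> cintegrable D (fun x => u x * b x).
Proof.
move=> mD fD p1 M0 mu mb up bM.
have ig : leb.-integrable D (EFin \o (fun x => M * 1 + M * normc (u x) `^ p)).
  apply: (@integrableZB _ _ _ (fun=> 1)) => //.
    exact: integrable_cst_in.
  apply/integrableP; split; first exact: measurable_powR_EFin (cmeasurable_normc mu).
  by under eq_integral do rewrite /= ger0_norm ?powR_ge0//.
have h x : D x -> normc (u x * b x) <= M * 1 + M * normc (u x) `^ p.
  move=> Dx; rewrite ComplexField.Normc.normcM -mulrDr mulrC; apply: ler_pM.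
  - exact: normc_ge0.
  - exact: normc_ge0.
  - exact: bM.
  - by apply: ler1D_powR => //; exact: normc_ge0.
apply: (cintegrable_le mD _ ig).
- exact: cmeasurableM.
- by move=> x Dx; apply: le_trans (h x Dx); exact: normr_Re_le.
- by move=> x Dx; apply: le_trans (h x Dx); exact: normr_Im_le.
Qed.

Lemma in_LpC_lty D p (u : E -> R[i]) : 0 < p -> cmeasurable D u ->
  (\int[leb]_(x in D) (normc (u x) `^ p)%:E < +oo)%E -> in_LpC D p%:E u.
Proof.
move=> p0 mu h; split=> //; rewrite /LnormDC LnormD_E//; apply: poweR_lty.
by under eq_integral do rewrite ger0_norm ?normc_ge0//.
Qed.

Lemma in_LpV_lty D p (g : E -> 'rV[R[i]]_n) : 0 < p ->
  (forall i, cmeasurable D (fun x => g x ord0 i)) ->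
  (\int[leb]_(x in D) (vnorm (g x) `^ p)%:E < +oo)%E -> in_LpV D p%:E g.
Proof.
move=> p0 mu h; split=> //; rewrite /LnormDV LnormD_E//; apply: poweR_lty.
by under eq_integral do rewrite ger0_norm ?vnorm_ge0//.
Qed.

Lemma bounded_integral_lty D p (b : E -> R) (M : R) : measurable D ->
  (leb D < +oo)%E -> 0 <= p -> measurable_fun D b ->
  (forall x, 0 <= b x <= M) -> (\int[leb]_(x in D) (b x `^ p)%:E < +oo)%E.
Proof.
move=> mD fD p0 mb hb.
apply: (@le_lt_trans _ _ (\int[leb]_(x in D) (M `^ p)%:E)%E).
  apply: ge0_le_integral => //.
  - by move=> x _; rewrite lee_fin powR_ge0.
  - exact: measurable_powR_EFin.
  - move=> x _; rewrite lee_fin; have /andP[b0 bM] := hb x.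
    by apply: ge0_ler_powR; rewrite ?nnegrE// (le_trans b0).
by rewrite integral_cst// lte_mul_pinfty// lee_fin powR_ge0.
Qed.

(** Test functions are the perturbations used in the variational argument. *)
Lemma W01p_add_test D p u gu f : open D -> bounded_set D -> 1 <= p ->
  W01p D p u gu -> test_fun D f ->
  W01p D p (fun x => u x + f x) (fun x => gu x + grad f x).
Proof.
move=> oD bD p1 Wu tf.
have mD := open_measurable_rV oD.
have fD := lebesgue_rV_bounded_lty mD bD.
have p0 : 0 < p by exact: lt_le_trans p1.
have [mu mgu] := W01p_cmeasurable Wu.
have mf := test_fun_cmeasurable D tf.
have mgf i := test_fun_grad_cmeasurable D i tf.
have [M M0 hM] := test_fun_bounded tf.
have ufin := W01p_Lp_lty p1 Wu; have gufin := W01p_grad_lty p1 Wu.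
have mgS i : cmeasurable D (fun x => (gu x + grad f x) ord0 i).
  by under eq_fun do rewrite mxE; exact: cmeasurableD.
have muS := cmeasurableD mu mf.
have ffin : (\int[leb]_(x in D) (normc (f x) `^ p)%:E < +oo)%E.
  apply: (@bounded_integral_lty D p (fun x => normc (f x)) M) => //.
  - exact: ltW.
  - exact: cmeasurable_normc.
  - by move=> x; rewrite normc_ge0; have [] := hM x.
have gffin : (\int[leb]_(x in D) (vnorm (grad f x) `^ p)%:E < +oo)%E.
  apply: (@bounded_integral_lty D p (fun x => vnorm (grad f x)) M) => //.
  - exact: ltW.
  - exact: measurable_vnorm.
  - by move=> x; rewrite vnorm_ge0; have [] := hM x.
have [[_ _ wg] [F [tF Fu gFu]]] := Wu.
split; last first.
  exists (fun k x => F k x + f x); split.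
  - by move=> k; exact: test_funD.
  - under eq_fun do under eq_fun do rewrite opprD addrACA subrr addr0.
    exact: Fu.
  - have -> : (fun k => LnormDV D p%:E (fun x => grad (fun x0 => F k x0 + f x0) x - (gu x + grad f x)))
      = (fun k => LnormDV D p%:E (fun x => grad (F k) x - gu x)).
      apply/funext => k; congr LnormDV; apply/funext => x.
      by rewrite (gradD _ (tF k) tf) opprD addrACA subrr addr0.
    exact: gFu.
split.
- apply: (in_LpC_lty p0 muS).
  apply: (le_lt_trans (@integral_powR_triangle R n D p (fun x => normc (u x)) (fun x => normc (f x)) _
    mD (ltW p0) (cmeasurable_normc mu) (cmeasurable_normc mf) (cmeasurable_normc muS) _ _ _ _)).
  + by move=> x; exact: normc_ge0.
  + by move=> x; exact: normc_ge0.
  + by move=> x; exact: normc_ge0.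
  + by move=> x; exact: normcD.
  + by apply: lte_mul_pinfty; [rewrite lee_fin powR_ge0| |exact: (lte_add_pinfty ufin ffin)].
- apply: (in_LpV_lty p0 mgS).
  apply: (le_lt_trans (@integral_powR_triangle R n D p (fun x => vnorm (gu x)) (fun x => vnorm (grad f x)) _
    mD (ltW p0) (measurable_vnorm mgu) (measurable_vnorm mgf) (measurable_vnorm mgS) _ _ _ _)).
  + by move=> x; exact: vnorm_ge0.
  + by move=> x; exact: vnorm_ge0.
  + by move=> x; exact: vnorm_ge0.
  + by move=> x; exact: vnormD.
  + by apply: lte_mul_pinfty; [rewrite lee_fin powR_ge0| |exact: (lte_add_pinfty gufin gffin)].
move=> g tg i.
have [Mg Mg0 hMg] := test_fun_bounded tg.
have mg := test_fun_cmeasurable D tg.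
have mgg := test_fun_grad_cmeasurable D i tg.
have ggM x : D x -> normc (grad g x ord0 i) <= Mg.
  by move=> _; apply: (le_trans (normc_le_vnorm _ _)); have [] := hMg x.
have gM x : D x -> normc (g x) <= Mg by move=> _; have [] := hMg x.
have le_comp (h : E -> 'rV[R[i]]_n) : (forall i, cmeasurable D (fun x => h x ord0 i)) ->
   (\int[leb]_(x in D) (vnorm (h x) `^ p)%:E < +oo)%E ->
   (\int[leb]_(x in D) (normc (h x ord0 i) `^ p)%:E < +oo)%E.
  move=> mh; apply: le_lt_trans; apply: ge0_le_integral => //.
  - by move=> x _; rewrite lee_fin powR_ge0.
  - by apply: measurable_powR_EFin; exact: cmeasurable_normc.
  - by apply: measurable_powR_EFin; exact: measurable_vnorm.
  - move=> x _; rewrite lee_fin; apply: ge0_ler_powR.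
    + exact: ltW.
    + by rewrite nnegrE normc_ge0.
    + by rewrite nnegrE vnorm_ge0.
    + exact: normc_le_vnorm.
have i1 := cintegrable_mul_bounded mD fD p1 Mg0 mu mgg ufin ggM.
have i2 := cintegrable_mul_bounded mD fD p1 Mg0 mf mgg ffin ggM.
have i3 := cintegrable_mul_bounded mD fD p1 Mg0 (mgu i) mg (le_comp _ mgu gufin) gM.
have i4 := cintegrable_mul_bounded mD fD p1 Mg0 (mgf i) mg (le_comp _ mgf gffin) gM.
have e1 := cintegralD mD i1 i2; have e2 := cintegralD mD i3 i4.
transitivity (cintegral D (fun x => u x * grad g x ord0 i + f x * grad g x ord0 i)).
  by congr cintegral; apply/funext => x; rewrite mulrDl.
rewrite e1 (wg g tg i) (test_fun_weak_grad mD tf tg i) -opprD -e2; congr (- _).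
by congr cintegral; apply/funext => x; rewrite -mulrDl; congr (_ * _); rewrite [RHS]mxE.
Qed.

End complex_integrals.

(** * Hölder's inequality with a potential *)
Section hoelder_potential.
Variables (R : realType) (n : nat) (D : set 'rV[R]_n) (p q : R) (r : \bar R).
Local Notation E := 'rV[R]_n.
Local Notation leb := (lebesgue_rV R n).
Local Notation normc := ComplexField.Normc.normc.
Hypotheses (mD : measurable D) (p1 : 1 < p) (pq : p <= q).
Hypotheses (r1 : (1 < r)%E) (pqr : (r^-1 + (p / q)%:E = 1)%E).

Let p0 : 0 < p. Proof. exact: lt_trans p1. Qed.
Let q0 : 0 < q. Proof. exact: lt_le_trans pq. Qed.

Lemma hoelder_exponent_fin (r0 : R) : r = r0%:E -> 0 < r0 /\ r0^-1 + (q / p)^-1 = 1.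
Proof.
move=> rE; move: r1 pqr; rewrite rE lte_fin => r01.
have r00 : 0 < r0 by exact: lt_trans r01.
by rewrite inver gt_eqF// -EFinD => -[<-]; rewrite invf_div.
Qed.

Lemma hoelder_exponent_infty : r = +oo%E -> q = p.
Proof.
move=> rE; move: pqr; rewrite rE invey add0e => -[h].
by rewrite -[RHS](divfK (lt0r_neq0 q0)) h mul1r.
Qed.

Lemma LnormD_infty_ae (V : E -> R) (v : R) : (LnormD D +oo V <= v%:E)%E ->
  {ae leb, forall x, D x -> (`|V x|%:E <= v%:E)%E}.
Proof.
rewrite /LnormD unlock.
have -> : (0 < leb [set: E])%E.
  by apply: lebesgue_rV_open_gt0; [exact: openT|exists 0].
move=> h; have := ess_sup_ge leb (abse \o (EFin \o V) \_ D).
apply: filterS => x /= hx Dx; apply: le_trans h; apply: le_trans hx.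
by rewrite patchE mem_set.
Qed.

(** Hölder's inequality with exponents [r] and [q / p]; for [r = +oo] the
    exponents [p] and [q] coincide and the essential bound is used directly. *)
Lemma hoelder_potential (V : E -> R) (w : E -> R[i]) (v : R) :
  measurable_fun D V -> cmeasurable D w -> (LnormD D r V <= v%:E)%E ->
  (\int[leb]_(x in D) (`|V x| * normc (w x) `^ p)%:E <=
   v%:E * (\int[leb]_(x in D) (normc (w x) `^ q)%:E) `^ (p / q))%E.
Proof.
move=> mV mw Vv.
have mwn := cmeasurable_normc mw.
have mwp : measurable_fun D (fun x => normc (w x) `^ p).
  exact: (measurableT_comp (measurable_powR p)).
have I0 : (0 <= (\int[leb]_(x in D) (normc (w x) `^ q)%:E) `^ (p / q))%E.
  exact: poweR_ge0.
case: r r1 pqr Vv (@hoelder_exponent_fin) hoelder_exponent_infty => [r0| |] // _ _ Vv h1 h2; last first.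
  have pqE := h2 erefl; rewrite pqE divff ?gt_eqF// poweRe1; last first.
    by apply: integral_ge0 => x _; rewrite lee_fin powR_ge0.
  have v0 : 0 <= v by rewrite -lee_fin (le_trans _ Vv)// Lnorm_ge0.
  rewrite -ge0_integralZl_EFin//; last 2 first.
  - by move=> x _; rewrite lee_fin powR_ge0.
  - exact/measurable_EFinP.
  apply: ae_ge0_le_integral => //.
  - by move=> x _; rewrite lee_fin mulr_ge0 ?powR_ge0.
  - by apply/measurable_EFinP; apply: measurable_funM => //; exact: measurableT_comp.
  - by move=> x _; rewrite -EFinM lee_fin mulr_ge0 ?powR_ge0.
  - by apply: measurable_funeM; exact/measurable_EFinP.
  have := LnormD_infty_ae Vv; apply: filterS => x hx Dx.
  by rewrite -EFinM lee_fin ler_wpM2r ?powR_ge0// -lee_fin hx.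
have [r00 rpq] := h1 _ erefl.
have mV' : measurable_fun setT (V \_ D) by apply/(measurable_restrictT _ mD).
have mw' : measurable_fun setT ((fun x => normc (w x) `^ p) \_ D).
  by apply/(measurable_restrictT _ mD).
have := hoelder leb mV' mw' r00 (divr_gt0 q0 p0) rpq.
rewrite Lnorm1.
rewrite (_ : (\int[leb]_x _)%E = (\int[leb]_(x in D) (`|V x| * normc (w x) `^ p)%:E)%E); last first.
  rewrite [RHS]integral_mkcond; apply: eq_integral => x _.
  rewrite /= !patchE; case: ifPn => _; last by rewrite mul0r normr0.
  by rewrite normrM (ger0_norm (powR_ge0 _ _)).
move=> /le_trans; apply.
rewrite (_ : Lnorm leb (q / p)%:E _ = (\int[leb]_(x in D) (normc (w x) `^ q)%:E) `^ (p / q))%E; last first.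
  have := @LnormD_E R n D (q / p) (fun x => normc (w x) `^ p) (divr_gt0 q0 p0).
  rewrite /LnormD restrict_EFin => ->.
  rewrite invf_div; congr poweR; apply: eq_integral => x _.
  by rewrite (ger0_norm (powR_ge0 _ _)) -powRrM mulrCA divff ?mulr1// gt_eqF.
apply: lee_wpmul2r => //.
by move: Vv; rewrite /LnormD restrict_EFin.
Qed.

End hoelder_potential.

(** * The energy of a solution *)
Section solutions.
Variables (R : realType) (n : nat) (D : set 'rV[R]_n) (p q : R) (r : \bar R).
Local Notation E := 'rV[R]_n.
Local Notation leb := (lebesgue_rV R n).
Local Notation Re := complex.Re.
Local Notation Im := complex.Im.
Local Notation normc := ComplexField.Normc.normc.
Hypotheses (n0 : (0 < n)%N) (oD : open D) (bD : bounded_set D).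
Hypotheses (p1 : 1 < p) (pq : p <= q) (npq : n%:R * (q - p) < p * q).
Hypotheses (r1 : (1 < r)%E) (pqr : (r^-1 + (p / q)%:E = 1)%E).

Let mD : measurable D. Proof. exact: open_measurable_rV. Qed.
Let p0 : 0 < p. Proof. exact: lt_trans p1. Qed.
Let q0 : 0 < q. Proof. exact: lt_le_trans pq. Qed.
Let p1' : 1 <= p. Proof. exact: ltW. Qed.

Lemma ge0_integrable_fin (f : E -> R) : measurable_fun D f -> (forall x, 0 <= f x) ->
  (\int[leb]_(x in D) (f x)%:E < +oo)%E ->
  leb.-integrable D (EFin \o f) /\
  (\int[leb]_(x in D) f x)%:E = (\int[leb]_(x in D) (f x)%:E)%E.
Proof.
move=> mf f0 ff; split.
  apply/integrableP; split; first exact/measurable_EFinP.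
  by under eq_integral => x _ do rewrite /= (ger0_norm (f0 x)).
rewrite /Rintegral fineK// ge0_fin_numE//.
by apply: integral_ge0 => x _; rewrite lee_fin.
Qed.

Lemma rdot_crow (a b : R[i]) : rdot (crow a) (crow b) = Re (a * b^*).
Proof. by rewrite /rdot big_ord1 !mxE; case: a b => a a' [b b'] /=; ring. Qed.

Lemma Re_gradient_pairing (g : E -> 'rV[R[i]]_n) f x : test_fun D f ->
  Re ((vnorm (g x) `^ (p - 2))%:C * dotC (g x) (grad (fun y => (f y)^*) x)) =
  vnorm (g x) `^ (p - 2) * rdot (g x) (grad f x).
Proof. by move=> tf; rewrite ReZ (gradJ _ tf) rdot_conj. Qed.

Lemma Re_potential_pairing (V : E -> R) (u f : E -> R[i]) x :
  Re ((V x * normc (u x) `^ (p - 2))%:C * u x * (f x)^*) =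
  V x * (normc (u x) `^ (p - 2) * rdot (crow (u x)) (crow (f x))).
Proof. by rewrite -mulrA ReZ rdot_crow mulrA. Qed.

Lemma measurable_potential_term (V : E -> R) (w : E -> R[i]) : measurable_fun D V ->
  cmeasurable D w -> measurable_fun D (fun x => `|V x| * normc (w x) `^ p).
Proof.
move=> mV mw; apply: measurable_funM; first exact: measurableT_comp.
exact: (measurableT_comp (measurable_powR p) (cmeasurable_normc mw)).
Qed.

Let absorb (x y z w s e k : R) : x + s <= z + s + (e * y + k * w) ->
  k * w <= e -> x <= z + e * (y + 1).
Proof. by rewrite mulrDr mulr1; lra. Qed.

(** A solution may be tested against itself: test with the conjugate of a
    test function close to [u], and absorb the two errors by Young's inequality.
    The error of the potential term is controlled by Hölder's inequality, which
    asks for closeness in [L^q]. *)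
Lemma solution_energy (V : E -> R) u gu (v : R) : measurable_fun D V ->
  (LnormD D r V <= v%:E)%E -> W01p D p u gu -> plaplace_sol D p V u gu ->
  \int[leb]_(x in D) (vnorm (gu x) `^ p) <=
  \int[leb]_(x in D) (V x * normc (u x) `^ p).
Proof.
move=> mV Vv Wu sol.
have [mu mgu] := W01p_cmeasurable Wu.
have v0 : 0 <= v by rewrite -lee_fin (le_trans _ Vv)// Lnorm_ge0.
pose a x := vnorm (gu x) `^ p.
pose b x := `|V x| * normc (u x) `^ p.
pose vv x := V x * normc (u x) `^ p.
have a0 x : 0 <= a x by exact: powR_ge0.
have b0 x : 0 <= b x by rewrite mulr_ge0 ?powR_ge0.
have ma : measurable_fun D a.
  exact: (measurableT_comp (measurable_powR p) (measurable_vnorm mgu)).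
have mb : measurable_fun D b := measurable_potential_term mV mu.
have [ia _] := ge0_integrable_fin ma a0 (W01p_grad_lty p1' Wu).
have bfin : (\int[leb]_(x in D) (b x)%:E < +oo)%E.
  apply: (le_lt_trans (hoelder_potential mD p1 pq r1 pqr mV mu Vv)).
  apply: lte_mul_pinfty; rewrite ?lee_fin//.
  by apply: poweR_lty; exact: (W01p_Lq_lty n0 oD bD p1' pq npq Wu).
have [ib _] := ge0_integrable_fin mb b0 bfin.
have ivv : leb.-integrable D (EFin \o vv).
  apply: (le_integrable mD _ _ ib).
    apply/measurable_EFinP; apply: measurable_funM => //.
    exact: (measurableT_comp (measurable_powR p) (cmeasurable_normc mu)).
  move=> x _ /=; rewrite lee_fin (ger0_norm (b0 x)) normrM.
  by rewrite (ger0_norm (powR_ge0 _ _)).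
pose A := \int[leb]_(x in D) a x.
pose B := \int[leb]_(x in D) b x.
pose VV := \int[leb]_(x in D) vv x.
have A0 : 0 <= A by apply: Rintegral_ge0 => x _.
have B0 : 0 <= B by apply: Rintegral_ge0 => x _.
suff key e : 0 < e -> A <= VV + e * (A + B + 1).
  apply/ler_addgt0Pr => e e0.
  have AB : 0 < A + B + 1 by rewrite ltr_wpDl// addr_ge0.
  have := key _ (divr_gt0 e0 AB).
  by rewrite -mulrA mulVf ?gt_eqF// mulr1.
(* [k] is the factor of the error integrals in Young's inequality. *)
move=> e0; pose k := e * (e^-1) `^ p.
have k0 : 0 < k by rewrite mulr_gt0// powR_gt0// invr_gt0.
have v1 : 0 < v + 1 by rewrite ltr_wpDl.
pose t := e / (2 * k).
have t0 : 0 < t by rewrite divr_gt0// mulr_gt0.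
(* With this closeness both error integrals [Dd] and [Dd'] are at most [t], and
   [k * (t + t) = e]. *)
pose dl := Num.min t ((t / (v + 1)) `^ (q / p)).
have dl0 : 0 < dl by rewrite lt_min t0 powR_gt0// divr_gt0.
have [f [tf gfd fd]] := W01p_approximation_Lq n0 oD bD p1' pq npq Wu dl0.
have mf := test_fun_cmeasurable D tf.
have mgf i := test_fun_grad_cmeasurable D i tf.
pose d x := vnorm (grad f x - gu x) `^ p.
pose d' x := `|V x| * normc (f x - u x) `^ p.
have d0 x : 0 <= d x by exact: powR_ge0.
have d'0 x : 0 <= d' x by rewrite mulr_ge0 ?powR_ge0.
have md : measurable_fun D d.
  apply: (measurableT_comp (measurable_powR p)); apply: measurable_vnorm.
  exact: cmeasurable_rowB.
have mfu := cmeasurableB mf mu.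
have md' : measurable_fun D d' := measurable_potential_term mV mfu.
have [id dE] := ge0_integrable_fin md d0 (le_lt_trans gfd (ltry _)).
have d'le : (\int[leb]_(x in D) (d' x)%:E <= (v * dl `^ (p / q))%:E)%E.
  apply: (le_trans (hoelder_potential mD p1 pq r1 pqr mV mfu Vv)).
  rewrite EFinM; apply: lee_wpmul2l; first by rewrite lee_fin.
  rewrite -poweR_EFin; apply: gt0_ler_poweR.
  - by rewrite divr_ge0// ltW.
  - rewrite in_itv/= leey andbT; apply: integral_ge0 => x _.
    by rewrite lee_fin powR_ge0.
  - by rewrite in_itv/= leey lee_fin ltW.
  - exact: fd.
have [id' d'E] := ge0_integrable_fin md' d'0 (le_lt_trans d'le (ltry _)).
pose Dd := \int[leb]_(x in D) d x.
pose Dd' := \int[leb]_(x in D) d' x.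
have Dd_le : Dd <= t.
  rewrite -lee_fin /Dd dE; apply: (le_trans gfd).
  by rewrite lee_fin ge_min lexx.
have Dd'_le : Dd' <= t.
  rewrite -lee_fin /Dd' d'E; apply: (le_trans d'le); rewrite lee_fin.
  apply: (@le_trans _ _ ((v + 1) * (t / (v + 1)))); last first.
    by rewrite mulrC divfK// gt_eqF.
  apply: ler_pM; rewrite ?powR_ge0// ?lerDl//.
  apply: (@le_trans _ _ (((t / (v + 1)) `^ (q / p)) `^ (p / q))).
    apply: ge0_ler_powR.
    - by rewrite divr_ge0// ltW.
    - by rewrite nnegrE ltW.
    - by rewrite nnegrE powR_ge0.
    - by rewrite ge_min lexx orbT.
  rewrite -powRrM (_ : q / p * (p / q) = 1); last by field; rewrite !gt_eqF.
  by rewrite powRr1// divr_ge0// ltW.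
have [[il _] [ir _] elr] := sol _ (test_funJ tf).
pose l x := vnorm (gu x) `^ (p - 2) * rdot (gu x) (grad f x).
pose rr x := V x * (normc (u x) `^ (p - 2) * rdot (crow (u x)) (crow (f x))).
have {}il : leb.-integrable D (EFin \o l).
  by move: il; congr (_.-integrable); apply/funext => x /=; rewrite (Re_gradient_pairing _ _ tf).
have {}ir : leb.-integrable D (EFin \o rr).
  by move: ir; congr (_.-integrable); apply/funext => x /=; rewrite Re_potential_pairing.
have {}elr : \int[leb]_(x in D) l x = \int[leb]_(x in D) rr x.
  move/(congr1 (@complex.Re R)) : elr; rewrite !Re_cintegral => elr.
  transitivity (\int[leb]_(x in D)
     Re ((vnorm (gu x) `^ (p - 2))%:C * dotC (gu x) (grad (fun y => (f y)^*) x))).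
    by apply: eq_Rintegral => x _; rewrite (Re_gradient_pairing _ _ tf).
  by rewrite elr; apply: eq_Rintegral => x _; rewrite Re_potential_pairing.
have pt x : D x -> 1 * a x + 1 * rr x <=
   1 * (1 * vv x + 1 * l x) + 1 * (e * (1 * a x + 1 * b x) + k * (1 * d x + 1 * d' x)).
  move=> _.
  have h1 := vnorm_pairing_young (gu x) (grad f x) p1 e0.
  have h2 := vnorm_pairing_young (crow (u x)) (crow (f x)) p1 e0.
  rewrite (_ : crow (f x) - crow (u x) = crow (f x - u x)) in h2; last by rewrite /crow raddfB.
  rewrite /pairing !vnorm_crow in h2; rewrite /pairing in h1.
  have ei0 : 0 <= e^-1 by rewrite invr_ge0 ltW.
  rewrite (powRM p (vnorm_ge0 _) ei0) in h1.
  rewrite (powRM p (normc_ge0 _) ei0) in h2.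
  have h3 : `|V x| * `|normc (u x) `^ p - normc (u x) `^ (p - 2) * rdot (crow (u x)) (crow (f x))| <=
     `|V x| * (e * normc (u x) `^ p + e * (normc (f x - u x) `^ p * e^-1 `^ p)).
    exact: ler_wpM2l.
  rewrite -normrM mulrBr in h3.
  have h4 := le_trans (ler_norm _) h1.
  have h5 : rr x - vv x <= `|V x| * (e * normc (u x) `^ p + e * (normc (f x - u x) `^ p * e^-1 `^ p)).
    by apply: le_trans h3; rewrite distrC ler_norm.
  have h6 : `|V x| * (e * normc (u x) `^ p + e * (normc (f x - u x) `^ p * e^-1 `^ p)) =
     e * b x + k * d' x by rewrite /b /k /d'; ring.
  rewrite h6 in h5.
  have h7 : e * (vnorm (grad f x - gu x) `^ p * e^-1 `^ p) = k * d x by rewrite /k /d; ring.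
  rewrite h7 -/(a x) -/(l x) in h4.
  by rewrite !mul1r; lra.
have iZB := fun (s s' : R) (g g' : E -> R) => @integrableZB R n D s s' g g' mD.
have RZB := fun (s s' : R) (g g' : E -> R) => @RintegralZB R n D s s' g g' mD.
have i1 := iZB 1 1 _ _ ia ir.
have i2 := iZB 1 1 _ _ ivv il.
have i3 := iZB 1 1 _ _ ia ib.
have i4 := iZB 1 1 _ _ id id'.
have i5 := iZB e k _ _ i3 i4.
have i6 := iZB 1 1 _ _ i2 i5.
have := le_Rintegral mD i1 i6 pt.
rewrite (RZB _ _ _ _ ia ir) (RZB _ _ _ _ i2 i5) (RZB _ _ _ _ ivv il) (RZB _ _ _ _ i3 i4).
rewrite (RZB _ _ _ _ ia ib) (RZB _ _ _ _ id id') elr.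
rewrite -/A -/B -/VV -/Dd -/Dd'.
set Rr := Rintegral _ _ rr.
move: Rr A B VV Dd Dd' {A0 B0} Dd_le Dd'_le => Rr A B VV Dd Dd' Dd_le Dd'_le h.
have h8 : k * (Dd + Dd') <= e.
  rewrite (_ : e = k * (t + t)); last by rewrite /t; field; rewrite gt_eqF.
  by apply: ler_wpM2l; [exact: ltW|exact: lerD].
by rewrite !mul1r in h; exact: absorb h h8.
Qed.

End solutions.

(** * The lower bound for the potential *)
Section lower_bound.
Variables (R : realType) (n : nat) (D : set 'rV[R]_n) (p q : R) (r : \bar R).
Local Notation E := 'rV[R]_n.
Local Notation leb := (lebesgue_rV R n).
Local Notation normc := ComplexField.Normc.normc.
Hypotheses (n0 : (0 < n)%N) (oD : open D) (bD : bounded_set D).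
Hypotheses (p1 : 1 < p) (pq : p <= q) (npq : n%:R * (q - p) < p * q).
Hypotheses (r1 : (1 < r)%E) (pqr : (r^-1 + (p / q)%:E = 1)%E).

Let mD : measurable D. Proof. exact: open_measurable_rV. Qed.
Let p0 : 0 < p. Proof. exact: lt_trans p1. Qed.
Let q0 : 0 < q. Proof. exact: lt_le_trans pq. Qed.
Let p1' : 1 <= p. Proof. exact: ltW. Qed.

Lemma ge0_lty_fin (x : \bar R) : (0 <= x)%E -> (x < +oo)%E -> x \is a fin_num.
Proof. by move=> x0; rewrite ge0_fin_numE. Qed.

Lemma fin_poweR (x : \bar R) (s : R) : x \is a fin_num ->
  (x `^ s)%E = (fine x `^ s)%:E.
Proof. by case: x. Qed.

Lemma integral_normc_eq0 (s : R) (u : E -> R[i]) : 0 < s -> cmeasurable D u ->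
  (\int[leb]_(x in D) (normc (u x) `^ s)%:E = 0)%E -> ae_zero D u.
Proof.
move=> s0 mu.
have mus := measurable_powR_EFin s (cmeasurable_normc mu).
under eq_integral => x _ do rewrite -[X in X%:E](ger0_norm (powR_ge0 _ _)) -abse_EFin.
move=> /(ae_eq_integral_abs leb mD mus); apply: filterS => x /= h Dx.
have /eqP := h Dx; rewrite eqe powR_eq0 (gt_eqF s0) andbT => /eqP.
exact: ComplexField.Normc.eq0_normc.
Qed.

Lemma ae_zero_integral (s : R) (u : E -> R[i]) : 0 < s -> cmeasurable D u ->
  ae_zero D u -> (\int[leb]_(x in D) (normc (u x) `^ s)%:E = 0)%E.
Proof.
move=> s0 mu u0.
have mus := measurable_powR_EFin s (cmeasurable_normc mu).
under eq_integral => x _ do rewrite -[X in X%:E](ger0_norm (powR_ge0 _ _)) -abse_EFin.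
apply/(ae_eq_integral_abs leb mD mus); move: u0; apply: filterS => x /= h Dx.
by rewrite h// ComplexField.Normc.normc0 powR0// gt_eqF.
Qed.

Lemma W01p_norms u gu : W01p D p u gu ->
  exists A j : R, [/\ (\int[leb]_(x in D) (vnorm (gu x) `^ p)%:E = A%:E)%E,
    (\int[leb]_(x in D) (normc (u x) `^ q)%:E = j%:E)%E, 0 <= A, 0 <= j &
    LnormDV D p%:E gu = (A `^ p^-1)%:E /\ LnormDC D q%:E u = (j `^ q^-1)%:E].
Proof.
move=> Wu.
have h1 : (0 <= \int[leb]_(x in D) (vnorm (gu x) `^ p)%:E)%E.
  by apply: integral_ge0 => x _; rewrite lee_fin powR_ge0.
have h2 : (0 <= \int[leb]_(x in D) (normc (u x) `^ q)%:E)%E.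
  by apply: integral_ge0 => x _; rewrite lee_fin powR_ge0.
have f1 := ge0_lty_fin h1 (W01p_grad_lty p1' Wu).
have f2 := ge0_lty_fin h2 (W01p_Lq_lty n0 oD bD p1' pq npq Wu).
exists (fine (\int[leb]_(x in D) (vnorm (gu x) `^ p)%:E)%E).
exists (fine (\int[leb]_(x in D) (normc (u x) `^ q)%:E)%E).
have e1 : (\int[leb]_(x in D) (`|vnorm (gu x)| `^ p)%:E =
    \int[leb]_(x in D) (vnorm (gu x) `^ p)%:E)%E.
  by apply: eq_integral => x _; rewrite (ger0_norm (vnorm_ge0 _)).
have e2 : (\int[leb]_(x in D) (`|normc (u x)| `^ q)%:E =
    \int[leb]_(x in D) (normc (u x) `^ q)%:E)%E.
  by apply: eq_integral => x _; rewrite (ger0_norm (normc_ge0 _)).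
rewrite /LnormDV /LnormDC (LnormD_E _ _ p0) (LnormD_E _ _ q0) e1 e2.
split; [exact: (esym (fineK f1))|exact: (esym (fineK f2))|exact: fine_ge0 h1|exact: fine_ge0 h2|].
by split; [exact: fin_poweR f1|exact: fin_poweR f2].
Qed.

(** A function with zero gradient vanishes, by the embedding; hence the
    quotients defining the Sobolev constant have nonzero denominators. *)
Lemma W01p_nontrivial u gu (A j : R) : W01p D p u gu -> ~ ae_zero D u ->
  (\int[leb]_(x in D) (vnorm (gu x) `^ p)%:E = A%:E)%E ->
  (\int[leb]_(x in D) (normc (u x) `^ q)%:E = j%:E)%E ->
  0 <= A -> 0 <= j -> 0 < A /\ 0 < j.
Proof.
move=> Wu nu hA hj A0 j0; have [mu _] := W01p_cmeasurable Wu.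
have jp : 0 < j.
  rewrite lt0r j0 andbT; apply/negP => /eqP j00; apply: nu.
  by apply: (integral_normc_eq0 q0 mu); rewrite hj j00.
split=> //; rewrite lt0r A0 andbT; apply/negP => /eqP A00.
have := W01p_grad_eq0 n0 oD bD p1' pq npq Wu; rewrite hA hj A00 => /(_ erefl) [].
by move/eqP; rewrite gt_eqF.
Qed.

Lemma sobolev_const_ratio u gu (A j : R) : W01p D p u gu -> ~ ae_zero D u ->
  LnormDV D p%:E gu = (A `^ p^-1)%:E -> LnormDC D q%:E u = (j `^ q^-1)%:E ->
  0 < A -> ((j `^ q^-1 / A `^ p^-1)%:E <= sobolev_const D q p)%E.
Proof.
move=> Wu nu hA hj A0; apply: ereal_sup_ubound; exists u, gu; split => //.
by rewrite hA hj inver gt_eqF ?powR_gt0.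
Qed.

(** Let [A] and [j] be the integrals of [|gu| ^ p] and [|u| ^ q], and [w] the norm
    of the positive part of [V]. Energy and Hölder give [A <= w * j ^ (p / q)],
    while [j ^ (p / q) / A] is at most the [p]-th power of the Sobolev constant. *)
Lemma solution_lower_bound (V : E -> R) u gu :
  in_Lp D r V -> W01p D p u gu -> ~ ae_zero D u -> plaplace_sol D p V u gu ->
  (1 <= sobolev_const D q p `^ p * LnormD D r (V^\+)%R)%E.
Proof.
move=> [mV Vfin] Wu nu sol.
have [mu _] := W01p_cmeasurable Wu.
have [A [j [hA hj A0 j0 [nA nj]]]] := W01p_norms Wu.
have [Ap jp] := W01p_nontrivial Wu nu hA hj A0 j0.
have ratio := sobolev_const_ratio Wu nu nA nj Ap.
have t0 : 0 < j `^ q^-1 / A `^ p^-1 by rewrite divr_gt0 ?powR_gt0.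
have K0 : (0 < sobolev_const D q p)%E by apply: lt_le_trans ratio; rewrite lte_fin.
have Kp : ((j `^ (p / q) / A)%:E <= sobolev_const D q p `^ p)%E.
  have -> : (j `^ (p / q) / A)%:E = ((j `^ q^-1 / A `^ p^-1)%:E `^ p)%E.
    rewrite poweR_EFin powRM ?powR_ge0 ?invr_ge0 ?powR_ge0//; congr EFin.
    rewrite -powRrM [q^-1 * p]mulrC; congr (_ * _).
    by rewrite -powRN -powRrM mulNr mulVf ?gt_eqF// powR_inv1.
  apply: gt0_ler_poweR => //.
  - exact: ltW.
  - by rewrite in_itv/= leey lee_fin ltW.
  - by rewrite in_itv/= leey ltW.
have mVp : measurable_fun D (V^\+)%R by exact: measurable_funrpos.
(* An infinite norm makes the product infinite, as the constant is positive. *)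
have [->|] := eqVneq (LnormD D r (V^\+)%R) +oo%E.
  by rewrite gt0_muley ?leey// poweR_gt0.
rewrite -ltey => Vpfin.
have Vp0 : (0 <= LnormD D r (V^\+)%R)%E by exact: Lnorm_ge0.
have /fineK Vpe := ge0_lty_fin Vp0 Vpfin.
have /fineK Ve := ge0_lty_fin (Lnorm_ge0 _ _ _) Vfin.
set w := fine (LnormD D r (V^\+)%R) in Vpe.
have Vle : (LnormD D r V <= (fine (LnormD D r V))%:E)%E by rewrite Ve.
have Vple : (LnormD D r (V^\+)%R <= w%:E)%E by rewrite Vpe.
have energy := solution_energy n0 oD bD p1 pq npq r1 pqr mV Vle Wu sol.
have hol := hoelder_potential mD p1 pq r1 pqr mVp mu Vple.
have holV := hoelder_potential mD p1 pq r1 pqr mV mu Vle.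
rewrite hj poweR_EFin -EFinM in hol; rewrite hj poweR_EFin -EFinM in holV.
have [ib bE] := ge0_integrable_fin (measurable_potential_term p mV mu)
  (fun x => mulr_ge0 (normr_ge0 _) (powR_ge0 _ _)) (le_lt_trans holV (ltry _)).
have [ibp bpE] := ge0_integrable_fin (measurable_potential_term p mVp mu)
  (fun x => mulr_ge0 (normr_ge0 _) (powR_ge0 _ _)) (le_lt_trans hol (ltry _)).
have ivv : leb.-integrable D (EFin \o (fun x => V x * normc (u x) `^ p)).
  apply: (le_integrable mD _ _ ib).
    apply/measurable_EFinP; apply: measurable_funM => //.
    exact: (measurableT_comp (measurable_powR p) (cmeasurable_normc mu)).
  move=> x _ /=; rewrite lee_fin [leRHS]ger0_norm ?mulr_ge0 ?powR_ge0// normrM.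
  by rewrite (ger0_norm (powR_ge0 _ _)).
have VVp : \int[leb]_(x in D) (V x * normc (u x) `^ p) <=
    \int[leb]_(x in D) (`|(V^\+)%R x| * normc (u x) `^ p).
  apply: le_Rintegral => // x _; rewrite ler_wpM2r ?powR_ge0//.
  by rewrite (le_trans _ (ler_norm _))// /funrpos le_max lexx.
have AE : \int[leb]_(x in D) (vnorm (gu x) `^ p) = A by rewrite /Rintegral hA.
have main : A <= w * j `^ (p / q).
  by rewrite -AE (le_trans energy)// (le_trans VVp)// -lee_fin bpE.
have w0 : 0 <= w by rewrite -lee_fin Vpe.
rewrite -Vpe; apply: (@le_trans _ _ ((j `^ (p / q) / A)%:E * w%:E)%E).
  rewrite -EFinM lee_fin mulrAC ler_pdivlMr// mul1r.
  by rewrite mulrC.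
by apply: lee_wpmul2r; rewrite ?lee_fin.
Qed.

End lower_bound.

(** Since [1 / r = 1 - p / q], the bound [n / p < r] says that [q] is below the
    critical exponent. *)
Lemma subcritical_exponents (R : realType) (n : nat) (p q : R) (r : \bar R) :
  1 < p -> p <= q -> (maxe 1 (n%:R / p)%:E < r)%E -> (r^-1 + (p / q)%:E = 1)%E ->
  (1 < r)%E /\ n%:R * (q - p) < p * q.
Proof.
move=> p1 pq; rewrite gt_max => /andP[r1 nr] pqr; split => //.
have p0 : 0 < p by exact: lt_trans p1.
have q0 : 0 < q by exact: lt_le_trans pq.
case: r r1 nr pqr => [r0| |] // r1 nr pqr; last first.
  by rewrite (hoelder_exponent_infty p1 pq pqr)// subrr mulr0 mulr_gt0.
have [r00 _] := hoelder_exponent_fin r1 pqr erefl.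
move: pqr; rewrite inver gt_eqF// -EFinD => -[e].
rewrite lte_fin ltr_pdivrMr// in nr.
have e2 : q - p = q * r0^-1.
  have -> : p = q * (p / q) by rewrite mulrC divfK// gt_eqF.
  by rewrite -[X in X - _]mulr1 -mulrBr -e addrK.
rewrite e2 mulrCA [ltRHS]mulrC ltr_pM2l// ltr_pdivrMr//.
by rewrite mulrC.
Qed.

(** * Continuity of the derivative of power integrals *)
Section pairing.
Variables (R : realType) (n : nat) (D : set 'rV[R]_n) (p : R).
Local Notation E := 'rV[R]_n.
Local Notation leb := (lebesgue_rV R n).
Hypotheses (p1 : 1 < p).

Let p0 : 0 < p. Proof. exact: lt_trans p1. Qed.

Lemma harmonic_right : (@harmonic R) k @[k --> \oo] --> (0 : R)^'+.
Proof.
move=> A A0.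
have h : \forall k \near \oo, 0 < @harmonic R k -> A (@harmonic R k) := @cvg_harmonic R _ A0.
change (\forall k \near \oo, A (@harmonic R k)); move: h.
by apply: filterS => k; apply; exact: harmonic_gt0.
Qed.

Lemma powR_continuous_gt0 (s x : R) : 0 < x -> {for x, continuous (fun y : R => y `^ s)}.
Proof.
move=> x0; apply: differentiable_continuous; apply/derivable1_diffP.
by apply: derivable_powR; rewrite in_itv/= x0.
Qed.

(** Continuity along a line through [z]. At [z = 0], where [vnorm z ^ (p - 2)]
    may be singular, it comes from the homogeneity of degree [p - 1 > 0]. *)
Lemma pairing_cvg m (z w : 'rV[R[i]]_m) :
  pairing p (z + (@harmonic R k)%:C *: w) w @[k --> \oo] --> pairing p z w.
Proof.
have h0 k : 0 < @harmonic R k := harmonic_gt0 k.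
have [z0|zN0] := eqVneq (vnorm z) 0.
  rewrite (vnorm_eq0 z0).
  have -> : pairing p (0 : 'rV[R[i]]_m) w = (0 : R) by rewrite /pairing rdot0l mulr0.
  have c0 : (@harmonic R k) `^ (p - 1) * vnorm w `^ p @[k --> \oo] --> 0.
    rewrite -[X in _ --> X](mul0r (vnorm w `^ p)); apply: cvgMr_tmp.
    have pm1 : 0 < p - 1 by rewrite subr_gt0.
    exact: (cvg_comp _ _ harmonic_right (powR_cvg0 pm1)).
  apply: cvg_trans c0; apply: near_eq_cvg; apply: nearW => k.
  rewrite /pairing add0r rdotZl vnormZ (ger0_norm (ltW (h0 k))) -sqr_vnorm.
  rewrite powRM ?vnorm_ge0 ?(ltW (h0 k))//.
  rewrite -(powR_mulB2 (ltW (h0 k)) p1) -(powR_mulB2_sqr (vnorm_ge0 w) p1).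
  by ring.
have zp : 0 < vnorm z by rewrite lt0r zN0 vnorm_ge0.
have cv : vnorm (z + (@harmonic R k)%:C *: w) @[k --> \oo] --> vnorm z.
  apply/cvgrPdist_le => e e0.
  have := @cvg_harmonic R; move/cvgrPdist_le => /(_ (e / (vnorm w + 1))).
  have w1 : 0 < vnorm w + 1 by rewrite ltr_wpDl ?vnorm_ge0.
  move=> /(_ (divr_gt0 e0 w1)); apply: filterS => k.
  rewrite sub0r normrN (ger0_norm (ltW (h0 k))) ler_pdivlMr// => hk.
  apply: le_trans hk.
  have hw : vnorm ((@harmonic R k)%:C *: w) <= @harmonic R k * (vnorm w + 1).
    by rewrite vnormZ (ger0_norm (ltW (h0 k))) ler_wpM2l ?lerDl// ltW.
  have := vnormD z ((@harmonic R k)%:C *: w).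
  have := vnormB (z + (@harmonic R k)%:C *: w) ((@harmonic R k)%:C *: w).
  rewrite addrK ler_norml => t1 t2; apply/andP; split; lra.
have cr : rdot (z + (@harmonic R k)%:C *: w) w @[k --> \oo] --> rdot z w.
  under eq_fun do rewrite rdotDl rdotZl.
  have c : rdot z w + @harmonic R k * rdot w w @[k --> \oo] --> rdot z w + 0 * rdot w w.
    apply: cvgD; first exact: cvg_cst.
    by apply: cvgMr_tmp; exact: cvg_harmonic.
  by move: c; rewrite mul0r addr0.
apply: cvgM => //.
exact: (cvg_comp _ _ cv (@powR_continuous_gt0 (p - 2) _ zp)).
Qed.

Lemma measurable_pairing m (g h : E -> 'rV[R[i]]_m) :
  (forall i, cmeasurable D (fun x => g x ord0 i)) ->
  (forall i, cmeasurable D (fun x => h x ord0 i)) ->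
  measurable_fun D (fun x => pairing p (g x) (h x)).
Proof.
move=> mg mh; apply: measurable_funM.
  exact: (measurableT_comp (measurable_powR _) (measurable_vnorm mg)).
apply: measurable_sum => i; have [gr gi] := mg i; have [hr hi] := mh i.
by apply: measurable_funD; exact: measurable_funM.
Qed.

Hypotheses (oD : open D) (bD : bounded_set D).
Let mD : measurable D. Proof. exact: open_measurable_rV. Qed.
Let fD : (leb D < +oo)%E. Proof. exact: lebesgue_rV_bounded_lty. Qed.

(** The part of differentiation under the integral sign that convexity does not
    give: the derivatives at [t > 0] tend to the one at 0. *)
Lemma integral_pairing_cvg m (g h : E -> 'rV[R[i]]_m) (M : R) :
  (forall i, cmeasurable D (fun x => g x ord0 i)) ->
  (forall i, cmeasurable D (fun x => h x ord0 i)) ->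
  (\int[leb]_(x in D) (vnorm (g x) `^ p)%:E < +oo)%E ->
  0 <= M -> (forall x, vnorm (h x) <= M) ->
  [/\ leb.-integrable D (EFin \o (fun x => pairing p (g x) (h x))),
      forall k, leb.-integrable D
        (EFin \o (fun x => pairing p (g x + (@harmonic R k)%:C *: h x) (h x))) &
      \int[leb]_(x in D) pairing p (g x + (@harmonic R k)%:C *: h x) (h x)
        @[k --> \oo] --> \int[leb]_(x in D) pairing p (g x) (h x)].
Proof.
move=> mg mh gfin M0 hM.
(* A dominating function for all [t <= 1]. *)
pose G x := M * 1 + (M * 2 `^ p) * (1 * vnorm (g x) `^ p + M `^ p * 1).
have mgp : measurable_fun D (fun x => vnorm (g x) `^ p).
  exact: (measurableT_comp (measurable_powR p) (measurable_vnorm mg)).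
have [igp _] := ge0_integrable_fin mgp (fun x => powR_ge0 _ _) gfin.
have i1 := integrable_cst_in 1 mD fD.
have iG : leb.-integrable D (EFin \o G).
  exact: (integrableZB M (M * 2 `^ p) mD i1 (integrableZB 1 (M `^ p) mD igp i1)).
have bound (t : R) x : 0 <= t -> t <= 1 -> `|pairing p (g x + t%:C *: h x) (h x)| <= G x.
  move=> t0 t1; apply: (le_trans (pairing_le _ _ p1)).
  have b1 : vnorm (g x + t%:C *: h x) <= vnorm (g x) + M.
    apply: (le_trans (vnormD _ _)); rewrite lerD2l vnormZ (ger0_norm t0).
    by rewrite -[leRHS]mul1r ler_pM ?vnorm_ge0.
  have gM : 0 <= vnorm (g x) + M by rewrite addr_ge0 ?vnorm_ge0.
  have b2 : vnorm (g x + t%:C *: h x) `^ (p - 1) <= 1 + (vnorm (g x) + M) `^ p.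
    apply: (le_trans _ (powR_le1D gM _ _ : (vnorm (g x) + M) `^ (p - 1) <= _)); last 2 first.
    - by rewrite subr_ge0 ltW.
    - by rewrite lerBlDr lerDl.
    by apply: ge0_ler_powR; rewrite ?nnegrE ?vnorm_ge0 ?subr_ge0 ?(ltW p1).
  have b3 := powR_addr_le (vnorm_ge0 (g x)) M0 (ltW p0).
  apply: (@le_trans _ _ ((1 + 2 `^ p * (vnorm (g x) `^ p + M `^ p)) * M)).
    apply: ler_pM; rewrite ?powR_ge0 ?vnorm_ge0//.
    by apply: (le_trans b2); rewrite lerD2l.
  by rewrite /G le_eqVlt; apply/orP; left; apply/eqP; ring.
have mt k i : cmeasurable D (fun x => (g x + (@harmonic R k)%:C *: h x) ord0 i).
  under eq_fun do rewrite !mxE; apply: cmeasurableD => //.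
  by apply: cmeasurableM => //; exact: cmeasurable_cst.
have hk1 k : @harmonic R k <= 1 by rewrite /= invf_le1// ler1n.
have ik k : leb.-integrable D
    (EFin \o (fun x => pairing p (g x + (@harmonic R k)%:C *: h x) (h x))).
  apply: (le_integrable mD _ _ iG).
    by apply/measurable_EFinP; exact: measurable_pairing.
  move=> x _ /=; rewrite lee_fin; apply: (le_trans (bound _ _ _ (hk1 k))).
    exact: harmonic_ge0.
  exact: ler_norm.
have i0 : leb.-integrable D (EFin \o (fun x => pairing p (g x) (h x))).
  apply: (le_integrable mD _ _ iG).
    by apply/measurable_EFinP; exact: measurable_pairing.
  move=> x _ /=; rewrite lee_fin.
  have := bound 0 x (lexx _) ler01; rewrite scale0r addr0 => /le_trans; apply.
  exact: ler_norm.
split => //.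
have [|||||_ _ c] := @dominated_convergence _ _ _ leb D mD
  (fun k x => (pairing p (g x + (@harmonic R k)%:C *: h x) (h x))%:E)
  (fun x => (pairing p (g x) (h x))%:E) (EFin \o G).
- by move=> k; apply/measurable_EFinP; exact: measurable_pairing.
- by apply/measurable_EFinP; exact: measurable_pairing.
- by apply: aeW => x _; apply: cvg_EFin; [exact: nearW|exact: pairing_cvg].
- exact: iG.
- apply: aeW => x k _; rewrite lee_fin; apply: bound; [exact: harmonic_ge0|exact: hk1].
have f0 := integrable_fin_num mD i0.
have c' : (\int[leb]_(x in D) (pairing p (g x + (@harmonic R k)%:C *: h x) (h x))%:E
    @[k --> \oo] --> (\int[leb]_(x in D) pairing p (g x) (h x))%:E)%E.
  by rewrite /Rintegral (fineK f0); exact: c.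
exact: (fine_cvg c').
Qed.

End pairing.

(** * Positivity of the Sobolev constant *)
Section extremals.
Variables (R : realType) (n : nat) (D : set 'rV[R]_n) (p q : R).
Local Notation E := 'rV[R]_n.
Local Notation leb := (lebesgue_rV R n).
Local Notation normc := ComplexField.Normc.normc.
Hypotheses (n0 : (0 < n)%N) (oD : open D) (bD : bounded_set D).
Hypotheses (p1 : 1 < p) (pq : p <= q) (npq : n%:R * (q - p) < p * q).

Let mD : measurable D. Proof. exact: open_measurable_rV. Qed.
Let fD : (leb D < +oo)%E. Proof. exact: lebesgue_rV_bounded_lty. Qed.
Let p0 : 0 < p. Proof. exact: lt_trans p1. Qed.
Let q0 : 0 < q. Proof. exact: lt_le_trans pq. Qed.

Lemma test_fun_W01p f : test_fun D f -> W01p D p f (grad f).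
Proof.
move=> tf; have [M M0 hM] := test_fun_bounded tf.
have mf := test_fun_cmeasurable D tf.
have mgf i := test_fun_grad_cmeasurable D i tf.
have Lnorm_sub0 (h : E -> R) : (forall x, h x = 0) -> LnormD D p%:E h = 0%E.
  move=> h0; rewrite (LnormD_E _ _ p0) integral0_eq ?poweR0r ?invr_eq0 ?gt_eqF//.
  by move=> x _; rewrite h0 normr0 powR0// gt_eqF.
split; [split|].
- apply: (in_LpC_lty p0 mf); apply: (@bounded_integral_lty R n D p (fun x => normc (f x)) M) => //.
  + exact: ltW.
  + exact: cmeasurable_normc.
  + by move=> x; rewrite normc_ge0; have [] := hM x.
- apply: (in_LpV_lty p0 mgf); apply: (@bounded_integral_lty R n D p (fun x => vnorm (grad f x)) M) => //.
  + exact: ltW.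
  + exact: measurable_vnorm.
  + by move=> x; rewrite vnorm_ge0; have [] := hM x.
- exact: test_fun_weak_grad.
exists (fun=> f); split => //.
- rewrite (_ : (fun _ => _) = (fun=> 0%E)); first exact: cvg_cst.
  by apply/funext => k; apply: Lnorm_sub0 => x; rewrite subrr ComplexField.Normc.normc0.
- rewrite (_ : (fun _ => _) = (fun=> 0%E)); first exact: cvg_cst.
  apply/funext => k; apply: Lnorm_sub0 => x; rewrite subrr.
  by rewrite /vnorm big1 ?sqrtr0// => i _; rewrite mxE ComplexField.Normc.normc0 expr0n.
Qed.

(** By continuity, and since nonempty open sets have positive measure. *)
Lemma test_fun_ae_zero f : test_fun D f -> ae_zero D f -> forall x, f x = 0.
Proof.
move=> tf f0 x; apply: contrapT => fx.
have [K [cK KD fK _]] := test_fun_supp tf.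
pose O := [set y : E | 0 < normc (f y)].
have oO : open O.
  have := test_fun_normc_continuous tf; move/continuousP => /(_ [set t | 0 < t]).
  by apply; exact: open_gt.
have Ox : O x.
  rewrite /O /= lt0r normc_ge0 andbT; apply/eqP.
  by move=> /ComplexField.Normc.eq0_normc.
have OD : O `<=` D.
  move=> y Oy; apply: KD; apply: contrapT => /fK fy; move: Oy.
  by rewrite /O /= fy ComplexField.Normc.normc0 ltxx.
have := lebesgue_rV_open_gt0 oO (ex_intro _ x Ox).
have [N [mN N0 subN]] := f0.
have ON : O `<=` N.
  move=> y Oy; apply: subN => /= /(_ (OD _ Oy)) fy; move: Oy.
  by rewrite /O /= fy ComplexField.Normc.normc0 ltxx.
rewrite ltNge => /negP; apply; rewrite -N0; apply: le_measure => //; rewrite inE//.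
exact: open_measurable_rV.
Qed.

Let double_absurd (x t : R) : 0 < x -> 1 <= t -> x * (2 * t) <= x -> False.
Proof. by move=> *; nra. Qed.

(** A Sobolev function with nonzero gradient is close to some test function
    that does not vanish, whose quotient is positive. *)
Lemma sobolev_const_gt0 u gu : W01p D p u gu ->
  (0 < \int[leb]_(x in D) (vnorm (gu x) `^ p)%:E)%E -> (0 < sobolev_const D q p)%E.
Proof.
move=> Wu gpos; have [mu mgu] := W01p_cmeasurable Wu.
have [A [j [hA _ A0 _ _]]] := W01p_norms n0 oD bD p1 pq npq Wu.
have Ap : 0 < A by move: gpos; rewrite hA.
have e0 : 0 < A / (2 * 2 `^ p) by rewrite divr_gt0 ?mulr_gt0 ?powR_gt0.
have [f [tf _ gf]] := W01p_approximable p0 Wu e0.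
have Wf := test_fun_W01p tf.
have mgf i := test_fun_grad_cmeasurable D i tf.
have nf : ~ ae_zero D f.
  move=> /(test_fun_ae_zero tf) f0.
  have gf0 x : grad f x = 0.
    have fE : f = fun=> 0 by apply/funext.
    apply/rowP => i; rewrite !mxE fE /partial.
    by rewrite !derive_cst.
  have : (\int[leb]_(x in D) (vnorm (grad f x - gu x) `^ p)%:E = A%:E)%E.
    by rewrite -hA; apply: eq_integral => x _; rewrite gf0 sub0r vnormN.
  move=> e; move: gf; rewrite e lee_fin ler_pdivlMr ?mulr_gt0 ?powR_gt0// => h.
  have : 1 <= 2 `^ p :> R by rewrite -[leLHS](powRr0 2); apply: ler_powR; rewrite ?ler1n// ltW.
  by move=> h2; exact: double_absurd Ap h2 h.
have [B [l [hB hl B0 l0 [nB nl]]]] := W01p_norms n0 oD bD p1 pq npq Wf.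
have [Bp lp] := W01p_nontrivial n0 oD bD p1 pq npq Wf nf hB hl B0 l0.
apply: lt_le_trans (sobolev_const_ratio Wf nf nB nl Bp).
by rewrite lte_fin divr_gt0 ?powR_gt0.
Qed.

Lemma sobolev_inequality w gw (j A l : R) : W01p D p w gw ->
  sobolev_const D q p = (j `^ q^-1)%:E -> 0 <= j ->
  (\int[leb]_(x in D) (vnorm (gw x) `^ p)%:E = A%:E)%E ->
  (\int[leb]_(x in D) (normc (w x) `^ q)%:E = l%:E)%E ->
  l <= j * A `^ (q / p).
Proof.
move=> Ww hK j0 hA hl.
have [mw _] := W01p_cmeasurable Ww.
have [A' [l' [hA' hl' A0 l0 [nA nl]]]] := W01p_norms n0 oD bD p1 pq npq Ww.
have eA : A' = A by move: hA'; rewrite hA => -[].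
have el : l' = l by move: hl'; rewrite hl => -[].
subst A' l'.
have [w0|nw] := pselect (ae_zero D w).
  have := ae_zero_integral oD q0 mw w0.
  by rewrite hl => -[->]; rewrite mulr_ge0 ?powR_ge0.
have [Ap lp] := W01p_nontrivial n0 oD bD p1 pq npq Ww nw hA hl A0 l0.
have := sobolev_const_ratio Ww nw nA nl Ap.
rewrite hK lee_fin ler_pdivrMr ?powR_gt0// => h.
have : (l `^ q^-1) `^ q <= (j `^ q^-1 * A `^ p^-1) `^ q.
  by apply: ge0_ler_powR; rewrite ?nnegrE ?mulr_ge0 ?powR_ge0 ?(ltW q0).
rewrite powRM ?powR_ge0// -!powRrM mulVf ?gt_eqF// !powRr1//.
by rewrite [p^-1 * q]mulrC.
Qed.

End extremals.

(** * The Euler-Lagrange equation of an extremal *)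
Section euler_lagrange.
Variables (R : realType) (n : nat) (D : set 'rV[R]_n) (p q : R).
Local Notation E := 'rV[R]_n.
Local Notation leb := (lebesgue_rV R n).
Local Notation normc := ComplexField.Normc.normc.
Hypotheses (n0 : (0 < n)%N) (oD : open D) (bD : bounded_set D).
Hypotheses (p1 : 1 < p) (pq : p <= q) (npq : n%:R * (q - p) < p * q).

Let mD : measurable D. Proof. exact: open_measurable_rV. Qed.
Let p0 : 0 < p. Proof. exact: lt_trans p1. Qed.
Let q0 : 0 < q. Proof. exact: lt_le_trans pq. Qed.
Let p1' : 1 <= p. Proof. exact: ltW. Qed.
Let q1 : 1 < q. Proof. exact: lt_le_trans pq. Qed.

(** The real-variable core of the variational argument: [t > 0] is the size of
    the perturbation, [l] and [a] are the perturbed integrals of the function and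
    of its gradient. Convexity bounds [l] below by its tangent at 0 (slope [B])
    and [a] above by its tangent at [t] (slope [x]). *)
Lemma variation_bound (j B a x t l : R) : 0 < t -> 0 <= j ->
  j + q * (t * B) <= l -> l <= j * a `^ (q / p) -> 0 <= a -> a <= 1 + p * (t * x) ->
  B <= j * x * (1 + p * (t * x)) `^ (q / p - 1).
Proof.
move=> t0 j0 h1 h2 a0 h3.
have qp : 1 <= q / p by rewrite ler_pdivlMr// mul1r.
have s0 : 0 <= 1 + p * (t * x) by exact: le_trans h3.
have h4 := powR_bernoulli s0 qp.
have h5 : a `^ (q / p) <= (1 + p * (t * x)) `^ (q / p).
  by apply: ge0_ler_powR; rewrite ?nnegrE// (le_trans ler01).
have h6 := ler_wpM2l j0 (le_trans h5 h4).
set y := (1 + p * (t * x)) `^ (q / p - 1) in h4 h6 *.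
have h7 : j + q * (t * B) <= j * (1 + q / p * (p * (t * x) * y)).
  exact: le_trans h1 (le_trans h2 h6).
have h8 : q / p * (p * (t * x) * y) = q * t * (x * y).
  by field; rewrite gt_eqF.
rewrite h8 mulrDr mulr1 lerD2l in h7.
have qt : 0 < q * t by rewrite mulr_gt0.
rewrite -(ler_pM2l qt) (_ : q * t * (j * x * y) = j * (q * t * (x * y))); last by ring.
by rewrite -[leLHS]mulrA; exact: h7.
Qed.

Lemma variation_bound_cvg (j X B : R) (x : nat -> R) : 
  x @ \oo --> X ->
  (forall k, B <= j * x k * (1 + p * (@harmonic R k * x k)) `^ (q / p - 1)) ->
  B <= j * X.
Proof.
move=> cx hB.
have c1 : 1 + p * (@harmonic R k * x k) @[k --> \oo] --> 1 + p * (0 * X).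
  apply: cvgD; first exact: cvg_cst.
  by apply: cvgMl_tmp; apply: cvgM => //; exact: cvg_harmonic.
rewrite mul0r mulr0 addr0 in c1.
have c2 := cvg_comp _ _ c1 (@powR_continuous_gt0 R (q / p - 1) _ ltr01).
rewrite powR1 in c2.
have c3 : j * x k * (1 + p * (@harmonic R k * x k)) `^ (q / p - 1) @[k --> \oo] --> j * X * 1.
  by apply: cvgM => //; exact: cvgMl_tmp.
rewrite mulr1 in c3.
rewrite -(cvg_lim (@Rhausdorff R) c3).
apply: limr_ge; last exact: nearW.
by apply/cvg_ex; eexists; exact: c3.
Qed.

Lemma Rintegral_lin_le (c : R) (f g h : E -> R) :
  leb.-integrable D (EFin \o f) -> leb.-integrable D (EFin \o g) ->
  leb.-integrable D (EFin \o h) -> (forall x, f x + c * g x <= h x) ->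
  \int[leb]_(x in D) f x + c * (\int[leb]_(x in D) g x) <= \int[leb]_(x in D) h x.
Proof.
move=> fi gi hi fgh; rewrite -[X in X + _]mul1r -(RintegralZB 1 c mD fi gi).
apply: (le_Rintegral mD (integrableZB 1 c mD fi gi) hi) => x _.
by rewrite mul1r.
Qed.

Lemma integrable_powR_fin (v : E -> R) (s a : R) : measurable_fun D v ->
  (\int[leb]_(x in D) (v x `^ s)%:E = a%:E)%E ->
  leb.-integrable D (EFin \o (fun x => v x `^ s)) /\ \int[leb]_(x in D) (v x `^ s) = a.
Proof.
move=> mv va.
have [i _] := ge0_integrable_fin (measurableT_comp (measurable_powR s) mv)
  (fun x => powR_ge0 _ _) (eq_ind_r (fun y => (y < +oo)%E) (ltry a) va).
by split; [exact: i|rewrite /Rintegral va].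
Qed.

Section variation.
Variables (u : E -> R[i]) (gu : E -> 'rV[R[i]]_n) (j : R).
Hypotheses (Wu : W01p D p u gu) (j0 : 0 < j).
Hypothesis hA : (\int[leb]_(x in D) (vnorm (gu x) `^ p)%:E = 1%:E)%E.
Hypothesis hj : (\int[leb]_(x in D) (normc (u x) `^ q)%:E = j%:E)%E.
Hypothesis hK : sobolev_const D q p = (j `^ q^-1)%:E.

Lemma pairing_test_integrable f : test_fun D f ->
  [/\ leb.-integrable D (EFin \o (fun x => pairing q (crow (u x)) (crow (f x)))),
      leb.-integrable D (EFin \o (fun x => pairing p (gu x) (grad f x))),
      forall k, leb.-integrable D (EFin \o
        (fun x => pairing p (gu x + (@harmonic R k)%:C *: grad f x) (grad f x))) &
      \int[leb]_(x in D) pairing p (gu x + (@harmonic R k)%:C *: grad f x) (grad f x)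
        @[k --> \oo] --> \int[leb]_(x in D) pairing p (gu x) (grad f x)].
Proof.
move=> tf; have [M M0 hM] := test_fun_bounded tf.
have [mu mgu] := W01p_cmeasurable Wu.
have mf := test_fun_cmeasurable D tf.
have mgf i := test_fun_grad_cmeasurable D i tf.
have fM x : vnorm (crow (f x)) <= M by rewrite vnorm_crow; have [] := hM x.
have gfM x : vnorm (grad f x) <= M by have [] := hM x.
have mcu i : cmeasurable D (fun x => crow (u x) ord0 i).
  by under eq_fun do rewrite mxE.
have mcf i : cmeasurable D (fun x => crow (f x) ord0 i).
  by under eq_fun do rewrite mxE.
have ufin : (\int[leb]_(x in D) (vnorm (crow (u x)) `^ q)%:E < +oo)%E.
  by under eq_integral do rewrite vnorm_crow; rewrite hj ltry.
have gfin : (\int[leb]_(x in D) (vnorm (gu x) `^ p)%:E < +oo)%E by rewrite hA ltry.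
have [iB _ _] := integral_pairing_cvg q1 oD bD mcu mcf ufin M0 fM.
by have [] := integral_pairing_cvg p1 oD bD mgu mgf gfin M0 gfM.
Qed.

(** Compare [u + t * f] with [u] in the Sobolev inequality, for [t = 1 / (k + 1)],
    and let [k] tend to infinity. *)
Lemma euler_lagrange_le f : test_fun D f ->
  \int[leb]_(x in D) pairing q (crow (u x)) (crow (f x)) <=
  j * (\int[leb]_(x in D) pairing p (gu x) (grad f x)).
Proof.
move=> tf; have [mu mgu] := W01p_cmeasurable Wu.
have [iB _ iA cA] := pairing_test_integrable tf.
set B := \int[leb]_(x in D) pairing q (crow (u x)) (crow (f x)).
apply: (variation_bound_cvg cA) => k.
set t := @harmonic R k; have t0 : 0 < t := harmonic_gt0 k.
set x := \int[leb]_(x in D) _.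
have ttf := test_funZ t%:C tf.
have Ww := W01p_add_test oD bD p1' Wu ttf.
have [a [l [ha hl a0 l0 _]]] := W01p_norms n0 oD bD p1 pq npq Ww.
have hS := sobolev_inequality n0 oD bD p1 pq npq Ww hK (ltW j0) ha hl.
have [mw mgw] := W01p_cmeasurable Ww.
have gwE y : grad (fun z => t%:C * f z) y = t%:C *: grad f y.
  exact: (gradZ _ _ tf).
have wE y : crow (u y + t%:C * f y) = crow (u y) + t%:C *: crow (f y).
  by apply/rowP => i; rewrite !mxE.
have [iu uE] := integrable_powR_fin (cmeasurable_normc mu) hj.
have [igu guE] := integrable_powR_fin (measurable_vnorm mgu) hA.
have [iw wE'] := integrable_powR_fin (cmeasurable_normc mw) hl.
have [igw gwE'] := integrable_powR_fin (measurable_vnorm mgw) ha.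
apply: (variation_bound t0 (ltW j0) _ hS a0).
  rewrite mulrA -uE -wE'; apply: (Rintegral_lin_le iu iB iw) => y.
  have := vnorm_powR_subgrad (crow (u y)) (t%:C *: crow (f y)) (ltW q1).
  by rewrite -/(pairing q _ _) pairingZr mulrA -wE !vnorm_crow.
suff : a + - (p * t) * x <= 1 by rewrite mulNr lerBlDr -mulrA.
rewrite -gwE' -guE; apply: (Rintegral_lin_le igw _ igu).
  exact: iA.
move=> y; rewrite gwE.
have := vnorm_powR_subgrad (gu y + t%:C *: grad f y) ((- t)%:C *: grad f y) p1'.
have tN : (- t)%:C *: grad f y = - (t%:C *: grad f y) by rewrite raddfN scaleNr.
by rewrite -/(pairing p _ _) pairingZr tN addrK mulNr mulrN -mulNr mulrA mulNr.
Qed.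

(** Both sides are linear in [f]: apply the inequality to [f] and [- f]. *)
Lemma euler_lagrange f : test_fun D f ->
  \int[leb]_(x in D) pairing q (crow (u x)) (crow (f x)) =
  j * (\int[leb]_(x in D) pairing p (gu x) (grad f x)).
Proof.
move=> tf; apply/eqP; rewrite eq_le (euler_lagrange_le tf)/=.
have tNf := test_funZ (-1)%:C tf.
have := euler_lagrange_le tNf.
have e1 x : pairing q (crow (u x)) (crow ((-1)%:C * f x)) =
    - 1 * pairing q (crow (u x)) (crow (f x)).
  by rewrite -pairingZr; congr pairing; apply/rowP => i; rewrite !mxE.
have e2 x : pairing p (gu x) (grad (fun y => (-1)%:C * f y) x) =
    - 1 * pairing p (gu x) (grad f x).
  by rewrite (gradZ _ _ tf) pairingZr.
under eq_Rintegral do rewrite e1.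
under [X in _ <= _ * X]eq_Rintegral do rewrite e2.
have [iB iA _ _] := pairing_test_integrable tf.
by rewrite (RintegralZl _ mD iB) (RintegralZl _ mD iA) mulrCA !mulN1r lerN2.
Qed.

End variation.
End euler_lagrange.

(** * The extremal potential *)
Section extremal_potential.
Variables (R : realType) (n : nat) (D : set 'rV[R]_n) (p q : R) (r : \bar R).
Local Notation E := 'rV[R]_n.
Local Notation leb := (lebesgue_rV R n).
Local Notation Re := complex.Re.
Local Notation Im := complex.Im.
Local Notation normc := ComplexField.Normc.normc.
Hypotheses (n0 : (0 < n)%N) (oD : open D) (bD : bounded_set D).
Hypotheses (p1 : 1 < p) (pq : p <= q) (npq : n%:R * (q - p) < p * q).
Hypotheses (r1 : (1 < r)%E) (pqr : (r^-1 + (p / q)%:E = 1)%E).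

Let mD : measurable D. Proof. exact: open_measurable_rV. Qed.
Let fD : (leb D < +oo)%E. Proof. exact: lebesgue_rV_bounded_lty. Qed.
Let p0 : 0 < p. Proof. exact: lt_trans p1. Qed.
Let q0 : 0 < q. Proof. exact: lt_le_trans pq. Qed.

Lemma normc_real (t : R) : normc t%:C = `|t|.
Proof. by rewrite /= expr0n/= addr0 sqrtr_sqr. Qed.

Lemma LnormD_cst_infty (v : R) : 0 <= v -> D !=set0 -> LnormD D +oo (fun=> v) = v%:E.
Proof.
move=> v0 D0; apply/eqP; rewrite eq_le; apply/andP; split.
  rewrite /LnormD unlock; case: ifPn => _; last by rewrite lee_fin.
  apply/ess_supP; apply: aeW => x /=.
  by rewrite patchE; case: ifPn => _ /=; rewrite ?normr0 ?ger0_norm// lee_fin.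
rewrite leNgt; apply/negP => lt_v.
have fin := ge0_lty_fin (Lnorm_ge0 _ _ _) (lt_trans lt_v (ltry v)).
have := @LnormD_infty_ae R n D (fun=> v) (fine (LnormD D +oo (fun=> v))).
rewrite fineK// => /(_ (lexx _)) [N [mN N0 subN]].
have DN : D `<=` N.
  move=> x Dx; apply: subN => /= /(_ Dx).
  by rewrite ger0_norm// leNgt lt_v.
have := lebesgue_rV_open_gt0 oD D0.
rewrite ltNge => /negP; apply; rewrite -N0.
by apply: le_measure => //; rewrite inE.
Qed.

Section extremal.
Variables (us : E -> R) (gus : E -> 'rV[R[i]]_n).
Local Notation u := (fun x => (us x)%:C).
Hypotheses (Wu : W01p D p u gus) (us0 : {ae leb, forall x, D x -> 0 <= us x}).
Hypotheses (hg : LnormDV D p%:E gus = 1%E) (hq : LnormD D q%:E us = sobolev_const D q p).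

Lemma extremal_norms : exists2 j : R, 0 < j &
  [/\ (\int[leb]_(x in D) (vnorm (gus x) `^ p)%:E = 1%:E)%E,
      (\int[leb]_(x in D) (normc (us x)%:C `^ q)%:E = j%:E)%E &
      sobolev_const D q p = (j `^ q^-1)%:E].
Proof.
have [A [j [hA hj A0 j0 [nA nj]]]] := W01p_norms n0 oD bD p1 pq npq Wu.
have A1 : A = 1.
  move: nA; rewrite hg => -[] A1.
  by rewrite -[LHS](powRr1 A0) -[X in _ `^ X](mulVf (lt0r_neq0 p0)) powRrM -A1 powR1.
have K : sobolev_const D q p = (j `^ q^-1)%:E.
  rewrite -hq -nj /LnormDC (LnormD_E D us q0) (LnormD_E D (fun x => normc (us x)%:C) q0).
  have -> // : (\int[leb]_(x in D) (`|us x| `^ q)%:E =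
      \int[leb]_(x in D) (`|normc (us x)%:C| `^ q)%:E)%E.
  by apply: eq_integral => x _; rewrite normc_real normr_id.
subst A; exists j => //.
rewrite lt0r j0 andbT; apply/negP => /eqP j00.
have : (0 < \int[leb]_(x in D) (vnorm (gus x) `^ p)%:E)%E by rewrite hA lte_fin.
move=> /(sobolev_const_gt0 n0 oD bD p1 pq npq Wu).
by rewrite K j00 powR0 ?ltxx// invr_eq0 gt_eqF.
Qed.

Let V (j : R) x := j^-1 * us x `^ (q - p).

Let mus : measurable_fun D us.
Proof. by have [[mr _] _] := W01p_cmeasurable Wu. Qed.

(** Up to a null set [V ^ r] is [us ^ q] divided by [j ^ r], because
    [(q - p) * r = q]; for [r = +oo] the potential is constant. *)
Lemma LnormD_extremal_potential (j : R) : 0 < j -> D !=set0 ->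
  (\int[leb]_(x in D) (normc (us x)%:C `^ q)%:E = j%:E)%E ->
  LnormD D r (V j) = (j `^ (- (p / q)))%:E.
Proof.
move=> j0 D0 hj.
case: r r1 pqr (fun r0 => @hoelder_exponent_fin _ p q r r1 pqr r0) (hoelder_exponent_infty p1 pq pqr) =>
  [r0| |] // _ e h1 h2; last first.
  have qp := h2 erefl.
  have -> : V j = fun=> j^-1 by apply/funext => x; rewrite /V qp subrr powRr0 mulr1.
  by rewrite LnormD_cst_infty ?invr_ge0 ?(ltW j0)// qp divff ?gt_eqF// powR_inv1 ?ltW.
have [r00 rpq] := h1 _ erefl; rewrite invf_div in rpq.
have eqr : (q - p) * r0 = q.
  have -> : p = q * (1 - r0^-1) by rewrite -rpq [r0^-1 + _]addrC addrK mulrC divfK// gt_eqF.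
  by field; rewrite gt_eqF.
have mW : measurable_fun D (fun x => us x `^ (q - p)).
  exact: (measurableT_comp (measurable_powR (q - p)) mus).
have mV : measurable_fun D (V j) by apply: measurable_funM.
rewrite (LnormD_E _ _ r00).
have -> : (\int[leb]_(x in D) (`|V j x| `^ r0)%:E =
    \int[leb]_(x in D) ((j^-1 `^ r0)%:E * (normc (us x)%:C `^ q)%:E))%E.
  apply: ge0_ae_eq_integral => //.
  - by apply: measurable_powR_EFin; exact: measurableT_comp.
  - apply: measurable_funeM; apply: measurable_powR_EFin.
    by under eq_fun do rewrite normc_real; exact: measurableT_comp.
  - by move=> x _; rewrite mule_ge0// lee_fin powR_ge0.
  move: us0; apply: filterS => x u0 Dx; rewrite -EFinM normc_real (ger0_norm (u0 Dx)).
  rewrite ger0_norm ?mulr_ge0 ?powR_ge0 ?invr_ge0 ?(ltW j0)// /V.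
  by rewrite powRM ?powR_ge0 ?invr_ge0 ?(ltW j0)// -powRrM eqr.
rewrite ge0_integralZl_EFin ?powR_ge0//; last 2 first.
- by move=> x _; rewrite lee_fin powR_ge0.
- apply: measurable_powR_EFin.
  by under eq_fun do rewrite normc_real; exact: measurableT_comp.
rewrite hj -EFinM poweR_EFin; congr EFin.
rewrite powRM ?powR_ge0 ?(ltW j0)// -powRrM mulfV ?gt_eqF// powRr1 ?invr_ge0 ?(ltW j0)//.
rewrite -(powR_inv1 (ltW j0)) -powRD; last by rewrite (gt_eqF j0) implybT.
by congr (_ `^ _); rewrite -rpq; ring.
Qed.

Lemma in_Lp_extremal_potential (j : R) : 0 < j -> D !=set0 ->
  (\int[leb]_(x in D) (normc (us x)%:C `^ q)%:E = j%:E)%E -> in_Lp D r (V j).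
Proof.
move=> j0 D0 hj; split; last by rewrite (LnormD_extremal_potential j0 D0 hj) ltry.
apply: measurable_funM; first exact: measurable_cst.
exact: (measurableT_comp (measurable_powR (q - p)) mus).
Qed.

Lemma sobolev_extremal_equality (j : R) : 0 < j -> D !=set0 ->
  (\int[leb]_(x in D) (normc (us x)%:C `^ q)%:E = j%:E)%E ->
  sobolev_const D q p = (j `^ q^-1)%:E ->
  (sobolev_const D q p `^ p * LnormD D r ((V j)^\+)%R = 1)%E.
Proof.
move=> j0 D0 hj ->.
have -> : ((V j)^\+)%R = V j.
  apply/funext => x; rewrite /funrpos max_l// /V.
  by rewrite mulr_ge0 ?powR_ge0 ?invr_ge0 ?(ltW j0).
rewrite (LnormD_extremal_potential j0 D0 hj) poweR_EFin -EFinM -powRrM -powRD; last first.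
  by rewrite (gt_eqF j0) implybT.
by rewrite mulrC subrr powRr0.
Qed.

(** For a nonnegative value the potential term of the equation is the pairing of
    the Euler-Lagrange equation. *)
Lemma potential_term_ge0 (j t : R) : 0 <= t ->
  j^-1 * t `^ (q - p) * normc t%:C `^ (p - 2) * t = j^-1 * (normc t%:C `^ (q - 2) * t).
Proof.
move=> t0; rewrite normc_real (ger0_norm t0).
have [->|tN0] := eqVneq t 0; first by rewrite !mulr0.
rewrite -!mulrA; congr (_ * _); rewrite mulrA -powRD ?tN0 ?implybT//.
by congr (_ `^ _ * _); ring.
Qed.

(** A negative [t] has [t ^ (q - p) = 1], so that the bound on the null set where
    [us] is negative comes from the exponent [p - 1 <= q]. *)
Lemma potential_term_le (j t : R) : 0 < j ->
  `|j^-1 * t `^ (q - p) * normc t%:C `^ (p - 2) * t| <= j^-1 * (1 + normc t%:C `^ q).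
Proof.
move=> j0; rewrite normc_real.
rewrite !normrM !(ger0_norm (powR_ge0 _ _)) (ger0_norm (ltW _)) ?invr_gt0//.
rewrite -!mulrA ler_pM2l ?invr_gt0// (powR_mulB2 (normr_ge0 t) p1).
have [t0|t0] := leP 0 t.
  rewrite (ger0_norm t0); have [->|tN0] := eqVneq t 0.
    by rewrite [X in _ * X]powR0 ?mulr0 ?addr_ge0 ?powR_ge0// gt_eqF// subr_gt0.
  rewrite -powRD ?tN0 ?implybT//; apply: powR_le1D => //; last by lra.
  by move: p1 pq; lra.
have -> : t `^ (q - p) = 1 by rewrite lt0_powR1.
rewrite mul1r; apply: powR_le1D => //; last by move: pq; lra.
by rewrite subr_ge0 ltW.
Qed.

Let lhs (f : E -> R[i]) x := (vnorm (gus x) `^ (p - 2))%:C * dotC (gus x) (grad f x).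
Let rhs j (f : E -> R[i]) x := (V j x * normc (us x)%:C `^ (p - 2))%:C * (us x)%:C * f x.

Lemma cmeasurable_real (f : E -> R) : measurable_fun D f -> cmeasurable D (fun x => (f x)%:C).
Proof. by move=> mf; split => //; exact: measurable_cst. Qed.

Lemma cmeasurable_sum (I : Type) (s : seq I) (f : I -> E -> R[i]) :
  (forall i, cmeasurable D (f i)) -> cmeasurable D (fun x => \sum_(i <- s) f i x).
Proof.
move=> mf; elim: s => [|a s IH].
  by under eq_fun do rewrite big_nil; exact: cmeasurable_cst.
by under eq_fun do rewrite big_cons; exact: cmeasurableD.
Qed.

Lemma extremal_lhs_integrable f : test_fun D f ->
  (\int[leb]_(x in D) (vnorm (gus x) `^ p)%:E = 1%:E)%E -> cintegrable D (lhs f).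
Proof.
move=> tf hA; have [M M0 hM] := test_fun_bounded tf.
have [mu mgu] := W01p_cmeasurable Wu.
have mgf i := test_fun_grad_cmeasurable D i tf.
have [igu _] := integrable_powR_fin (measurable_vnorm mgu) hA.
have i1 := integrable_cst_in 1 mD fD.
have iG := integrableZB M M mD i1 igu.
have b (s : R) x : `|s| <= vnorm (gus x) * vnorm (grad f x) ->
    `|vnorm (gus x) `^ (p - 2) * s| <= M * 1 + M * vnorm (gus x) `^ p.
  move=> hs; rewrite normrM (ger0_norm (powR_ge0 _ _)) -mulrDr mulrC.
  apply: (le_trans (ler_wpM2r (powR_ge0 _ _) hs)).
  have [_ gM] := hM x.
  rewrite mulrAC [vnorm _ * _]mulrC powR_mulB2 ?vnorm_ge0// mulrC.
  apply: ler_pM; rewrite ?vnorm_ge0 ?powR_ge0//.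
  apply: powR_le1D; rewrite ?vnorm_ge0 ?subr_ge0 ?(ltW p1)//.
  by rewrite lerBlDr lerDl.
apply: (cintegrable_le mD _ iG).
- apply: cmeasurableM.
    apply: cmeasurable_real.
    exact: (measurableT_comp (measurable_powR _) (measurable_vnorm mgu)).
  by apply: cmeasurable_sum => i; exact: cmeasurableM.
- by move=> x _; rewrite ReZ; apply: b; exact: Re_dotC_le.
- by move=> x _; rewrite ImZ; apply: b; exact: Im_dotC_le.
Qed.

Lemma extremal_rhs_integrable j f : 0 < j -> test_fun D f ->
  (\int[leb]_(x in D) (normc (us x)%:C `^ q)%:E = j%:E)%E -> cintegrable D (rhs j f).
Proof.
move=> j0 tf hj; have [M M0 hM] := test_fun_bounded tf.
have [mu mgu] := W01p_cmeasurable Wu.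
have mf := test_fun_cmeasurable D tf.
have [iu _] := integrable_powR_fin (cmeasurable_normc mu) hj.
have i1 := integrable_cst_in 1 mD fD.
have iG := integrableZB (j^-1 * M) (j^-1 * M) mD i1 iu.
have b (s : R) x : `|s| <= M ->
    `|V j x * normc (us x)%:C `^ (p - 2) * us x * s| <=
    j^-1 * M * 1 + j^-1 * M * normc (us x)%:C `^ q.
  move=> sM; rewrite normrM -mulrDr [leRHS]mulrAC.
  apply: ler_pM => //; exact: potential_term_le.
have rE x : rhs j f x = (V j x * normc (us x)%:C `^ (p - 2) * us x)%:C * f x.
  by rewrite /rhs -rmorphM.
apply: (cintegrable_le mD _ iG).
- apply: cmeasurableM => //; apply: cmeasurableM => //; apply: cmeasurable_real.
  apply: measurable_funM.
    apply: measurable_funM; first exact: measurable_cst.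
    exact: (measurableT_comp (measurable_powR (q - p)) mus).
  exact: (measurableT_comp (measurable_powR (p - 2)) (cmeasurable_normc mu)).
- move=> x _; rewrite rE ReZ; apply: b; have [fM _] := hM x.
  exact: le_trans (normr_Re_le _) fM.
- move=> x _; rewrite rE ImZ; apply: b; have [fM _] := hM x.
  exact: le_trans (normr_Im_le _) fM.
Qed.

(** The Euler-Lagrange equation for the conjugate of [f], since the equation is
    bilinear whereas the pairing conjugates its second argument. *)
Lemma extremal_Re_equation j f : 0 < j -> test_fun D f ->
  (\int[leb]_(x in D) (vnorm (gus x) `^ p)%:E = 1%:E)%E ->
  (\int[leb]_(x in D) (normc (us x)%:C `^ q)%:E = j%:E)%E ->
  sobolev_const D q p = (j `^ q^-1)%:E ->
  \int[leb]_(x in D) Re (lhs f x) = \int[leb]_(x in D) Re (rhs j f x).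
Proof.
move=> j0 tf hA hj hK; have tJ := test_funJ tf.
have fJ : f = (fun y => ((f y)^*)^*) by apply/funext => y; rewrite conjcK.
have [iB iA _ _] := pairing_test_integrable oD bD p1 pq Wu hA hj tJ.
have EL := euler_lagrange n0 oD bD p1 pq npq Wu j0 hA hj hK tJ.
have -> : \int[leb]_(x in D) Re (lhs f x) =
    \int[leb]_(x in D) pairing p (gus x) (grad (fun y => (f y)^*) x).
  by apply: eq_Rintegral => x _; rewrite /lhs {1}fJ (Re_gradient_pairing _ _ _ tJ).
have -> : \int[leb]_(x in D) Re (rhs j f x) =
    \int[leb]_(x in D) (j^-1 * pairing q (crow (us x)%:C) (crow (f x)^*)).
  have [ir _] := extremal_rhs_integrable j0 tf hj.
  rewrite /Rintegral; congr fine; apply: ae_eq_integral => //.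
  - by have /integrableP[] := ir.
  - by have /integrableP[] := integrableZl mD j^-1 iB.
  move: us0; apply: filterS => x u0 Dx; congr EFin.
  rewrite /rhs -rmorphM ReZ (potential_term_ge0 _ (u0 Dx)).
  rewrite /pairing vnorm_crow rdot_crow ReZ !mulrA.
  by case: (f x).
by rewrite (RintegralZl _ mD iB) EL mulrA mulVf ?mul1r// gt_eqF.
Qed.

Lemma extremal_solution j : 0 < j ->
  (\int[leb]_(x in D) (vnorm (gus x) `^ p)%:E = 1%:E)%E ->
  (\int[leb]_(x in D) (normc (us x)%:C `^ q)%:E = j%:E)%E ->
  sobolev_const D q p = (j `^ q^-1)%:E -> plaplace_sol D p (V j) u gus.
Proof.
move=> j0 hA hj hK f tf.
have eqRe g (tg : test_fun D g) := extremal_Re_equation j0 tg hA hj hK.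
split.
- exact: extremal_lhs_integrable.
- exact: extremal_rhs_integrable.
(* The imaginary part at [f] is the real part at [- i * f]. *)
pose c : R[i] := 0 -i* 1.
have ReC (z : R[i]) : Re (c * z) = Im z by case: z => a b /=; ring.
have tcf := test_funZ c tf.
have lhsC x : Re (lhs (fun y => c * f y) x) = Im (lhs f x).
  rewrite -ReC /lhs (gradZ _ _ tf) [in RHS]mulrCA; congr (Re (_ * _)).
  by rewrite /dotC mulr_sumr; apply: eq_bigr => i _; rewrite mxE mulrCA.
have rhsC x : Re (rhs j (fun y => c * f y) x) = Im (rhs j f x).
  by rewrite -ReC /rhs mulrCA.
have := eqRe _ tcf.
under eq_Rintegral do rewrite lhsC.
under [in X in _ = X -> _]eq_Rintegral do rewrite rhsC.
by move=> eI; rewrite /cintegral -/(lhs f) -/(rhs j f) (eqRe _ tf) eI.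
Qed.

End extremal.
End extremal_potential.

(** * Sharp lower bound for the potential *)

Theorem theorem2p2 (R : realType) (n : nat) (D : set 'rV[R]_n)
    (p q : R) (r : \bar R)
    (n_gt0 : (0 < n)%N) (openD : open D) (boundedD : bounded_set D)
    (p_gt1 : 1 < p) (r_gt : (maxe 1 (n%:R / p)%:E < r)%E)
    (q_ge : p <= q) (pqr : (r^-1 + (p / q)%:E = 1)%E) :
  (forall (V : 'rV[R]_n -> R) (u : 'rV[R]_n -> R[i])
      (gu : 'rV[R]_n -> 'rV[R[i]]_n),
    in_Lp D r V -> W01p D p u gu -> ~ ae_zero D u ->
    plaplace_sol D p V u gu ->
    (1 <= sobolev_const D q p `^ p * LnormD D r (V^\+)%R)%E)
  /\
  (forall (us : 'rV[R]_n -> R) (gus : 'rV[R]_n -> 'rV[R[i]]_n),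
    W01p D p (fun x => (us x)%:C) gus ->
    {ae lebesgue_rV R n, forall x, D x -> 0 <= us x} ->
    LnormDV D p%:E gus = 1%E ->
    LnormD D q%:E us = sobolev_const D q p ->
    let c := (fine (LnormD D q%:E us) `^ q)^-1 in
    let V := fun x => c * us x `^ (q - p) in
    [/\ in_Lp D r V,
        plaplace_sol D p V (fun x => (us x)%:C) gus &
        (sobolev_const D q p `^ p * LnormD D r (V^\+)%R = 1)%E]).
Proof.
have [r_gt1 npq] := subcritical_exponents p_gt1 q_ge r_gt pqr.
split=> [V u gu | us gus Wu us0 hg hq].
  exact: (solution_lower_bound n_gt0 openD boundedD p_gt1 q_ge npq r_gt1 pqr).
have [j j0 [hA hj hK]] := extremal_norms n_gt0 openD boundedD p_gt1 q_ge npq Wu hg hq.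
have -> : fine (LnormD D q%:E us) `^ q = j.
  have q0 : 0 < q by rewrite (lt_le_trans _ q_ge)// (lt_trans _ p_gt1).
  by rewrite hq hK /= -powRrM mulVf ?gt_eqF// powRr1 ?ltW.
have D0 : D !=set0.
  by apply/set0P/eqP => D0; move: hA; rewrite D0 integral_set0 => -[] /eqP; rewrite eq_sym oner_eq0.
move=> c V; split.
- exact: (in_Lp_extremal_potential openD p_gt1 q_ge r_gt1 pqr Wu us0 j0 D0 hj).
- exact: (extremal_solution n_gt0 openD boundedD p_gt1 q_ge npq Wu us0 j0 hA hj hK).
- exact: (sobolev_extremal_equality openD p_gt1 q_ge r_gt1 pqr Wu us0 j0 D0 hj hK).
Qed.
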